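(* Fix $t\in\mathbb{R}$ and let $\alpha_{i,n}$ denote the $i$th local level of the one-sided HC test with critical values $h_{i,n}(d_n(t))$, $i=1,\dots,n$. Let $(i_n^{(1)})$ and $(i_n^{(2)})$ be non-decreasing sequences of ranks, each belonging to one of the classes $A_c$ ($c\ge0$), $B_0$, $B_c$ ($c>0$), $C$, $\bar B_c$ ($c>0$), $\bar B_0$, $\bar A_c$ ($c\ge 0$), with $i_n^{(1)}<i_n^{(2)}$ for all $n\in\mathbb{N}$. Then $$\lim_{n\to\infty}\alpha_{i_n^{(2)},n}/\alpha_{i_n^{(1)},n}=1$$ if the tuple $(i_n^{(1)},i_n^{(2)})$ satisfies one of: (i) $(i_n^{(1)},i_n^{(2)})\in C\times C$; (ii) $(i_n^{(1)},i_n^{(2)})\in B_c\times B_c$ for some $c>0$; (iii) $(i_n^{(1)},i_n^{(2)})\in \bar B_c\times\bar B_c$ for some $c>0$; (iv) $(i_n^{(1)},i_n^{(2)})\in B_0\times B_0$ and $i_n^{(1)}/i_n^{(2)}=1+o\bigl(\sqrt{i_n^{(1)}/u_n^3}\bigr)$; (v) $(i_n^{(1)},i_n^{(2)})\in\bar B_0\times\bar B_0$ and $(n-i_n^{(2)})/(n-i_n^{(1)})=1+o\bigl(\sqrt{(n-i_n^{(2)})/u_n^3}\bigr)$. Moreover, $$0<\lim_{n\to\infty}\alpha_{i_n^{(2)},n}/\alpha_{i_n^{(1)},n}<1$$ if one of the following conditions is satisfied: (vi) $(i_n^{(1)},i_n^{(2)})\in B_{c_1}\times(B_{c_2}\cup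 C\cup\bar B_c)$, where $c_1,c_2,c>0$ and $c_1<c_2$; (vii) $(i_n^{(1)},i_n^{(2)})\in(C\cup\bar B_{c_1})\times\bar B_{c_2}$, where $c_1,c_2>0$ and $c_2<c_1$; (viii) $(i_n^{(1)},i_n^{(2)})\in B_0\times B_0$ and $i_n^{(1)}/i_n^{(2)}=1-c_n\sqrt{i_n^{(1)}/u_n^3}$ with $c_n\to c>0$; (ix) $(i_n^{(1)},i_n^{(2)})\in\bar B_0\times\bar B_0$ and $(n-i_n^{(2)})/(n-i_n^{(1)})=1-c_n\sqrt{(n-i_n^{(2)})/u_n^3}$ with $c_n\to c>0$; (x) $(i_n^{(1)},i_n^{(2)})\in A_c\times A_c$ with $c>0$ and, for some $m\in\mathbb{N}$, $i_n^{(2)}-i_n^{(1)}=m$ for all sufficiently large $n$; (xi) $(i_n^{(1)},i_n^{(2)})\in\bar A_c\times\bar A_c$ with $c>0$ and, for some $m\in\mathbb{N}$, $i_n^{(2)}-i_n^{(1)}=m$ for all sufficiently large $n$. Finally, $$\lim_{n\to\infty}\alpha_{i_n^{(2)},n}/\alpha_{i_n^{(1)},n}=0$$ for all other such tuples (satisfying none of (i)-(xi)) whenever this limit exists.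
   Context: Let $u_n=\log(\log(n))$ and, for fixed $t\in\mathbb{R}$, $d_n(t)=\bigl(t+2u_n+(\log(u_n)-\log(\pi))/2\bigr)/\sqrt{2u_n}$ (everything is considered for $n$ large enough to be defined with $d_n(t)\ge1$). For $1\le i\le n$ let $$h_{i,n}(d)=\frac{d^2+2i-d\sqrt{d^2+4i-4i^2/n}}{2(d^2+n)}.$$ The local levels of the one-sided higher criticism (HC) test based on $d_n(t)$ are $\alpha_{i,n}=\mathbb{P}(U_{i:n}<h_{i,n}(d_n(t)))=\mathbb{P}(Z_n\ge i)$, where $U_{i:n}$ is the $i$th order statistic of $n$ i.i.d. uniform random variables on $[0,1]$ and $Z_n$ is binomial with parameters $n$ and $h_{i,n}(d_n(t))$. Classes of sequences of ranks $i_n\in\{1,\dots,n\}$ (all limits as $n\to\infty$): $A_c$: $i_n/u_n\to c$; $B_0$: $i_n/u_n\to\infty$ and $i_n/u_n^3\to0$; $B_c$ ($c>0$): $i_n/u_n^3\to c$; $C$: $i_n(1-i_n/n)/u_n^3\to\infty$; $\bar B_c$ ($c>0$): $(n-i_n)/u_n^3\to c$; $\bar B_0$: $(n-i_n)/u_n\to\infty$ and $(n-i_n)/u_n^3\to0$; $\bar A_c$: $(n-i_n)/u_n\to c$. Products such as $B_{c_1}\times(B_{c_2}\cup C\cup\bar B_c)$ mean that the first sequence belongs to the first class and the second sequence to one of the listed classes; in (vi) and (vii) the inequality between $c_1$ and $c_2$ is relevant only when both indices occur, i.e. for pairs in $B_{c_1}\times B_{c_2}$ and $\bar B_{c_1}\times\bar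 B_{c_2}$ respectively. *)

(* Defs.v *)
From HB Require Import structures.
From mathcomp Require Import all_boot all_order all_algebra.
From mathcomp Require Import all_classical all_reals all_analysis.
Set Implicit Arguments.
Unset Strict Implicit.
Unset Printing Implicit Defensive.
Import Order.TTheory GRing.Theory Num.Theory.
Import numFieldNormedType.Exports.
Local Open Scope classical_set_scope.
Local Open Scope ring_scope.

Section UniformSample.
Context {R : realType} {d : measure_display} {T : measurableType d}.
Context {P : probability T R}.

Definition mutually_independent (n : nat) (X : 'I_n -> {RV P >-> R}) : Prop :=
  forall (J : {set 'I_n}) (A : 'I_n -> set R),
    (forall j, measurable (A j)) ->
    P (\bigcap_(j in [set j | j \in J]) (X j @^-1` A j)) =
    (\prod_(j in J) P (X j @^-1` A j))%E.

Definition uniform01 (X : {RV P >-> R}) : Prop :=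
  forall A : set R, measurable A ->
    distribution P X A = uniform_prob (@ltr01 R) A.

Definition iid_uniform01 (n : nat) (X : 'I_n -> {RV P >-> R}) : Prop :=
  mutually_independent X /\ forall j, uniform01 (X j).

End UniformSample.

(* Ranks start at 1: [order_stat x 1] is the minimum of the sample [x] and
   [order_stat x n] its maximum. *)
Definition order_stat {R : realType} (n : nat) (x : 'I_n -> R) (i : nat) : R :=
  nth 0 (sort <=%R [seq x j | j <- enum 'I_n]) i.-1.

Section HigherCriticism.
Context {R : realType}.

(* [ln] is 0 outside the positive reals, so [u n] and [dHC t n] only have their
   intended values for large [n]. *)
Definition u (n : nat) : R := ln (ln n%:R).

Definition dHC (t : R) (n : nat) : R :=
  (t + 2 * u n + (ln (u n) - ln pi) / 2) / Num.sqrt (2 * u n).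

Definition hHC (n i : nat) (d : R) : R :=
  (d ^+ 2 + 2 * i%:R
     - d * Num.sqrt (d ^+ 2 + 4 * i%:R - 4 * i%:R ^+ 2 / n%:R))
  / (2 * (d ^+ 2 + n%:R)).

Definition local_level {d : measure_display} {T : measurableType d}
    {P : probability T R} (n : nat) (U : 'I_n -> {RV P >-> R}) (t : R)
    (i : nat) : R :=
  fine (P [set w | order_stat (fun j => U j w) i < hHC n i (dHC t n)]).

Implicit Types (c : R) (i : nat -> nat).

(* The number of ranks above [i n], as a real number. *)
Definition corank i (n : nat) : R := n%:R - (i n)%:R.

Definition classA c i := (i n)%:R / u n @[n --> \oo] --> c.

Definition classB0 i :=
  (i n)%:R / u n @[n --> \oo] --> +oo /\
  (i n)%:R / u n ^+ 3 @[n --> \oo] --> (0 : R).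

Definition classB c i := (i n)%:R / u n ^+ 3 @[n --> \oo] --> c.

Definition classC i :=
  (i n)%:R * (1 - (i n)%:R / n%:R) / u n ^+ 3 @[n --> \oo] --> +oo.

Definition classBbar c i := corank i n / u n ^+ 3 @[n --> \oo] --> c.

Definition classBbar0 i :=
  corank i n / u n @[n --> \oo] --> +oo /\
  corank i n / u n ^+ 3 @[n --> \oo] --> (0 : R).

Definition classAbar c i := corank i n / u n @[n --> \oo] --> c.

Inductive classified i : Prop :=
| Classified_A c of 0 <= c & classA c i
| Classified_B0 of classB0 i
| Classified_B c of 0 < c & classB c i
| Classified_C of classC i
| Classified_Bbar c of 0 < c & classBbar c i
| Classified_Bbar0 of classBbar0 i
| Classified_Abar c of 0 <= c & classAbar c i.

(* The constraints start at [n = 2]: for [n = 1] the only rank is 1, so two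
   distinct ranks do not exist. *)
Definition nondecreasing_ranks i : Prop :=
  forall m n : nat, (2 <= m)%N -> (m <= n)%N -> (i m <= i n)%N.

Definition ordered_ranks (i1 i2 : nat -> nat) : Prop :=
  forall n : nat, (2 <= n)%N -> [/\ (1 <= i1 n)%N, (i1 n < i2 n)%N & (i2 n <= n)%N].

Inductive negligible_gap (i1 i2 : nat -> nat) : Prop :=
| Gap0_C of classC i1 & classC i2
| Gap0_B c of 0 < c & classB c i1 & classB c i2
| Gap0_Bbar c of 0 < c & classBbar c i1 & classBbar c i2
| Gap0_B0 of classB0 i1 & classB0 i2 &
    ((fun n => (i1 n)%:R / (i2 n)%:R : R) =
      cst 1 +o_\oo (fun n => Num.sqrt ((i1 n)%:R / u n ^+ 3)))
| Gap0_Bbar0 of classBbar0 i1 & classBbar0 i2 &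
    ((fun n => corank i2 n / corank i1 n) =
      cst 1 +o_\oo (fun n => Num.sqrt (corank i2 n / u n ^+ 3))).

Inductive critical_gap (i1 i2 : nat -> nat) : Prop :=
| Gap1_B_B c1 c2 of 0 < c1 & c1 < c2 & classB c1 i1 & classB c2 i2
| Gap1_B_C c1 of 0 < c1 & classB c1 i1 & classC i2
| Gap1_B_Bbar c1 c of 0 < c1 & 0 < c & classB c1 i1 & classBbar c i2
| Gap1_C_Bbar c2 of 0 < c2 & classC i1 & classBbar c2 i2
| Gap1_Bbar_Bbar c1 c2 of 0 < c2 & c2 < c1 & classBbar c1 i1 & classBbar c2 i2
| Gap1_B0 (a : nat -> R) c of classB0 i1 & classB0 i2 &
    (\forall n \near \oo,
      (i1 n)%:R / (i2 n)%:R = 1 - a n * Num.sqrt ((i1 n)%:R / u n ^+ 3)) &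
    a @ \oo --> c & 0 < c
| Gap1_Bbar0 (a : nat -> R) c of classBbar0 i1 & classBbar0 i2 &
    (\forall n \near \oo,
      corank i2 n / corank i1 n = 1 - a n * Num.sqrt (corank i2 n / u n ^+ 3)) &
    a @ \oo --> c & 0 < c
| Gap1_A c (m : nat) of 0 < c & classA c i1 & classA c i2 &
    (\forall n \near \oo, i2 n = i1 n + m)%N
| Gap1_Abar c (m : nat) of 0 < c & classAbar c i1 & classAbar c i2 &
    (\forall n \near \oo, i2 n = i1 n + m)%N.

End HigherCriticism.

Arguments classified : clear implicits.
Arguments negligible_gap : clear implicits.
Arguments critical_gap : clear implicits.

(* Main.v *)
Require Import Defs.
From HB Require Import structures.
From mathcomp Require Import all_boot all_order all_algebra.
From mathcomp Require Import all_classical all_reals all_analysis.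
From mathcomp Require Import ring lra.
Import Order.TTheory GRing.Theory Num.Theory.
Import numFieldNormedType.Exports.
Local Open Scope classical_set_scope.
Local Open Scope ring_scope.

Set Implicit Arguments.
Unset Strict Implicit.
Unset Printing Implicit Defensive.

(** The level of rank i is the binomial tail P(Bin(n, h) >= i) at the critical value
    h = hHC n i d, and h is the root of (i - n h)^2 = d^2 n h (1 - h) for which i exceeds the
    mean: every rank lies exactly d standard deviations above its mean. The ratio of two levels is
    therefore decided by second-order effects, and the point is to find coordinates in which these
    are visible.

    Coordinates. Let a = (i - n h) / (n h) and b = (i - n h) / (n (1 - h)) be the gaps of the
    rank. Their product is eps = d^2 / n for every rank (gapsP), and each satisfies a quadratic
    equation of its own (gap_eqs): i (a^2 + eps) = d^2 (1 + a) and (n - i) (b^2 + eps) =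
    d^2 (1 - b). Since d^2 is about 2 ln ln n, every power of d is negligible against n
    (dHC_pow_div_cvg0), so eps can be treated as 0 and the class of a sequence of ranks turns into
    a limit of a, b, d^2 a and d^2 b.

    One level. Mills' inequalities for the binomial tail (binomial_tail_mills) and Stirling's
    formula give the level uniformly in i < n, up to Stirling errors and a factor between 1 and 1
    + d^-2, as e^(- d^2 rate a b) sqrt ((1 + a) / (1 - b)) / d (binomial_tail_bounds), where
    rate a b is the integral over [0, 1] of (1 - x) / ((1 + a x) (1 - b x)).

    Two levels. Because a b = eps is common to all ranks, (1 + a x) (1 - b x) = 1 + s x - eps x^2
    depends on the rank only through the shift s = a - b. The rates of two ranks hence differ by
    (s1 - s2) times the integral of x (1 - x) / (Q1 Q2), Q1 and Q2 being the two quadratics. If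
    the gaps of both ranks tend to common limits with b away from 1, that integral converges
    (slope_ratio_cvg) to a positive number K, so that the ratio of the levels tends to
    e^(- K lambda) exactly when the shift gap d^2 (s1 - s2) tends to lambda (level_ratio_cvg,
    level_ratio_cvg0, shift_gap_cvg). The three kinds of limit are lambda = 0, 0 < lambda < oo and
    lambda = oo.

    What remains is to compute shift gaps. For classes B, C and Bbar, d^2 a and d^2 b converge and
    the shift gap is read off. For B0 and Bbar0 the difference of the gaps is, up to a constant,
    the relative difference of the ranks in units of sqrt (i / u^3) (rank_quotientE); for A and
    Abar with positive c it is proportional to the difference of the ranks, an integer
    (rank_diff_cvg). This settles the first two claims. For the last one, 1 / (2 + s) has a limit
    in every class; different limits make the rates differ by a multiple of d^2 and the ratio
    tends to 0 (level_ratio_separated). With equal limits, a nonzero limit of the ratio makes the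
    shift gap converge and thereby puts the pair in one of the cases excluded. There remain the
    extreme ranks of order o(u) at either end, where the gaps tend to (oo, 0) or (0, 1), the
    slopes degenerate, and the ratio tends to 0 by direct estimates (level_ratio_bottom,
    level_ratio_top). *)

(** * Local levels are binomial tails *)

Definition binomial_tail {R : realType} (n i : nat) (p : R) : R :=
  \sum_(i <= k < n.+1) binomial_pmf n p k.

(** In a sorted list the entries below y form a prefix, so the entry of rank i is below y iff
    this prefix has length at least i. *)
Lemma order_stat_ltE {R : realType} (n : nat) (x : 'I_n -> R) (i : nat) (y : R) :
  (0 < i <= n)%N ->
  (order_stat x i < y) = (i <= #|[set j | (x j < y)%R]%SET|)%N.
Proof.
case: i => [//|i] /andP[_ lein]; rewrite /order_stat /=.
set s := [seq x j | j <- enum 'I_n].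
have sz : size (sort <=%R s) = n by rewrite size_sort size_map size_enum_ord.
have ss : sorted <=%O (sort <=%R s) by apply: sort_sorted => u v; exact: le_total.
have -> : #|[set j | (x j < y)%R]%SET| = count (< y) (sort <=%R s).
  rewrite count_sort /s count_map -size_filter cardE; congr size.
  by rewrite enumT /enum_mem; apply: eq_filter => j; rewrite /= !inE.
apply/idP/idP => [lty|lei].
  rewrite ltnNge; apply/negP => lec.
  have := @nth_count_ge _ _ y 0 (sort <=%R s) i ss.
  by rewrite sz lec lein => /(_ isT); rewrite leNgt lty.
by have := @nth_count_lt _ _ y 0 (sort <=%R s) i ss lei.
Qed.

Lemma measurable_lt_set {R : realType} (y : R) : measurable [set z : R | z < y].
Proof. by rewrite -[X in measurable X]set_itvNyo; exact: measurable_itv. Qed.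

Section level.
Context {R : realType} {d : measure_display} {T : measurableType d}.
Context {P : probability T R}.

Lemma uniform01_ltE (X : {RV P >-> R}) (y : R) : uniform01 X -> 0 <= y <= 1 ->
  P (X @^-1` [set z | z < y]) = y%:E.
Proof.
move=> uX /andP[y0 y1].
have mA := measurable_lt_set y.
rewrite -[LHS]/(distribution P X _) (uX _ mA) /uniform_prob.
rewrite integral_uniform_pdf.
rewrite (eq_integral (fun=> 1%:E)); last first.
  move=> z; rewrite inE/= => -[_]; rewrite in_itv/= => z01.
  by rewrite /uniform_pdf z01 subr0 invr1.
rewrite integral_cst ?mul1e; last exact: measurableI.
have -> : [set z : R | z < y] `&` [set` `[0%R, 1%R]] = `[0%R, y[%classic.
  apply/seteqP; split => z; rewrite /= !in_itv/=; first by move=> [-> /andP[->]].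
  by move=> /andP[-> zy]; rewrite zy (ltW (lt_le_trans zy y1)).
rewrite [LHS](_ : _ = lebesgue_measure (`[0%R, y[%classic : set R)); last by [].
rewrite lebesgue_measure_itv/= lte_fin; case: ltP => [_|y0']; first by rewrite sube0.
by congr EFin; apply/eqP; rewrite eq_le y0 y0'.
Qed.

Lemma exact_setE (n : nat) (X : 'I_n -> {RV P >-> R}) (y : R) (J : {set 'I_n}) :
  [set w | [set j | X j w < y]%SET = J] =
  \bigcap_(j in [set j | j \in [set: 'I_n]%SET])
    (X j @^-1` (if j \in J then [set z | z < y] else ~` [set z | z < y])).
Proof.
apply/seteqP; split => w /=.
  by move=> <- j _; rewrite inE; case: ifP => //= /negbT/negP.
move=> wA; apply/setP => j; rewrite inE.
by have := wA j; rewrite /= inE => /(_ isT); case: ifP => //= _ /negP/negbTE.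
Qed.

(** An intersection of independent events, one for each index: of probability y for the indices
    in J and 1 - y for the others. *)
Lemma prob_exact_set (n : nat) (X : 'I_n -> {RV P >-> R}) (y : R)
    (J : {set 'I_n}) : iid_uniform01 X -> 0 <= y <= 1 ->
  P [set w | [set j | X j w < y]%SET = J] = (y ^+ #|J| * (1 - y) ^+ (n - #|J|))%:E.
Proof.
move=> [indX uX] y01; rewrite exact_setE indX; last first.
  by move=> j; case: ifP => // _; [|apply: measurableC]; exact: measurable_lt_set.
rewrite (eq_bigr (fun j => (if j \in J then y else 1 - y)%:E)); last first.
  move=> j _; case: ifP => _; first exact: uniform01_ltE.
  have mX := @measurable_funPTI _ _ _ _ (X j) _ (measurable_lt_set y).
  by rewrite preimage_setC (probability_setC P mX) uniform01_ltE.
rewrite -(big_morph EFin EFinM (erefl 1%:E)); congr EFin.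
under eq_bigl do rewrite inE.
rewrite (bigID (mem J))/= (eq_bigr (fun=> y)); last by move=> j ->.
rewrite prodr_const; congr (_ * _).
rewrite (eq_bigr (fun=> 1 - y)); last by move=> j /negbTE ->.
rewrite prodr_const; congr (_ ^+ _).
have := cardC (mem J); rewrite card_ord => e.
rewrite -[X in (X - _)%N]e addKn; apply: eq_card => j; by rewrite !inE.
Qed.

(** The event splits according to the set of the indices of the observations below y, and these
    sets are grouped by cardinality. *)
Lemma prob_order_stat_lt (n : nat) (X : 'I_n -> {RV P >-> R}) (i : nat) (y : R) :
  iid_uniform01 X -> 0 <= y <= 1 -> (0 < i <= n)%N ->
  P [set w | order_stat (fun j => X j w) i < y] = (binomial_tail n i y)%:E.
Proof.
move=> iidX y01 i_n.
have -> : [set w | order_stat (fun j => X j w) i < y] =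
    \bigcup_(J in [set J : {set 'I_n} | (i <= #|J|)%N])
       [set w | [set j | X j w < y]%SET = J].
  apply/seteqP; split => w /=.
    rewrite order_stat_ltE// => iJ.
    by exists [set j | X j w < y]%SET.
  by move=> [J /= iJ wJ]; rewrite order_stat_ltE// wJ.
rewrite measure_fin_bigcup//; first last.
- move=> J _; rewrite exact_setE; apply: fin_bigcap_measurable => // j _.
  apply: measurable_funPTI => //.
  by case: ifP => // _; [|apply: measurableC]; exact: measurable_lt_set.
- by move=> J K _ _ /= [w [/= <- <-]].
- exact: finite_finset.
have -> : [set J : {set 'I_n} | (i <= #|J|)%N] =
    [set` enum [pred J : {set 'I_n} | (i <= #|J|)%N]].
  by apply/seteqP; split => J /=; rewrite mem_enum inE.
rewrite -fsbig_seq ?enum_uniq// big_enum/=.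
under eq_bigr do rewrite prob_exact_set//.
rewrite sumEFin; congr EFin; rewrite /binomial_tail.
rewrite (partition_big (fun J : {set 'I_n} => inord #|J| : 'I_n.+1)
  (fun k => (i <= k)%N))/=; last first.
  by move=> J; rewrite inordK// ltnS -[X in (_ <= X)%N]card_ord max_card.
rewrite big_geq_mkord; apply: eq_bigr => k ik.
rewrite (eq_bigl (fun J : {set 'I_n} => #|J| == k)); last first.
  move=> J; have cJ : (#|J| < n.+1)%N by rewrite ltnS -[X in (_ <= X)%N]card_ord max_card.
  rewrite -val_eqE/= inordK// inE/=.
  by case: eqP => [->|]; rewrite ?andbF// andbT; apply/idP.
rewrite (eq_bigr (fun=> y ^+ k * (1 - y) ^+ (n - k))); last first.
  by move=> J /eqP ->.
rewrite /binomial_pmf -[X in 'C(X, _)](card_ord n) -(card_draws 'I_n k) -sumr_const.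
by apply: eq_bigl => J; rewrite inE.
Qed.
End level.

(** * A Mills ratio for the binomial tail *)

Section mills.
Context {R : realType}.
Implicit Types (n i k : nat) (p : R).

(** The discrete counterpart of the fact that - x e^(- x^2 / 2) is a derivative: with the weight
    k - n p the sum over a tail reduces to a boundary term. *)
Lemma binomial_pmf_telescope n k p : (k <= n)%N ->
  (k%:R - n%:R * p) * binomial_pmf n p k =
  k%:R * (1 - p) * binomial_pmf n p k - k.+1%:R * (1 - p) * binomial_pmf n p k.+1.
Proof.
move=> kn; suff e : k.+1%:R * (1 - p) * binomial_pmf n p k.+1 =
    (n%:R - k%:R) * p * binomial_pmf n p k by rewrite e; ring.
rewrite /binomial_pmf -[_ *+ 'C(n, k)]mulr_natr -[_ *+ 'C(n, k.+1)]mulr_natr -natrB//.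
move: kn; rewrite leq_eqVlt => /predU1P[->|kn].
  by rewrite subnn bin_small// !(mulr0, mul0r).
have := mul_bin_left n k => /(congr1 (GRing.natmul (1 : R))).
rewrite !natrM => e.
transitivity (p ^+ k.+1 * ((1 - p) * (1 - p) ^+ (n - k.+1)) * (k.+1%:R * 'C(n, k.+1)%:R)).
  by ring.
by rewrite e -exprS subnSK// exprS; ring.
Qed.

(** Summation by parts. Taking F k = 1 and F k = k - n p gives the first two moments of the
    tail. *)
Lemma sum_binomial_tail_telescope n i p (F : nat -> R) : (i <= n)%N ->
  \sum_(i <= k < n.+1) F k * (k%:R - n%:R * p) * binomial_pmf n p k =
  F i * (i%:R * (1 - p) * binomial_pmf n p i) +
  \sum_(i <= k < n.+1) (F k.+1 - F k) * ((n%:R - k%:R) * p * binomial_pmf n p k).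
Proof.
move=> i_n; pose f k := k%:R * (1 - p) * binomial_pmf n p k.
have fS k : (k <= n)%N -> f k.+1 = (n%:R - k%:R) * p * binomial_pmf n p k.
  by move=> kn; have := binomial_pmf_telescope p kn; rewrite -/(f k) -/(f k.+1) /f; lra.
have fn : f n.+1 = 0.
  by rewrite fS// subrr !mul0r.
rewrite (eq_big_nat _ _ (F2 := fun k => (F k.+1 - F k) * f k.+1 - (F k.+1 * f k.+1 - F k * f k))).
  rewrite sumrB telescope_sumr ?(leqW i_n)// fn mulr0 sub0r opprK -/(f i) addrC.
  by congr (_ + _); apply: eq_big_nat => k /andP[_ kn]; rewrite -fS.
by move=> k /andP[_ kn]; rewrite -mulrA binomial_pmf_telescope// -/(f k) -/(f k.+1); ring.
Qed.

(** The first moment of k - n p over the tail equals the boundary term i (1 - p) b_i, and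
    replacing k - n p by its least value i - n p gives the upper bound on the tail. The lower bound
    expresses that the sum of (k - i)^2 b_k over the tail is nonnegative. *)
Lemma binomial_tail_mills n i p : 0 < p < 1 -> (i <= n)%N -> n%:R * p < i%:R ->
  (i%:R - n%:R * p) * binomial_tail n i p <= i%:R * (1 - p) * binomial_pmf n p i
  /\ (i%:R - n%:R * p) * (i%:R * (1 - p) * binomial_pmf n p i) <=
     ((i%:R - n%:R * p) ^+ 2 + n%:R * p * (1 - p)) * binomial_tail n i p.
Proof.
move=> /andP[p0 p1] i_n ni.
have b0 k : 0 <= binomial_pmf n p k by rewrite binomial_pmf_ge0 ?(ltW p0)// ltW.
set b := binomial_pmf n p; set B := i%:R * _ * _; set T := binomial_tail n i p.
have M1 : \sum_(i <= k < n.+1) (k%:R - n%:R * p) * b k = B.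
  have := @sum_binomial_tail_telescope n i p (fun=> 1) i_n.
  rewrite mul1r [X in _ = _ + X]big1 ?addr0 => [e|k _]; last by rewrite subrr mul0r.
  rewrite /B -/b -[i%:R * _ * _]e.
  by apply: eq_bigr => k _; rewrite mul1r.
have M2 := @sum_binomial_tail_telescope n i p (fun k => k%:R - n%:R * p) i_n.
split.
  rewrite -M1 /T /binomial_tail mulr_sumr; apply: ler_sum_nat => k /andP[ik _].
  by apply: ler_wpM2r => //; rewrite lerD2r ler_nat.
have : 0 <= \sum_(i <= k < n.+1) (k%:R - i%:R) ^+ 2 * b k.
  by apply: sumr_ge0 => k _; rewrite mulr_ge0// sqr_ge0.
set dl := i%:R - n%:R * p.
have -> : \sum_(i <= k < n.+1) (k%:R - i%:R) ^+ 2 * b k =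
    \sum_(i <= k < n.+1) (k%:R - n%:R * p) * (k%:R - n%:R * p) * b k
    - 2 * dl * \sum_(i <= k < n.+1) (k%:R - n%:R * p) * b k + dl ^+ 2 * T.
  rewrite /T /binomial_tail !mulr_sumr -sumrB -big_split/=.
  by apply: eq_bigr => k _; rewrite /dl; ring.
have -> : \sum_(i <= k < n.+1) (k%:R - n%:R * p) * (k%:R - n%:R * p) * b k =
    dl * B + n%:R * p * (1 - p) * T - p * \sum_(i <= k < n.+1) (k%:R - n%:R * p) * b k.
  rewrite M2 -addrA; congr (_ + _); rewrite /T /binomial_tail !mulr_sumr -sumrB.
  by apply: eq_bigr => k _; rewrite -[k.+1]addn1 natrD; ring.
rewrite M1; have B0 : 0 <= p * B by rewrite /B !mulr_ge0 ?subr_ge0// ltW.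
by lra.
Qed.

End mills.

(** * Calculus of affine logarithms *)

Section calculus.
Context {R : realType}.
Implicit Types (a b c x y : R).

Lemma le_of_derive_ge0 (f df : R -> R) y : 0 <= y ->
  (forall x, 0 <= x <= y -> is_derive x 1 f (df x)) ->
  (forall x, 0 <= x <= y -> 0 <= df x) -> f 0 <= f y.
Proof.
move=> y0 fdf df0.
have fdf' x : x \in `]0, y[ -> is_derive x 1 f (df x).
  by rewrite in_itv/= => /andP[x0 xy]; apply: fdf; rewrite !ltW.
have fc : {within `[0, y], continuous f}.
  apply: continuous_in_subspaceT => x; rewrite inE/= in_itv/= => /fdf[fx _].
  exact/differentiable_continuous/derivable1_diffP.
have [c] := MVT_segment y0 fdf' fc.
rewrite in_itv/= => /df0 dc; rewrite subr0 -subr_ge0 => ->.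
exact: mulr_ge0.
Qed.

(** Rules of differentiation for functions given by explicit formulas in the variable, with the
    derivative as a plain product that ring and field can normalise. *)
Lemma is_derive1_cst c x : is_derive x 1 (fun=> c) 0.
Proof. exact: is_derive_cst. Qed.

Lemma is_derive1_id x : is_derive x 1 (fun z => z) 1.
Proof. exact: is_derive_id. Qed.

Lemma is_derive1D (f g : R -> R) x df dg : is_derive x 1 f df ->
  is_derive x 1 g dg -> is_derive x 1 (fun z => f z + g z) (df + dg).
Proof. exact: is_deriveD. Qed.

Lemma is_derive1B (f g : R -> R) x df dg : is_derive x 1 f df ->
  is_derive x 1 g dg -> is_derive x 1 (fun z => f z - g z) (df - dg).
Proof. exact: is_deriveB. Qed.

Lemma is_derive1Z (f : R -> R) c x df : is_derive x 1 f df ->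
  is_derive x 1 (fun z => c * f z) (c * df).
Proof. exact: is_deriveZ. Qed.

Lemma is_derive1M (f g : R -> R) x df dg : is_derive x 1 f df ->
  is_derive x 1 g dg -> is_derive x 1 (fun z => f z * g z) (f x * dg + g x * df).
Proof. exact: is_deriveM. Qed.

Lemma is_derive1_affine c x : is_derive x 1 (fun z => 1 + c * z) c.
Proof. apply: is_derive_eq; rewrite add0r mul1r; exact: mulr1. Qed.

Lemma is_derive1_ln_affine c x : 0 < 1 + c * x ->
  is_derive x 1 (fun z => ln (1 + c * z)) (c / (1 + c * x)).
Proof.
move=> cx; have D1 := is_derive1_ln cx; have D2 := is_derive1_affine c x.
have D := @is_derive1_comp R (@ln R) (fun z => 1 + c * z) _ _ _ D1 D2.
by apply: (is_derive_eq D); rewrite mulrC.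
Qed.

Lemma is_derive1_inv_affine c x : 0 < 1 + c * x ->
  is_derive x 1 (fun z => (1 + c * z)^-1) (- c / (1 + c * x) ^+ 2).
Proof.
move=> cx; have cx0 : 1 + c * x != 0 by rewrite gt_eqF.
apply: (is_derive_eq (@is_deriveV R (fun z => 1 + c * z) _ _ _ cx0 (is_derive1_affine c x))).
by rewrite /GRing.scale/=; field.
Qed.

(** Both this bound and ln1D_le agree with ln (1 + x) to second order at 0; this is the accuracy
    that makes the steps of stirling_log summable. *)
Lemma ln1D_ge x : 0 <= x -> 2 * x / (2 + x) <= ln (1 + x).
Proof.
move=> x0.
have := @le_of_derive_ge0 (fun z => ln (1 + 1 * z) + (1 + 2^-1 * z)^-1 * 2)
  (fun z => 1 / (1 + 1 * z) + (- 2^-1 / (1 + 2^-1 * z) ^+ 2) * 2) x x0.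
rewrite !mulr0 !addr0 ln1 invr1 mul1r add0r mul1r => H.
suff : 2 <= ln (1 + x) + (1 + 2^-1 * x)^-1 * 2.
  have -> : 2 * x / (2 + x) = 2 - (1 + 2^-1 * x)^-1 * 2 by field; lra.
  lra.
apply: H => z /andP[z0 _].
  have z1 : 0 < 1 + 1 * z by lra.
  have z2 : 0 < 1 + 2^-1 * z by lra.
  refine (is_derive_eq (is_derive1D (is_derive1_ln_affine z1)
    (is_derive1M (is_derive1_inv_affine z2) (is_derive1_cst 2 z))) _).
  by ring.
rewrite /= (_ : 1 / _ + _ = z ^+ 2 / ((1 + z) * (2 + z) ^+ 2)); last by field; lra.
by rewrite divr_ge0 ?mulr_ge0 ?sqr_ge0//; lra.
Qed.

Lemma ln1D_le x : 0 <= x -> ln (1 + x) <= x * (2 + x) / (2 * (1 + x)).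
Proof.
move=> x0.
have := @le_of_derive_ge0 (fun z => (2^-1 * z - (1 + 1 * z)^-1 * 2^-1) - ln (1 + 1 * z))
  (fun z => (2^-1 - (- 1 / (1 + 1 * z) ^+ 2) * 2^-1) - 1 / (1 + 1 * z)) x x0.
rewrite !mulr0 !addr0 ln1 invr1 mul1r mul1r => H.
suff : 0 - 2^-1 - 0 <= 2^-1 * x - (1 + x)^-1 * 2^-1 - ln (1 + x).
  have -> : x * (2 + x) / (2 * (1 + x)) = 2^-1 * x - (1 + x)^-1 * 2^-1 + 2^-1 by field; lra.
  lra.
apply: H => z /andP[z0 _].
  have z1 : 0 < 1 + 1 * z by lra.
  refine (is_derive_eq (is_derive1B (is_derive1B (is_derive1Z 2^-1 (is_derive1_id z))
    (is_derive1M (is_derive1_inv_affine z1) (is_derive1_cst 2^-1 z)))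
    (is_derive1_ln_affine z1)) _).
  by ring.
rewrite /= (_ : 2^-1 - _ - _ = z ^+ 2 / (2 * (1 + z) ^+ 2)); last by field; lra.
by rewrite divr_ge0 ?mulr_ge0 ?sqr_ge0//; lra.
Qed.
End calculus.

(** * Stirling's formula and the two gaps of a rank *)

Section stirling.
Context {R : realType}.

(** The logarithm of m! / ((m / e)^m sqrt m). *)
Definition stirling_log (m : nat) : R :=
  ln m`!%:R + m%:R - (m%:R + 2^-1) * ln m%:R.

(** With x = 1 / m, the step is (1/x + 1/2) ln (1 + x) - 1, to which the two bounds on ln (1 +
    x) apply. *)
Lemma stirling_log_step (m : nat) : (0 < m)%N ->
  0 <= stirling_log m - stirling_log m.+1 <= (4 * m%:R)^-1 - (4 * m.+1%:R)^-1.
Proof.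
move=> m0; have mR : 0 < m%:R :> R by rewrite ltr0n.
have -> : stirling_log m - stirling_log m.+1 =
    (m%:R + 2^-1) * ln (1 + m%:R^-1) - 1.
  have -> : 1 + m%:R^-1 = m.+1%:R / m%:R :> R by rewrite -[m.+1%:R]natr1; field; rewrite gt_eqF.
  rewrite ln_div ?posrE ?ltr0n// /stirling_log factS natrM lnM ?posrE ?ltr0n ?fact_gt0//.
  by rewrite -[m.+1%:R]natr1; ring.
have x0 : 0 <= m%:R^-1 :> R by rewrite invr_ge0 ltW.
have mp : 0 <= m%:R + 2^-1 :> R by lra.
have lo := ler_wpM2l mp (ln1D_ge x0); have hi := ler_wpM2l mp (ln1D_le x0).
rewrite subr_ge0; apply/andP; split.
  apply: le_trans lo; rewrite [leRHS](_ : _ = 1)//; field.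
  by rewrite gt_eqF//=; apply/eqP; lra.
rewrite lerBlDr; apply: (le_trans hi); rewrite -[m.+1%:R]natr1.
rewrite [leLHS](_ : _ = (4 * m%:R)^-1 - (4 * (m%:R + 1))^-1 + 1)//.
by field; rewrite gt_eqF//=; apply/eqP; lra.
Qed.

(** The steps sum to a bound uniform in k. Ratios of levels only involve such differences, so
    the limit of stirling_log never has to be known. *)
Lemma stirling_log_le (m k : nat) : (0 < m)%N -> (m <= k)%N ->
  0 <= stirling_log m - stirling_log k <= (4 * m%:R)^-1.
Proof.
move=> m0 mk; suff /andP[-> h] : 0 <= stirling_log m - stirling_log k
    <= (4 * m%:R)^-1 - (4 * k%:R)^-1.
  by apply: (le_trans h); rewrite gerBl invr_ge0 mulr_ge0.
elim: k mk => [|k IH]; first by case: m m0.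
rewrite leq_eqVlt => /predU1P[<-|]; first by rewrite !subrr lexx.
rewrite ltnS => mk; have /andP[h1 h2] := IH mk.
have /andP[h3 h4] := @stirling_log_step k (leq_trans m0 mk).
rewrite -[stirling_log m - _](subrKA (stirling_log k)) addr_ge0//=.
by rewrite -[(4 * m%:R)^-1 - _](subrKA (4 * k%:R)^-1) lerD.
Qed.

Lemma factE_stirling (m : nat) : (0 < m)%N ->
  m`!%:R = expR (stirling_log m - m%:R + m%:R * ln m%:R) * Num.sqrt m%:R :> R.
Proof.
move=> m0; have mR : 0 < m%:R :> R by rewrite ltr0n.
have -> : Num.sqrt m%:R = expR (2^-1 * ln m%:R) :> R.
  by rewrite -powR12_sqrt ?ltW// /powR gt_eqF.
rewrite -expRD -[LHS]lnK ?posrE ?ltr0n ?fact_gt0//; congr expR.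
by rewrite /stirling_log; ring.
Qed.
End stirling.

Section coordinates.
Context {R : realType}.
Implicit Types (d a b : R).

(** The relative excess of i over the expected number n h of observations below the critical
    value h. *)
Definition low_gap (n i : nat) (d : R) : R :=
  (i%:R - n%:R * hHC n i d) / (n%:R * hHC n i d).

(** The same excess relative to the expected number n (1 - h) of observations above h. *)
Definition high_gap (n i : nat) (d : R) : R :=
  (i%:R - n%:R * hHC n i d) / (n%:R * (1 - hHC n i d)).

(** The critical value is the smaller root of a quadratic equation, which says that the rank
    exceeds its mean by exactly d standard deviations. *)
Lemma hHC_root (n i : nat) (d : R) : 0 < d -> (0 < i <= n)%N ->
  [/\ 0 < hHC n i d, hHC n i d < 1, n%:R * hHC n i d < i%:R &
   (i%:R - n%:R * hHC n i d) ^+ 2 = d ^+ 2 * (n%:R * hHC n i d * (1 - hHC n i d))].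
Proof.
move=> d0 /andP[i0 i_n]; set h := hHC n i d.
have n0 : 0 < n%:R :> R by rewrite ltr0n (leq_trans i0).
have iR : 0 < i%:R :> R by rewrite ltr0n.
have inR : i%:R <= n%:R :> R by rewrite ler_nat.
pose D := d ^+ 2 + 4 * i%:R - 4 * i%:R ^+ 2 / n%:R.
pose q := Num.sqrt D.
have nD : n%:R * D = n%:R * d ^+ 2 + 4 * i%:R * (n%:R - i%:R) by rewrite /D; field; lra.
have D0 : 0 < D.
  rewrite -(pmulr_rgt0 _ n0) nD; apply: ltr_pwDl; first by rewrite mulr_gt0 ?exprn_gt0.
  by rewrite !mulr_ge0//; lra.
have q0 : 0 < q by rewrite sqrtr_gt0.
have qq : q ^+ 2 = D by rewrite sqr_sqrtr// ltW.
have dn : 0 < 2 * (d ^+ 2 + n%:R) by rewrite mulr_gt0// addr_gt0// exprn_gt0.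
have hE : h = (d ^+ 2 + 2 * i%:R - d * q) / (2 * (d ^+ 2 + n%:R)) by [].
have d2 : 0 < d ^+ 2 by rewrite exprn_gt0.
have dq0 : 0 < d * q by rewrite mulr_gt0.
have dq2 : (d * q) ^+ 2 = d ^+ 2 * D by rewrite exprMn qq.
have h0 : 0 < h.
  rewrite hE divr_gt0// subr_gt0 -(@ltr_pXn2r _ 2)// ?nnegrE ?(ltW dq0)//; last by lra.
  rewrite dq2 -subr_gt0 (_ : _ - _ = 4 * (d ^+ 2 + n%:R) * i%:R ^+ 2 / n%:R).
    by rewrite divr_gt0// !mulr_gt0// ?exprn_gt0//; lra.
  by rewrite /D; field; lra.
have h1 : h < 1 by rewrite hE ltr_pdivrMr//; lra.
have hi : n%:R * h < i%:R.
  rewrite -subr_gt0 (_ : _ - _ = d * (n%:R * q - d * (n%:R - 2 * i%:R)) / (2 * (d ^+ 2 + n%:R))); last first.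
    by rewrite hE; field; lra.
  rewrite divr_gt0// mulr_gt0// subr_gt0.
  have [neg|pos] := ltP (n%:R - 2 * i%:R : R) 0.
    by apply: lt_trans (mulr_gt0 n0 q0); rewrite pmulr_rlt0.
  rewrite -(@ltr_pXn2r _ 2)// ?nnegrE ?mulr_ge0 ?(ltW q0) ?(ltW n0) ?(ltW d0)//.
  rewrite !exprMn qq -subr_gt0.
  rewrite (_ : _ - _ = n%:R * (n%:R * D) - d ^+ 2 * (n%:R - 2 * i%:R) ^+ 2); last by ring.
  rewrite nD (_ : _ - _ = 4 * i%:R * (n%:R - i%:R) * (n%:R + d ^+ 2)); last by ring.
  by rewrite !mulr_gt0//; lra.
split=> //.
have e2 : d * q = d ^+ 2 + 2 * i%:R - 2 * (d ^+ 2 + n%:R) * h by rewrite hE; field; lra.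
have : (d ^+ 2 + 2 * i%:R - 2 * (d ^+ 2 + n%:R) * h) ^+ 2 = d ^+ 2 * D by rewrite -e2.
move=> e3; apply: (@mulIf _ (4 * (d ^+ 2 + n%:R))); first by apply/eqP; lra.
have e4 : n%:R * (d ^+ 2 + 2 * i%:R - 2 * (d ^+ 2 + n%:R) * h) ^+ 2 = d ^+ 2 * (n%:R * D).
  by rewrite e3; ring.
by move: e4; rewrite nD => e4; lra.
Qed.

(** The gaps are coordinates for which the rank, the corank and the critical value are rational
    functions, and whose product is the same for all ranks. *)
Lemma gapsP (n i : nat) (d : R) : 0 < d -> (0 < i <= n)%N ->
  let a := low_gap n i d in let b := high_gap n i d in
  [/\ 0 < a /\ 0 < b, b <= 1, a * b = d ^+ 2 / n%:R,
      i%:R = d ^+ 2 * (1 + a) / (a * (a + b)) /\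
      n%:R - i%:R = d ^+ 2 * (1 - b) / (b * (a + b)) &
      hHC n i d = b / (a + b)].
Proof.
move=> d0 i_n; have [h0 h1 hi hq] := hHC_root d0 i_n.
have /andP[i0 in1] := i_n.
have n0 : 0 < n%:R :> R by rewrite ltr0n (leq_trans i0).
have inR : i%:R <= n%:R :> R by rewrite ler_nat.
rewrite /low_gap /high_gap; move: h0 h1 hi hq; set h := hHC n i d => h0 h1 hi hq.
set e := i%:R - n%:R * h; have e0 : 0 < e by rewrite subr_gt0.
have nh : 0 < n%:R * h by rewrite mulr_gt0.
have nh' : 0 < n%:R * (1 - h) by rewrite mulr_gt0// subr_gt0.
have h1' : 1 - h != 0 by apply/eqP; lra.
set a := e / (n%:R * h); set b := e / (n%:R * (1 - h)).
have a0 : 0 < a by rewrite divr_gt0.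
have b0 : 0 < b by rewrite divr_gt0.
have abE : a + b = e / (n%:R * h * (1 - h)).
  by rewrite /a /b; field; rewrite h1' !gt_eqF.
have d2E : d ^+ 2 = e ^+ 2 / (n%:R * h * (1 - h)).
  by rewrite hq; field; rewrite h1' !gt_eqF.
have iE : i%:R = n%:R * h + e by rewrite /e; ring.
split=> //.
- by rewrite /b ler_pdivrMr// mul1r /e mulrBr mulr1; lra.
- by rewrite d2E /a /b; field; rewrite h1' !gt_eqF.
- rewrite abE d2E; split.
    by rewrite [LHS]iE /a; field; rewrite h1' !gt_eqF.
  by rewrite [in LHS]iE /b; field; rewrite h1' !gt_eqF.
- by rewrite abE /b; field; rewrite h1' !gt_eqF.
Qed.
End coordinates.

(** * The rate of a level *)

Section level_rate.
Context {R : realType}.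
Implicit Types (d a b : R).

(** By i = n h (1 + a) and n - i = n (1 - h) (1 - b), the product d^2 * rate a b is n times the
    relative entropy of i / n with respect to h. As an integral, rate a b is that of
    (1 - x) / ((1 + a x) (1 - b x)) over [0, 1]. *)
Definition rate (a b : R) : R :=
  ((1 + a) * ln (1 + a) / a + (1 - b) * ln (1 - b) / b) / (a + b).

(** In Stirling's formula for the three factorials the powers of e cancel and the powers of n, i
    and n - i combine to the relative entropy. *)
Lemma binomial_pmf_stirling (n i : nat) (p a b : R) : (0 < i < n)%N ->
  0 < p < 1 -> 0 < 1 + a -> 0 < 1 - b ->
  i%:R = n%:R * p * (1 + a) -> n%:R - i%:R = n%:R * (1 - p) * (1 - b) ->
  binomial_pmf n p i =
  expR (stirling_log n - stirling_log i - stirling_log (n - i)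
        - (i%:R * ln (1 + a) + (n%:R - i%:R) * ln (1 - b)))
  * (Num.sqrt n%:R / (Num.sqrt i%:R * Num.sqrt (n%:R - i%:R))).
Proof.
move=> /andP[i0 i_n] /andP[p0 p1] a1 b1 iE jE.
have n0 : (0 < n)%N by exact: leq_trans i_n.
have j0 : (0 < n - i)%N by rewrite subn_gt0.
have p1' : 0 < 1 - p by rewrite subr_gt0.
have jR : (n - i)%:R = n%:R - i%:R :> R by rewrite natrB// ltnW.
have nR : 0 < n%:R :> R by rewrite ltr0n.
have /(congr1 (GRing.natmul (1 : R))) := bin_fact (ltnW i_n).
rewrite !natrM (factE_stirling i0) (factE_stirling j0) (factE_stirling n0) => binE.
rewrite /binomial_pmf -mulr_natr.
have -> : p ^+ i * unstable.onem p ^+ (n - i) = expR (i%:R * ln p + (n - i)%:R * ln (1 - p)).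
  by rewrite expRD !expRM_natl !lnK.
have si : 0 < Num.sqrt i%:R :> R by rewrite sqrtr_gt0 ltr0n.
have sj : 0 < Num.sqrt (n - i)%:R :> R by rewrite sqrtr_gt0 ltr0n.
apply: (@mulIf _ (expR (stirling_log i - i%:R + i%:R * ln i%:R) * Num.sqrt i%:R *
      (expR (stirling_log (n - i) - (n - i)%:R + (n - i)%:R * ln (n - i)%:R) *
       Num.sqrt (n - i)%:R))).
  by rewrite !mulf_neq0// gt_eqF// expR_gt0.
rewrite -[LHS]mulrA binE -jR.
transitivity (expR (i%:R * ln p + (n - i)%:R * ln (1 - p)
  + (stirling_log n - n%:R + n%:R * ln n%:R)) * Num.sqrt n%:R).
  by rewrite [in RHS]expRD mulrA.
set X := stirling_log n - _ - _ - _.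
transitivity (expR (X + (stirling_log i - i%:R + i%:R * ln i%:R)
  + (stirling_log (n - i) - (n - i)%:R + (n - i)%:R * ln (n - i)%:R)) * Num.sqrt n%:R);
  last first.
  by rewrite 2!expRD; field; rewrite !gt_eqF.
congr (expR _ * _); rewrite /X.
have -> : ln (i%:R) = ln n%:R + ln p + ln (1 + a).
  by rewrite iE !lnM ?posrE// ?mulr_gt0//.
have -> : ln ((n - i)%:R) = ln n%:R + ln (1 - p) + ln (1 - b).
  by rewrite jR jE !lnM ?posrE// ?mulr_gt0//.
by rewrite jR; ring.
Qed.

(** The boundary term of Mills' inequalities divided by i - n h, written with the gaps. *)
Definition tail_approx (n i : nat) (d : R) : R :=
  expR (stirling_log n - stirling_log i - stirling_log (n - i)
        - d ^+ 2 * rate (low_gap n i d) (high_gap n i d))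
  * (Num.sqrt ((1 + low_gap n i d) / (1 - high_gap n i d)) / d).

(** The variance n h (1 - h) is (i - n h)^2 / d^2, so the two sides of Mills' inequalities
    differ by the factor 1 + d^-2 whatever the rank. *)
Lemma binomial_tail_bounds (n i : nat) (d : R) : 0 < d -> (0 < i < n)%N ->
  binomial_tail n i (hHC n i d) <= tail_approx n i d /\
  tail_approx n i d <= (1 + d ^- 2) * binomial_tail n i (hHC n i d).
Proof.
move=> d0 i_n; have /andP[i0 ltin] := i_n.
have i_n' : (0 < i <= n)%N by rewrite i0 ltnW.
rewrite /tail_approx.
move: (hHC_root d0 i_n') (gapsP d0 i_n') => /=.
move: (low_gap n i d) (high_gap n i d) (hHC n i d) => a b h.
move=> [h0 h1 hi hq] [[a0 b0] b1 ab [iE jE] hE].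
set T := binomial_tail n i h.
set G := expR _ * _.
have n0 : 0 < n%:R :> R by rewrite ltr0n (leq_trans i0)// ltnW.
have iR : 0 < i%:R :> R by rewrite ltr0n.
have jR : 0 < n%:R - i%:R :> R by rewrite subr_gt0 ltr_nat.
have a1 : 0 < 1 + a by lra.
have s0 : 0 < a + b by lra.
have b1' : 0 < 1 - b.
  rewrite subr_gt0 lt_neqAle b1 andbT; apply/eqP => b1E.
  by move: jR; rewrite jE b1E subrr mulr0 mul0r ltxx.
have nE : n%:R = d ^+ 2 / (a * b) by rewrite ab; field; rewrite !gt_eqF ?exprn_gt0.
have iE' : i%:R = n%:R * h * (1 + a).
  by rewrite iE hE nE; field; rewrite !gt_eqF.
have jE' : n%:R - i%:R = n%:R * (1 - h) * (1 - b).
  by rewrite jE hE nE; field; rewrite !gt_eqF.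
have dlE : i%:R - n%:R * h = n%:R * h * a by rewrite iE'; ring.
have dl0 : 0 < n%:R * h * a by rewrite !mulr_gt0.
have BE : i%:R * (1 - h) * binomial_pmf n h i = (n%:R * h * a) * G.
  rewrite (binomial_pmf_stirling i_n _ a1 b1' iE' jE') ?h0//.
  have -> : i%:R * ln (1 + a) + (n%:R - i%:R) * ln (1 - b) = d ^+ 2 * rate a b.
    by rewrite /rate jE iE; field; rewrite !gt_eqF.
  rewrite /G mulrCA [RHS]mulrCA; congr (_ * _).
  rewrite -sqrtrM ?ler0n// -sqrtrV ?mulr_ge0 ?ltW// -sqrtrM ?ler0n//.
  rewrite -[LHS]ger0_norm ?mulr_ge0 ?sqrtr_ge0 ?subr_ge0 ?(ltW h1)//.
  rewrite -[RHS]ger0_norm ?mulr_ge0 ?sqrtr_ge0 ?invr_ge0 ?(ltW dl0) ?(ltW d0) ?(ltW h0) ?(ltW a0)//.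
  rewrite -!sqrtr_sqr; congr Num.sqrt.
  rewrite !exprMn exprVn !sqr_sqrtr.
  - by rewrite jE iE nE hE; field; rewrite !gt_eqF.
  - by rewrite divr_ge0// ltW.
  - by rewrite divr_ge0// ?mulr_ge0// ltW.
have [] := @binomial_tail_mills R n i h _ (ltnW ltin) hi; first by rewrite h0.
rewrite BE -/T hq dlE => m1 m2.
have m2' : (n%:R * h * a) ^+ 2 * G <= (n%:R * h * a) ^+ 2 * ((1 + d ^- 2) * T).
  apply: (le_trans _ (le_trans m2 _)); first by rewrite expr2 -[leLHS]mulrA.
  rewrite -dlE hq [leLHS](_ : _ = d ^+ 2 * (n%:R * h * (1 - h)) * ((1 + d ^- 2) * T))//.
  by field; rewrite gt_eqF.
move: m1 m2'; rewrite (ler_pM2l dl0) (ler_pM2l (exprn_gt0 2 dl0)) => m1 m2'.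
by split; [exact: m1 | exact: m2'].
Qed.

(** At the top rank b = 1, where tail_approx breaks down; but there the level is the single term
    h^n. *)
Lemma binomial_tail_max (n : nat) (d : R) : 0 < d -> (0 < n)%N ->
  binomial_tail n n (hHC n n d) =
  expR (- (d ^+ 2 * rate (low_gap n n d) (high_gap n n d))).
Proof.
move=> d0 n0; have n_n : (0 < n <= n)%N by rewrite n0 leqnn.
have nR : 0 < n%:R :> R by rewrite ltr0n.
move: (hHC_root d0 n_n) (gapsP d0 n_n) => /=.
move: (low_gap n n d) (high_gap n n d) (hHC n n d) => a b h.
move=> [h0 h1 hi hq] [[a0 b0] b1 ab [iE jE] hE].
have bE : b = 1.
  have : d ^+ 2 * (1 - b) / (b * (a + b)) = 0 by rewrite -jE subrr.
  move/eqP; rewrite mulf_eq0 invr_eq0 [b * _ == 0]gt_eqF ?mulr_gt0 ?addr_gt0//.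
  by rewrite orbF mulf_eq0 sqrf_eq0 gt_eqF//= subr_eq0 => /eqP.
rewrite /binomial_tail big_nat1 /binomial_pmf subnn expr0 mulr1 binn mulr1n.
rewrite -[h]lnK ?posrE// -expRM_natl; congr expR.
rewrite hE bE /rate subrr mul0r mul0r addr0 lnM ?posrE ?invr_gt0 ?ln1//; last by lra.
rewrite ?add0r lnV ?posrE ?(addrC a 1); last by lra.
move: ab; rewrite bE mulr1 => aE; have -> : d ^+ 2 = a * n%:R.
  by rewrite aE; field; rewrite gt_eqF.
by field; rewrite !gt_eqF// addr_gt0.
Qed.
End level_rate.

(** * Comparing two rates *)

Section rate_comparison.
Context {R : realType}.
Implicit Types (a b c s x y : R).

(** Integrating f2 <= g2 twice; with it the rates can be compared without introducing
    integrals. *)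
Lemma le_of_derive2_le (f f1 f2 g g1 g2 : R -> R) y : 0 <= y ->
  (forall x, 0 <= x <= y -> is_derive x 1 f (f1 x) /\ is_derive x 1 f1 (f2 x)) ->
  (forall x, 0 <= x <= y -> is_derive x 1 g (g1 x) /\ is_derive x 1 g1 (g2 x)) ->
  f 0 = g 0 -> f1 0 = g1 0 -> (forall x, 0 <= x <= y -> f2 x <= g2 x) ->
  f y <= g y.
Proof.
move=> y0 Df Dg e0 e1 le2.
have le1 x : 0 <= x <= y -> 0 <= g1 x - f1 x.
  move=> /andP[x0 xy]; rewrite [leLHS](_ : 0 = g1 0 - f1 0); last by rewrite e1 subrr.
  apply: (@le_of_derive_ge0 _ (fun z => g1 z - f1 z) (fun z => g2 z - f2 z)) => // z /andP[z0 zx].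
    have zy : 0 <= z <= y by rewrite z0 (le_trans zx).
    by apply: is_derive1B; [exact: (Dg z zy).2|exact: (Df z zy).2].
  by rewrite subr_ge0 le2// z0 (le_trans zx).
rewrite -subr_ge0 [leLHS](_ : 0 = g 0 - f 0); last by rewrite e0 subrr.
apply: (@le_of_derive_ge0 _ (fun z => g z - f z) (fun z => g1 z - f1 z)) => // z zy.
by apply: is_derive1B; [exact: (Dg z zy).1|exact: (Df z zy).1].
Qed.

(** The integral of (y - x) / ((1 + a x) (1 - b x)) over x in [0, y], so that its second
    derivative in y is the reciprocal of the quadratic. *)
Definition rate_at a b y :=
  ((1 + a * y) * ln (1 + a * y) / a + (1 + - b * y) * ln (1 + - b * y) / b) / (a + b).

Lemma rate_at1 a b : rate_at a b 1 = rate a b.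
Proof. by rewrite /rate_at /rate !mulr1. Qed.

Definition rate_at' a b y := (ln (1 + a * y) - ln (1 + - b * y)) / (a + b).

Lemma is_derive_rate_at a b y : 0 < a -> 0 < b -> 0 <= y -> b * y < 1 ->
  is_derive y 1 (rate_at a b) (rate_at' a b y) /\
  is_derive y 1 (rate_at' a b) (((1 + a * y) * (1 - b * y))^-1).
Proof.
move=> a0 b0 y0 by1.
have ay : 0 < 1 + a * y by rewrite ltr_wpDr// mulr_ge0// ltW.
have by' : 0 < 1 + - b * y by rewrite mulNr subr_gt0.
have s0 : 0 < a + b by rewrite addr_gt0.
have Da := is_derive1_ln_affine ay; have Db := is_derive1_ln_affine by'.
have La := is_derive1_affine a y; have Lb := is_derive1_affine (- b) y.
split.
  have D := is_derive1M (is_derive1D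
    (is_derive1M (is_derive1M La Da) (is_derive1_cst a^-1 y))
    (is_derive1M (is_derive1M Lb Db) (is_derive1_cst b^-1 y))) (is_derive1_cst (a + b)^-1 y).
  apply: (is_derive_eq D); rewrite /rate_at'.
  by field; rewrite !gt_eqF//=; rewrite mulNr in by'.
have D := is_derive1M (is_derive1B Da Db) (is_derive1_cst (a + b)^-1 y).
apply: (is_derive_eq D); field.
by rewrite !gt_eqF//=; rewrite mulNr in by'.
Qed.

(** The integral of (y - x) x / (1 + s x)^2 over x in [0, y]; the value at s = 0 removes the
    singularity of the closed form. *)
Definition rate_slope s y := if s == 0 then y ^+ 3 / 6
  else ((1 + (1 + s * y)) * ln (1 + s * y) - 2 * s * y) / s ^+ 3.

Definition rate_slope' s y := if s == 0 then y ^+ 2 / 2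
  else (ln (1 + s * y) + (1 + s * y)^-1 - 1) / s ^+ 2.

Lemma rate_slope_0 s : rate_slope s 0 = 0.
Proof.
rewrite /rate_slope; case: ifP => _; first by rewrite expr0n mul0r.
by rewrite !mulr0 addr0 ln1 mulr0 subrr mul0r.
Qed.

Lemma rate_slope'_0 s : rate_slope' s 0 = 0.
Proof.
rewrite /rate_slope'; case: ifP => _; first by rewrite expr0n mul0r.
by rewrite !mulr0 addr0 ln1 invr1 add0r subrr mul0r.
Qed.

Lemma is_derive_rate_slope s y : 0 < 1 + s * y ->
  is_derive y 1 (rate_slope s) (rate_slope' s y) /\
  is_derive y 1 (rate_slope' s) (y / (1 + s * y) ^+ 2).
Proof.
move=> sy; have sy0 : 1 + s * y != 0 by rewrite gt_eqF.
have I := is_derive1_id y.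
have D := is_derive1_ln_affine sy; have L := is_derive1_affine s y.
have V := is_derive1_inv_affine sy.
rewrite /rate_slope /rate_slope'; have [s0|s0] := eqVneq s 0.
  split.
    apply: (is_derive_eq (is_derive1M (is_derive1M I (is_derive1M I I)) (is_derive1_cst 6^-1 y))).
    by field.
  apply: (is_derive_eq (is_derive1M (is_derive1M I I) (is_derive1_cst 2^-1 y))).
  by rewrite s0 mul0r addr0 expr1n; field.
split.
  apply: (is_derive_eq (is_derive1M (is_derive1B
    (is_derive1M (is_derive1D (is_derive1_cst 1 y) L) D)
    (is_derive1Z (2 * s) I)) (is_derive1_cst (s ^+ 3)^-1 y))).
  by field; rewrite ?sy0 s0.
apply: (is_derive_eq (is_derive1M (is_derive1B (is_derive1D D V)
  (is_derive1_cst 1 y)) (is_derive1_cst (s ^+ 2)^-1 y))).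
by field; rewrite sy0 s0.
Qed.

Lemma affine_gt0 s x : -1 < s -> 0 <= x <= 1 -> 0 < 1 + s * x.
Proof.
move=> s1 /andP[]; rewrite le_eqVlt => /predU1P[<- _|x0 x1]; first by rewrite mulr0 addr0.
by have : 0 < (1 + s) * x by [rewrite mulr_gt0//; lra]; lra.
Qed.

(** Since (1 + a x) (1 - b x) = 1 + (a - b) x - a b x^2, two quadratics with the same product a
    b differ only through their shifts a - b. *)
Lemma quad_subE a1 b1 a2 b2 x : a1 * b1 = a2 * b2 ->
  0 < (1 + a1 * x) * (1 - b1 * x) -> 0 < (1 + a2 * x) * (1 - b2 * x) ->
  ((1 + a2 * x) * (1 - b2 * x))^-1 - ((1 + a1 * x) * (1 - b1 * x))^-1 =
  (a1 - b1 - (a2 - b2)) * x / ((1 + a1 * x) * (1 - b1 * x) * ((1 + a2 * x) * (1 - b2 * x))).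
Proof.
move=> ab q1 q2.
rewrite -[in RHS](mulfK (lt0r_neq0 q1) (_ * x)).
set Q1 := (1 + a1 * x) * _ in q1 *; set Q2 := (1 + a2 * x) * _ in q2 *.
have e : (a1 - b1 - (a2 - b2)) * x = Q1 - Q2.
  rewrite /Q1 /Q2; transitivity ((a1 - b1 - (a2 - b2)) * x - (a1 * b1 - a2 * b2) * x ^+ 2); last by ring.
  by rewrite ab subrr mul0r subr0.
by rewrite e; field; rewrite !gt_eqF.
Qed.

Lemma quad_gt0 a b x : 0 < a -> 0 <= x -> b * x < 1 -> 0 < (1 + a * x) * (1 - b * x).
Proof. by move=> a0 x0 bx; rewrite mulr_gt0 ?subr_gt0// ltr_wpDr// mulr_ge0// ltW. Qed.

Lemma rate_at_0 a b : rate_at a b 0 = 0.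
Proof. by rewrite /rate_at !mulr0 !addr0 ln1 !mulr0 !mul0r addr0 mul0r. Qed.

Lemma rate_at'_0 a b : rate_at' a b 0 = 0.
Proof. by rewrite /rate_at' !mulr0 !addr0 ln1 subrr mul0r. Qed.

(** The second derivative of the difference of the two sides is controlled by quad_subE, the
    product of the quadratics being compared with C (1 + s x)^2. The end point y is kept below the
    zeros of the quadratics, since b2 may be 1. *)
Lemma rate_at_diff_ge a1 b1 a2 b2 s C y : 0 < a1 -> 0 < b1 -> 0 < a2 -> 0 < b2 ->
  a1 * b1 = a2 * b2 -> a2 - b2 <= a1 - b1 -> -1 < s -> 0 < C ->
  (forall x, 0 <= x <= 1 ->
    (1 + a1 * x) * (1 - b1 * x) * ((1 + a2 * x) * (1 - b2 * x)) <= C * (1 + s * x) ^+ 2) ->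
  0 <= y <= 1 -> b1 * y < 1 -> b2 * y < 1 ->
  (a1 - b1 - (a2 - b2)) / C * rate_slope s y + rate_at a1 b1 y <= rate_at a2 b2 y.
Proof.
move=> a10 b10 a20 b20 ab ss s1 C0 Q /andP[y0 y1] b1y b2y.
set c := (_ / C); have c0 : 0 <= c by rewrite divr_ge0 ?subr_ge0// ltW.
have bx b x : 0 < b -> b * y < 1 -> 0 <= x <= y -> b * x < 1.
  by move=> b0 by1 /andP[x0 xy]; apply: le_lt_trans by1; rewrite ler_pM2l.
have H := (@le_of_derive2_le (fun z => c * rate_slope s z + rate_at a1 b1 z)
  (fun z => c * rate_slope' s z + rate_at' a1 b1 z)
  (fun z => c * (z / (1 + s * z) ^+ 2) + ((1 + a1 * z) * (1 - b1 * z))^-1)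
  (rate_at a2 b2) (rate_at' a2 b2) (fun z => ((1 + a2 * z) * (1 - b2 * z))^-1) y y0).
apply: H.
- move=> x xy; have /andP[x0 xy'] := xy; have x1 : 0 <= x <= 1 by rewrite x0 (le_trans xy').
  have [D1 D2] := is_derive_rate_at a10 b10 x0 (bx _ _ b10 b1y xy).
  have [D3 D4] := is_derive_rate_slope (affine_gt0 s1 x1).
  by split; apply: is_derive1D => //; exact: is_derive1Z.
- move=> x xy; have /andP[x0 _] := xy.
  exact: is_derive_rate_at a20 b20 x0 (bx _ _ b20 b2y xy).
- by rewrite rate_slope_0 !rate_at_0 mulr0 addr0.
- by rewrite rate_slope'_0 !rate_at'_0 mulr0 addr0.
move=> x xy; have /andP[x0 xy'] := xy; have x1 : 0 <= x <= 1 by rewrite x0 (le_trans xy').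
have q1 := quad_gt0 a10 x0 (bx _ _ b10 b1y xy).
have q2 := quad_gt0 a20 x0 (bx _ _ b20 b2y xy).
have k0 : 0 < (1 + s * x) ^+ 2 by rewrite exprn_gt0// affine_gt0.
rewrite -lerBrDr quad_subE// (_ : c * _ = (a1 - b1 - (a2 - b2)) * x / (C * (1 + s * x) ^+ 2)).
  by rewrite ler_wpM2l ?mulr_ge0 ?subr_ge0// lef_pV2 ?posrE ?(mulr_gt0 C0 k0) ?(mulr_gt0 q1 q2)// Q.
by rewrite /c; field; rewrite !gt_eqF// affine_gt0.
Qed.

Lemma rate_diff_le a1 b1 a2 b2 s C : 0 < a1 -> 0 < b1 < 1 -> 0 < a2 -> 0 < b2 < 1 ->
  a1 * b1 = a2 * b2 -> a2 - b2 <= a1 - b1 -> -1 < s -> 0 < C ->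
  (forall x, 0 <= x <= 1 ->
    C * (1 + s * x) ^+ 2 <= (1 + a1 * x) * (1 - b1 * x) * ((1 + a2 * x) * (1 - b2 * x))) ->
  rate a2 b2 - rate a1 b1 <= (a1 - b1 - (a2 - b2)) * rate_slope s 1 / C.
Proof.
move=> a10 /andP[b10 b11] a20 /andP[b20 b21] ab ss s1 C0 Q.
rewrite mulrAC -!rate_at1 lerBlDr; set c := (_ / C).
have c0 : 0 <= c by rewrite divr_ge0 ?subr_ge0// ltW.
have bx b x : 0 < b < 1 -> 0 <= x <= 1 -> b * x < 1.
  by move=> /andP[b0 bl1] /andP[x0 x1]; nra.
have b1' : 0 < b1 < 1 by rewrite b10.
have b2' : 0 < b2 < 1 by rewrite b20.
have H := (@le_of_derive2_le (rate_at a2 b2) (rate_at' a2 b2) (fun z => ((1 + a2 * z) * (1 - b2 * z))^-1)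
  (fun z => c * rate_slope s z + rate_at a1 b1 z)
  (fun z => c * rate_slope' s z + rate_at' a1 b1 z)
  (fun z => c * (z / (1 + s * z) ^+ 2) + ((1 + a1 * z) * (1 - b1 * z))^-1) 1 ler01).
apply: H.
- move=> x x1; have /andP[x0 _] := x1.
  exact: is_derive_rate_at a20 b20 x0 (bx _ _ b2' x1).
- move=> x x1; have /andP[x0 xy'] := x1.
  have [D1 D2] := is_derive_rate_at a10 b10 x0 (bx _ _ b1' x1).
  have [D3 D4] := is_derive_rate_slope (affine_gt0 s1 x1).
  by split; apply: is_derive1D => //; exact: is_derive1Z.
- by rewrite rate_slope_0 !rate_at_0 mulr0 addr0.
- by rewrite rate_slope'_0 !rate_at'_0 mulr0 addr0.
move=> x x1; have /andP[x0 xy'] := x1.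
have q1 := quad_gt0 a10 x0 (bx _ _ b1' x1).
have q2 := quad_gt0 a20 x0 (bx _ _ b2' x1).
have k0 : 0 < (1 + s * x) ^+ 2 by rewrite exprn_gt0// affine_gt0.
rewrite -lerBlDr quad_subE// (_ : c * _ = (a1 - b1 - (a2 - b2)) * x / (C * (1 + s * x) ^+ 2)).
  by rewrite ler_wpM2l ?mulr_ge0 ?subr_ge0// lef_pV2 ?posrE ?(mulr_gt0 C0 k0) ?(mulr_gt0 q1 q2)// Q.
by rewrite /c; field; rewrite !gt_eqF// affine_gt0.
Qed.

(** For b2 = 1, the value at the top rank, the comparison holds on [0, y] for y < 1 and passes
    to the limit. *)
Lemma rate_diff_ge a1 b1 a2 b2 s C : 0 < a1 -> 0 < b1 < 1 -> 0 < a2 -> 0 < b2 <= 1 ->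
  a1 * b1 = a2 * b2 -> a2 - b2 <= a1 - b1 -> -1 < s -> 0 < C ->
  (forall x, 0 <= x <= 1 ->
    (1 + a1 * x) * (1 - b1 * x) * ((1 + a2 * x) * (1 - b2 * x)) <= C * (1 + s * x) ^+ 2) ->
  (a1 - b1 - (a2 - b2)) * rate_slope s 1 / C <= rate a2 b2 - rate a1 b1.
Proof.
move=> a10 /andP[b10 b11] a20 /andP[b20 b21] ab ss s1 C0 Q.
rewrite mulrAC lerBrDr -[rate a1 b1]rate_at1; set c := (_ / C).
move: b21; rewrite le_eqVlt => /predU1P[b2E|b21]; last first.
  by rewrite -[rate a2 b2]rate_at1 rate_at_diff_ge ?mulr1 ?ler01 ?lexx.
(* for b2 = 1 the summand with ln (1 - y) is nonpositive and can be dropped *)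
have up y : 0 <= y < 1 -> c * rate_slope s y + rate_at a1 b1 y <= rate a2 b2.
  move=> /andP[y0 y1]; have y01 : 0 <= y <= 1 by rewrite y0 ltW.
  apply: (@le_trans _ _ (rate_at a2 b2 y)).
    by apply: rate_at_diff_ge => //; [nra|rewrite b2E mul1r].
  rewrite /rate /rate_at b2E ler_pM2r ?invr_gt0 ?addr_gt0// subrr mul0r mul0r addr0.
  have l1 : (1 + -1 * y) * ln (1 + -1 * y) / 1 <= 0.
    by rewrite divr1 mulr_ge0_le0 ?ln_le0//; lra.
  apply: (@le_trans _ _ ((1 + a2 * y) * ln (1 + a2 * y) / a2)); first by rewrite gerDl.
  have ay0 : 0 <= a2 * y by rewrite mulr_ge0// ltW.
  have ay1 : a2 * y <= a2 by rewrite ler_piMr// ltW.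
  rewrite ler_pM2r ?invr_gt0// ler_pM ?ln_ge0 ?ler_ln ?posrE//; lra.
rewrite leNgt; apply/negP => lt1.
pose f (y : R) : R := c * rate_slope s y + rate_at a1 b1 y.
have i01 : 0 <= (1 : R) <= 1 by rewrite ler01 lexx.
have fc : f y @[y --> (1 : R)] --> f 1.
  have D1 := (is_derive_rate_slope (affine_gt0 s1 i01)).1.
  have b11' : b1 * 1 < 1 by rewrite mulr1.
  have D2 := (is_derive_rate_at a10 b10 ler01 b11').1.
  have [] := is_derive1D (is_derive1Z c D1) D2.
  by move=> /derivable1_diffP/differentiable_continuous.
have [e /= e0 he] := cvgr_gt _ fc _ lt1.
pose z := 1 - Num.min e 1 / 2.
have m0 : 0 < Num.min e 1 by rewrite lt_min e0 ltr01.
have me : Num.min e 1 <= e by rewrite ge_min lexx.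
have m1 : Num.min e 1 <= 1 by rewrite ge_min lexx orbT.
have := he z; rewrite /ball_/= (_ : 1 - z = Num.min e 1 / 2); last by rewrite /z; ring.
rewrite ger0_norm ?divr_ge0 ?(ltW m0)// => /(_ _).
have -> : Num.min e 1 / 2 < e by lra.
move=> /(_ isT); rewrite ltNge /f up//; by rewrite /z; lra.
Qed.

End rate_comparison.

(** * The slope of the rate *)

Section slope_bounds.
Context {R : realType}.
Implicit Types (s : R).

Lemma rate_slope01 : rate_slope 0 1 = 6^-1 :> R.
Proof. by rewrite /rate_slope eqxx expr1n mul1r. Qed.

(** The kernel x / (1 + s x)^2 is at least x / (1 + |s|)^2, so the slope is at least a fraction
    of the slope at 0. *)
Lemma rate_slope1_gt0 s : -1 < s -> 0 < rate_slope s 1.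
Proof.
move=> s1; pose M := (1 + `|s|) ^+ 2; have M0 : 0 < M by rewrite exprn_gt0// ltr_pwDl.
have H := @le_of_derive2_le R (fun z => M^-1 * rate_slope 0 z) (fun z => M^-1 * rate_slope' 0 z)
  (fun z => M^-1 * (z / (1 + 0 * z) ^+ 2)) (rate_slope s) (rate_slope' s)
  (fun z => z / (1 + s * z) ^+ 2) 1 ler01.
apply: (@lt_le_trans _ _ (M^-1 * rate_slope 0 1)).
  by rewrite rate_slope01 mulr_gt0// invr_gt0.
apply: H.
- move=> x x1; have x0 : 0 < 1 + 0 * x by rewrite mul0r addr0.
  by have [D1 D2] := is_derive_rate_slope x0; split; exact: is_derive1Z.
- by move=> x x1; exact: is_derive_rate_slope (affine_gt0 s1 x1).
- by rewrite !rate_slope_0 mulr0.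
- by rewrite !rate_slope'_0 mulr0.
move=> x x1; have sx := affine_gt0 s1 x1; have /andP[x0 x1'] := x1.
rewrite mul0r addr0 expr1n divr1 mulrC ler_wpM2l// lef_pV2 ?posrE ?exprn_gt0//.
rewrite /M ler_pXn2r// ?nnegrE ?(ltW sx) ?addr_ge0//.
rewrite lerD2l (le_trans (ler_norm _))// normrM ler_piMr// ger0_norm//.
Qed.

(** The growth for shifts tending to infinity, where rate_slope s 1 itself tends to 0. *)
Lemma rate_slope1_ge_ln s : 0 < s -> ln (1 + s) - 2 <= s ^+ 2 * rate_slope s 1.
Proof.
move=> s0; rewrite /rate_slope gt_eqF// !mulr1.
have l0 : 0 <= ln (1 + s) by rewrite ln_ge0//; lra.
rewrite [leRHS](_ : _ = ln (1 + s) - 2 + 2 * ln (1 + s) / s); last by field; rewrite gt_eqF.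
by rewrite lerDl divr_ge0 ?mulr_ge0// ltW.
Qed.

(** The slope is unbounded for shifts tending to -1. *)
Lemma rate_slope1_ge_lnN s : -1 < s < 0 -> - ln (1 + s) - 2 <= rate_slope s 1.
Proof.
move=> /andP[s1 s0]; have K0 := rate_slope1_gt0 s1.
have l0 : ln (1 + s) <= 0 by rewrite ln_le0//; lra.
have -> : - ln (1 + s) - 2 = - s ^+ 3 * rate_slope s 1 + (1 + s) * (ln (1 + s) - 2).
  by rewrite /rate_slope lt_eqF// !mulr1; field; rewrite lt_eqF.
have h1 : (1 + s) * (ln (1 + s) - 2) <= 0 by rewrite mulr_ge0_le0//; lra.
have h2 : - s ^+ 3 * rate_slope s 1 <= rate_slope s 1.
  have -> : - s ^+ 3 = (- s) ^+ 3 by ring.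
  by rewrite ler_piMl ?(ltW K0)// exprn_ile1//; lra.
lra.
Qed.
End slope_bounds.

(** * Inequalities for a pair of ranks *)

Section one_rank.
Context {R : realType}.
Implicit Types (d x y : R).

Definition rank_level (n i : nat) (d : R) : R := binomial_tail n i (hHC n i d).

(** Eliminating one gap by a b = d^2 / n leaves a quadratic equation for the other whose
    coefficients are the rank and d: this turns limits of ranks into limits of gaps. *)
Lemma gap_eqs (n i : nat) (d : R) : 0 < d -> (0 < i <= n)%N ->
  let a := low_gap n i d in let b := high_gap n i d in let e := d ^+ 2 / n%:R in
  [/\ [/\ 0 < a, 0 < b & b <= 1], a * b = e, 0 < e,
   i%:R * (a ^+ 2 + e) = d ^+ 2 * (1 + a) &
   (n%:R - i%:R) * (b ^+ 2 + e) = d ^+ 2 * (1 - b)].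
Proof.
move=> d0 i_n; have [[a0 b0] b1 ab [iE jE] _] := gapsP d0 i_n.
have s0 : 0 < low_gap n i d + high_gap n i d by rewrite addr_gt0.
split=> //.
- by rewrite divr_gt0 ?exprn_gt0// ltr0n; case/andP: i_n => i0; apply: leq_trans.
- by rewrite iE -ab; field; rewrite !gt_eqF.
- by rewrite jE -ab; field; rewrite !gt_eqF.
Qed.

Lemma high_gap_lt1 (n i : nat) (d : R) : 0 < d -> (0 < i < n)%N -> high_gap n i d < 1.
Proof.
move=> d0 /andP[i0 i_n]; have i_n' : (0 < i <= n)%N by rewrite i0 ltnW.
have [[a0 b0 b1] _ e0 _ jE] := gap_eqs d0 i_n'.
rewrite lt_neqAle b1 andbT; apply/eqP => bE.
have : 0 < (n%:R - i%:R) * (high_gap n i d ^+ 2 + d ^+ 2 / n%:R).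
  by rewrite mulr_gt0 ?subr_gt0 ?ltr_nat// addr_gt0 ?exprn_gt0.
by rewrite jE bE subrr mulr0 ltxx.
Qed.

Lemma rank_level_gt0 (n i : nat) (d : R) : 0 < d -> (0 < i <= n)%N -> 0 < rank_level n i d.
Proof.
move=> d0 /andP[i0]; rewrite leq_eqVlt => /predU1P[e|i_n].
  by subst i; rewrite /rank_level binomial_tail_max ?expR_gt0.
have i_n' : (0 < i < n)%N by rewrite i0.
have i_n2 : (0 < i <= n)%N by rewrite i0 ltnW.
have [_ h] := binomial_tail_bounds d0 i_n'.
have [[a0 b0 b1] _ _ _ _] := gap_eqs d0 i_n2.
have b1' := high_gap_lt1 d0 i_n'.
rewrite -(@pmulr_rgt0 _ (1 + d ^- 2)) ?addr_gt0 ?invr_gt0 ?exprn_gt0//.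
apply: lt_le_trans h; rewrite /tail_approx mulr_gt0 ?expR_gt0// divr_gt0// sqrtr_gt0.
by rewrite divr_gt0 ?subr_gt0 ?addr_gt0.
Qed.

(** Both gap equations have the form y (x^2 + e) = D (1 + th x): th = 1 for a rank and its low
    gap, th = -1 for a corank and its high gap. Keeping th as a parameter treats the two ends at
    once. *)
Lemma gap_eq_sub (th e D x1 x2 y1 y2 : R) :
  y1 * (x1 ^+ 2 + e) = D * (1 + th * x1) ->
  y2 * (x2 ^+ 2 + e) = D * (1 + th * x2) ->
  (y2 - y1) * ((x1 ^+ 2 + e) * (x2 ^+ 2 + e)) =
  D * (x1 - x2) * (x1 + x2 + th * x1 * x2 - th * e).
Proof.
move=> h1 h2.
transitivity (y2 * (x2 ^+ 2 + e) * (x1 ^+ 2 + e) - y1 * (x1 ^+ 2 + e) * (x2 ^+ 2 + e)).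
  by ring.
by rewrite h1 h2; ring.
Qed.

End one_rank.

Section rank_pair.
Context {R : realType}.
Variables (n i1 i2 : nat) (d : R).
Hypotheses (d1 : 1 <= d) (i10 : (0 < i1)%N) (i12 : (i1 < i2)%N) (i2n : (i2 <= n)%N).

Let d0 : 0 < d. Proof. exact: lt_le_trans d1. Qed.
Let i1_n : (0 < i1 <= n)%N. Proof. by rewrite i10 ltnW// (leq_trans i12). Qed.
Let i1_ltn : (0 < i1 < n)%N. Proof. by rewrite i10 (leq_trans i12). Qed.
Let i2_n : (0 < i2 <= n)%N. Proof. by rewrite i2n (leq_trans _ i12). Qed.
Local Notation a1 := (low_gap n i1 d).
Local Notation b1 := (high_gap n i1 d).
Local Notation a2 := (low_gap n i2 d).
Local Notation b2 := (high_gap n i2 d).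
Local Notation D := (d ^+ 2 * (rate a2 b2 - rate a1 b1)).

(** By gap_eq_sub the gaps are ordered oppositely to the ranks. *)
Lemma low_gap_decr : a2 < a1.
Proof.
have [[a10 b10 b11] ab1 e0 iE1 _] := gap_eqs d0 i1_n.
have [[a20 b20 b21] ab2 _ iE2 _] := gap_eqs d0 i2_n.
rewrite -[in RHS](mul1r a1) in iE1; rewrite -[in RHS](mul1r a2) in iE2.
have h := gap_eq_sub iE1 iE2; rewrite !mul1r in h.
have : 0 < d ^+ 2 * (a1 - a2) * (a1 + a2 + a1 * a2 - d ^+ 2 / n%:R).
  rewrite -h; rewrite mulr_gt0 ?subr_gt0 ?ltr_nat// mulr_gt0// addr_gt0// exprn_gt0//.
have f0 : 0 < a1 + a2 + a1 * a2 - d ^+ 2 / n%:R.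
  have : a1 * b1 <= a1 by rewrite ler_piMr// ltW.
  rewrite -ab1; have := mulr_gt0 a10 a20; lra.
by rewrite pmulr_lgt0// pmulr_rgt0 ?exprn_gt0// subr_gt0.
Qed.

Lemma high_gap_incr : b1 < b2.
Proof.
have [[a10 b10 b11] ab1 e0 iE1 _] := gap_eqs d0 i1_n.
have [[a20 b20 b21] ab2 _ iE2 _] := gap_eqs d0 i2_n.
have h : a1 * b1 < a1 * b2 by rewrite ab1 -ab2 ltr_pM2r// low_gap_decr.
by move: h; rewrite ltr_pM2l.
Qed.

(** On [0, 1] the quadratic of shift s is at most 2 + s, so the slope 1/6 at 0 applies. In terms
    of 1 / (2 + s) the bound remains useful for unbounded shifts. *)
Lemma rate_diff_ge_inv :
  d ^+ 2 * ((2 + (a2 - b2))^-1 - (2 + (a1 - b1))^-1) / 6 <= D.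
Proof.
have [[a10 b10 b11] ab1 e0 iE1 _] := gap_eqs d0 i1_n.
have [[a20 b20 b21] ab2 _ iE2 _] := gap_eqs d0 i2_n.
have b1' := high_gap_lt1 d0 i1_ltn.
have la := low_gap_decr; have lb := high_gap_incr.
set s1 := a1 - b1; set s2 := a2 - b2.
have t1 : 0 < 2 + s1 by rewrite /s1; lra.
have t2 : 0 < 2 + s2 by rewrite /s2; lra.
have := @rate_diff_ge R a1 b1 a2 b2 0 ((2 + s1) * (2 + s2)) a10 _ a20 _ _ _ _ _ _.
rewrite rate_slope01 b10 b20 b1' b21 ab1 ab2 => h.
rewrite -mulrA ler_wpM2l ?sqr_ge0//; apply: le_trans (h _ _ _ _ _ _ _).
- by rewrite le_eqVlt; apply/orP; left; apply/eqP; rewrite -/s1 -/s2; field; rewrite !gt_eqF.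
- by [].
- by [].
- by [].
- by lra.
- by lra.
- by rewrite mulr_gt0.
move=> x /andP[x0 x1]; rewrite mul0r addr0 expr1n mulr1.
have bx b : 0 < b -> b <= 1 -> 0 <= 1 - b * x.
  by move=> bb0 bb1; rewrite subr_ge0 mulr_ile1// ltW.
have Q a b : 0 < a -> 0 < b -> b <= 1 -> (1 + a * x) * (1 - b * x) <= 2 + (a - b).
  move=> aa0 bb0 bb1.
  have : 0 <= a * b * x * x by rewrite !mulr_ge0// ltW.
  have : 0 <= (1 + (a - b)) * (1 - x) by rewrite mulr_ge0; lra.
  by lra.
have Q0 a b : 0 < a -> 0 < b -> b <= 1 -> 0 <= (1 + a * x) * (1 - b * x).
  by move=> aa0 bb0 bb1; rewrite mulr_ge0 ?bx// addr_ge0// mulr_ge0// ltW.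
by rewrite ler_pM// ?Q ?Q0.
Qed.

(** The factors 1 / d and the terms stirling_log n of the two approximations cancel. *)
Lemma rank_ratio_approx : (i2 < n)%N ->
  let G := expR (stirling_log i1 - stirling_log i2
                 + (stirling_log (n - i1) - stirling_log (n - i2)) - D)
           * Num.sqrt ((1 + a2) / (1 - b2) / ((1 + a1) / (1 - b1))) in
  G <= (1 + d ^- 2) * (rank_level n i2 d / rank_level n i1 d) /\
  rank_level n i2 d / rank_level n i1 d <= (1 + d ^- 2) * G.
Proof.
move=> i2_ltn.
have i2_ltn' : (0 < i2 < n)%N by rewrite i2_ltn (leq_trans _ i12).
have b1' := high_gap_lt1 d0 i1_ltn; have b2' := high_gap_lt1 d0 i2_ltn'.
have [[a10 b10 b11] ab1 e0 iE1 _] := gap_eqs d0 i1_n.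
have [[a20 b20 b21] ab2 _ iE2 _] := gap_eqs d0 i2_n.
have [u1 l1] := binomial_tail_bounds d0 i1_ltn.
have [u2 l2] := binomial_tail_bounds d0 i2_ltn'.
rewrite -!/(rank_level _ _ _) in u1 l1 u2 l2.
have T1 := rank_level_gt0 d0 i1_n; have T2 := rank_level_gt0 d0 i2_n.
have X1 : 0 < (1 + a1) / (1 - b1) by rewrite divr_gt0 ?subr_gt0 ?addr_gt0.
have X2 : 0 < (1 + a2) / (1 - b2) by rewrite divr_gt0 ?subr_gt0 ?addr_gt0.
move=> G.
have GE : tail_approx n i2 d = G * tail_approx n i1 d.
  rewrite /tail_approx /G [RHS]mulrACA -expRD; congr (expR _ * _); first by ring.
  by rewrite (sqrtrM _ (ltW X2)) sqrtrV ?(ltW X1)// mulrA mulfVK// gt_eqF ?sqrtr_gt0.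
have k0 : 0 < 1 + d ^- 2 :> R by rewrite addr_gt0 ?invr_gt0 ?exprn_gt0.
have G0 : 0 < G by rewrite mulr_gt0 ?expR_gt0// sqrtr_gt0 divr_gt0.
split.
  rewrite mulrA ler_pdivlMr//; apply: (le_trans _ l2); rewrite GE.
  by rewrite ler_pM2l.
rewrite ler_pdivrMr//; apply: (le_trans u2); rewrite GE.
by rewrite [(1 + d ^- 2) * G]mulrC -[leRHS]mulrA ler_pM2l.
Qed.

Lemma stirling_gap_le :
  stirling_log i1 - stirling_log i2 + (stirling_log (n - i1) - stirling_log (n - i2)) <= 2 :> R.
Proof.
have /andP[_ h1] := @stirling_log_le R _ _ i10 (ltnW i12).
have i1R : 1 <= i1%:R :> R by rewrite ler1n.
have h2 : (4 * i1%:R)^-1 <= 1 :> R by rewrite invf_le1; lra.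
suff h3 : stirling_log (n - i1) - stirling_log (n - i2) <= 1 :> R by lra.
have j10 : (0 < n - i1)%N by rewrite subn_gt0 (leq_trans i12).
(* the corank of i2 may be 0, where stirling_log is 0 by the convention ln 0 = 0 *)
have [->|j20] := posnP (n - i2).
  rewrite {2}/stirling_log fact0 ln1 ln0 ?lexx// mulr0 !addr0 subr0.
  have /andP[] := @stirling_log_le R _ _ (isT : (0 < 1)%N) j10.
  have -> : stirling_log 1 = 1 :> R by rewrite /stirling_log (_ : 1%N`! = 1%N)// ln1; ring.
  lra.
have := @stirling_log_le R _ _ j20 (leq_sub2l n (ltnW i12)); lra.
Qed.

Lemma rank_ratio_le_lt : (i2 < n)%N ->
  rank_level n i2 d / rank_level n i1 d <=
  2 * expR 2 * expR (- D) * Num.sqrt ((1 + a2) / (1 - b2) / ((1 + a1) / (1 - b1))).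
Proof.
move=> i2_ltn; have [_ h] := rank_ratio_approx i2_ltn.
apply: (le_trans h); rewrite mulrA ler_wpM2r ?sqrtr_ge0//.
rewrite -mulrA ler_pM ?expR_ge0//.
- by rewrite addr_ge0// invr_ge0 exprn_ge0// ltW.
- by rewrite -[leRHS]/(1 + 1) lerD2l invf_le1 ?exprn_gt0// exprn_ege1.
by rewrite -expRD ler_expR lerD2r stirling_gap_le.
Qed.

Lemma rank_ratio_le_max : i2 = n ->
  rank_level n i2 d / rank_level n i1 d <=
  2 * expR 2 * expR (- D) * (d / Num.sqrt ((1 + a1) / (1 - b1))).
Proof.
move=> i2E.
have b1' := high_gap_lt1 d0 i1_ltn.
have [[a10 b10 b11] ab1 e0 iE1 _] := gap_eqs d0 i1_n.
have [u1 l1] := binomial_tail_bounds d0 i1_ltn.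
rewrite -!/(rank_level _ _ _) in u1 l1.
have T1 := rank_level_gt0 d0 i1_n.
have X1 : 0 < (1 + a1) / (1 - b1) by rewrite divr_gt0 ?subr_gt0 ?addr_gt0.
have k0 : 0 < 1 + d ^- 2 :> R by rewrite addr_gt0 ?invr_gt0 ?exprn_gt0.
have k2 : 1 + d ^- 2 <= 2 :> R.
  by rewrite -[leRHS]/(1 + 1) lerD2l invf_le1 ?exprn_gt0// exprn_ege1.
have n0 : (0 < n)%N by apply: leq_trans i2n; apply: leq_trans i12.
have TE : rank_level n i2 d = expR (- (d ^+ 2 * rate a2 b2)).
  by rewrite i2E /rank_level binomial_tail_max.
rewrite ler_pdivrMr// TE.
have sg := stirling_gap_le.
have j20 : stirling_log (n - i2) = 0 :> R.
  by rewrite i2E subnn /stirling_log fact0 ln1 ln0 ?lexx// mulr0 !addr0 subr0.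
rewrite j20 subr0 in sg.
rewrite i2E in sg.
have s0 : 0 < Num.sqrt ((1 + a1) / (1 - b1)) by rewrite sqrtr_gt0.
set B := (X in _ <= X * _).
have B0 : 0 < B by rewrite /B !mulr_gt0 ?expR_gt0 ?invr_gt0.
apply: (@le_trans _ _ (B * (tail_approx n i1 d / (1 + d ^- 2)))); last first.
  by rewrite ler_pM2l// ler_pdivrMr// mulrC.
rewrite mulrA ler_pdivlMr// mulrC.
have -> : B * tail_approx n i1 d = 2 * expR (2 + - D
    + (stirling_log n - stirling_log i1 - stirling_log (n - i1) - d ^+ 2 * rate a1 b1)).
  rewrite /B /tail_approx [in RHS]expRD [in RHS](expRD 2); field; by rewrite !gt_eqF.
rewrite ler_pM ?expR_ge0 ?(ltW k0)// ler_expR.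
lra.
Qed.

(** The quotient is the odds ratio of i / n and the critical value, and i / n is the larger of
    the two. *)
Lemma odds_ge1 : 1 <= (1 + a1) / (1 - b1).
Proof.
have b1' := high_gap_lt1 d0 i1_ltn; have [[a10 b10 b11] _ _ _ _] := gap_eqs d0 i1_n.
by rewrite ler_pdivlMr ?subr_gt0// mul1r; lra.
Qed.

(** A prefactor of order d (1 + a2) suffices when the rates are far apart. Below the top rank
    the corank is at least 1, so the gap equation bounds 1 / (1 - b2) by a multiple of d^2; at the
    top rank the level lacks the factor 1 / d. *)
Lemma rank_ratio_crude :
  rank_level n i2 d / rank_level n i1 d <=
  4 * expR 2 * expR (- D) * d * (1 + a2).
Proof.
have o1 := odds_ge1; have o0 : 0 < (1 + a1) / (1 - b1) by exact: lt_le_trans o1.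
have [[a20 b20 b21] ab2 e0 iE2 jE2] := gap_eqs d0 i2_n.
have c0 : 0 <= 2 * expR 2 * expR (- D) by rewrite !mulr_ge0 ?expR_ge0.
have e4 : 4 * expR 2 * expR (- D) * d * (1 + a2) =
    (2 * expR 2 * expR (- D)) * (2 * d * (1 + a2)) by ring.
rewrite e4; have [i2E|i2N] := eqVneq i2 n.
  apply: (le_trans (rank_ratio_le_max i2E)); rewrite ler_wpM2l//.
  apply: (@le_trans _ _ d).
    rewrite ler_pdivrMr ?sqrtr_gt0// ler_peMr// ?(ltW d0)//.
    by rewrite -[leLHS]sqrtr1 ler_wsqrtr.
  have : 0 <= d * a2 by rewrite mulr_ge0 ?(ltW d0) ?(ltW a20).
  by have := d0; lra.
have i2_ltn : (i2 < n)%N by rewrite ltn_neqAle i2N.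
have i2_ltn' : (0 < i2 < n)%N by rewrite i2_ltn (leq_trans _ i12).
have b2' := high_gap_lt1 d0 i2_ltn'.
apply: (le_trans (rank_ratio_le_lt i2_ltn)); rewrite ler_wpM2l//.
rewrite -[leRHS]ger0_norm ?mulr_ge0 ?(ltW d0) ?addr_ge0 ?(ltW a20)//.
rewrite -sqrtr_sqr ler_wsqrtr//.
apply: (@le_trans _ _ ((1 + a2) / (1 - b2))).
  by rewrite ler_pdivrMr// ler_peMr// divr_ge0 ?subr_ge0// addr_ge0// ltW.
have bd : (1 - b2)^-1 <= 4 * d ^+ 2.
  have d2 : 1 <= d ^+ 2 by rewrite exprn_ege1.
  have [b2h|b2h] := leP b2 (2^-1).
    apply: (@le_trans _ _ 2); last by lra.
    by rewrite -[leRHS]invrK lef_pV2 ?posrE ?subr_gt0// ?invr_gt0//; lra.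
  rewrite -[leRHS]invrK lef_pV2 ?posrE ?subr_gt0 ?invr_gt0 ?mulr_gt0 ?exprn_gt0//.
  rewrite -[leLHS]mul1r ler_pdivrMr ?mulr_gt0 ?exprn_gt0//.
  have j2R : 1 <= n%:R - i2%:R :> R by rewrite -natrB// ler1n subn_gt0.
  have : b2 ^+ 2 + d ^+ 2 / n%:R <= d ^+ 2 * (1 - b2).
    by rewrite -jE2 ler_peMl// addr_ge0 ?sqr_ge0// ltW.
  have : 4^-1 <= b2 ^+ 2 by nra.
  lra.
apply: (@le_trans _ _ ((1 + a2) * (4 * d ^+ 2))); first by rewrite ler_wpM2l// addr_ge0// ltW.
rewrite (_ : (2 * d * (1 + a2)) ^+ 2 = (1 + a2) * (4 * d ^+ 2) * (1 + a2)); last by ring.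
have A0 : 0 <= 1 + a2 by lra.
have A1 : 0 <= (1 + a2) * (4 * d ^+ 2) by do 2 rewrite mulr_ge0 ?sqr_ge0//.
by rewrite ler_peMr//; lra.
Qed.

(** For b1 >= 1/2 the gap equation makes 1 - b comparable to the corank divided by d^2; the
    prefactor is at most the root of a quotient of coranks, which grows less than exponentially in
    the rank difference. *)
Lemma rank_ratio_top : 2^-1 <= b1 -> d ^+ 2 / n%:R <= 1 ->
  rank_level n i2 d / rank_level n i1 d <=
  2 * expR 2 * expR (i2%:R - i1%:R - D).
Proof.
move=> b1h e1.
have o1 := odds_ge1; have o0 : 0 < (1 + a1) / (1 - b1) by exact: lt_le_trans o1.
have [[a10 b10 b11] ab1 e0 iE1 jE1] := gap_eqs d0 i1_n.
have [[a20 b20 b21] ab2 _ iE2 jE2] := gap_eqs d0 i2_n.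
have la := low_gap_decr; have lb := high_gap_incr.
have b1' := high_gap_lt1 d0 i1_ltn.
have c0 : 0 <= 2 * expR 2 * expR (- D) by rewrite !mulr_ge0 ?expR_ge0.
have i12R : i1%:R + 1 <= i2%:R :> R by rewrite natr1 ler_nat.
rewrite [i2%:R - i1%:R - _]addrC (expRD (- D)) [leRHS]mulrA.
have sq (x y : R) : 0 <= x -> y <= 1 + 2 * x -> Num.sqrt y <= expR x.
  move=> x0 yx; rewrite -[leRHS]ger0_norm ?expR_ge0// -sqrtr_sqr ler_wsqrtr//.
  apply: (le_trans yx); rewrite -expRM_natl; exact: expR_ge1Dx.
have [i2E|i2N] := eqVneq i2 n.
  apply: (le_trans (rank_ratio_le_max i2E)); rewrite ler_wpM2l//.
  rewrite -[X in X / _](ger0_norm (ltW d0)) -sqrtr_sqr -sqrtrV ?(ltW o0)//.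
  rewrite -sqrtrM ?sqr_ge0// sq//; first by lra.
  rewrite invf_div mulrA ler_pdivrMr ?addr_gt0// -jE1 i2E.
  have : b1 ^+ 2 <= 1 by rewrite expr_le1// ltW.
  have j1 : 0 <= n%:R - i1%:R :> R by rewrite -i2E; lra.
  move=> b1s; apply: (@le_trans _ _ ((n%:R - i1%:R) * 2)).
    by rewrite ler_wpM2l//; lra.
  have := mulr_ge0 j1 (ltW a10); lra.
have i2_ltn : (i2 < n)%N by rewrite ltn_neqAle i2N.
have i2_ltn' : (0 < i2 < n)%N by rewrite i2_ltn (leq_trans _ i12).
have b2' := high_gap_lt1 d0 i2_ltn'.
apply: (le_trans (rank_ratio_le_lt i2_ltn)); rewrite ler_wpM2l// sq//; first by lra.
have j2R : 1 <= n%:R - i2%:R :> R by rewrite -natrB// ler1n subn_gt0.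
have q1 : 0 < 1 - b1 by rewrite subr_gt0.
have q2 : 0 < 1 - b2 by rewrite subr_gt0.
apply: (@le_trans _ _ ((1 - b1) / (1 - b2))).
  rewrite (_ : _ / _ = (1 - b1) / (1 - b2) * ((1 + a2) / (1 + a1))); last first.
    by field; rewrite !gt_eqF// addr_gt0.
  by rewrite ler_piMr ?ler_pdivrMr ?mul1r ?lerD2l ?(ltW la) ?divr_ge0 ?addr_gt0// ltW.
rewrite ler_pdivrMr//.
have dd : 0 < d ^+ 2 by rewrite exprn_gt0.
rewrite -(ler_pM2l dd) -jE1 mulrCA -jE2.
have E12 : b1 ^+ 2 + d ^+ 2 / n%:R <= b2 ^+ 2 + d ^+ 2 / n%:R.
  by rewrite lerD2r ler_pXn2r ?nnegrE ?(ltW b10) ?(ltW b20) ?(ltW lb).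
apply: (@le_trans _ _ ((n%:R - i1%:R) * (b2 ^+ 2 + d ^+ 2 / n%:R))).
  by rewrite ler_wpM2l//; lra.
rewrite mulrA ler_wpM2r ?addr_ge0 ?sqr_ge0 ?(ltW e0)//.
have : 0 <= (n%:R - i2%:R - 1) * (i2%:R - i1%:R) :> R by rewrite mulr_ge0; lra.
have : 0 <= (n%:R - i2%:R) * (i2%:R - i1%:R) :> R by rewrite mulr_ge0; lra.
lra.
Qed.

End rank_pair.

(** * Limits of real sequences *)

Section limits.
Context {R : realType}.
Implicit Types (f g : nat -> R) (a b : R).

Lemma seqlim_eq f g a b : f @ \oo --> a -> (\forall n \near \oo, f n = g n) -> a = b ->
  g @ \oo --> b.
Proof.
move=> fa fg <-; apply: cvg_trans fa; apply: near_eq_cvg.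
by apply: filterS fg => n ->.
Qed.

Lemma seqlim_cst a : (fun _ : nat => a) @ \oo --> a.
Proof. exact: cvg_cst. Qed.

(** The limit laws for sequences given by explicit formulas in n, the form in which gaps and
    ranks occur. *)
Lemma seqlimD f g a b : f @ \oo --> a -> g @ \oo --> b ->
  (fun n => f n + g n) @ \oo --> a + b.
Proof. exact: cvgD. Qed.

Lemma seqlimB f g a b : f @ \oo --> a -> g @ \oo --> b ->
  (fun n => f n - g n) @ \oo --> a - b.
Proof. exact: cvgB. Qed.

Lemma seqlimN f a : f @ \oo --> a -> (fun n => - f n) @ \oo --> - a.
Proof. exact: cvgN. Qed.

Lemma seqlimM f g a b : f @ \oo --> a -> g @ \oo --> b ->
  (fun n => f n * g n) @ \oo --> a * b.
Proof. exact: cvgM. Qed.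

Lemma seqlimV f a : f @ \oo --> a -> a != 0 -> (fun n => (f n)^-1) @ \oo --> a^-1.
Proof. by move=> fa a0; exact: cvgV. Qed.

Lemma seqlimX k f a : f @ \oo --> a -> (fun n => f n ^+ k) @ \oo --> a ^+ k.
Proof. by move=> fa; apply: (cvg_comp _ (fun x : R => x ^+ k) fa); exact: exprn_continuous. Qed.

Lemma seqlim_sqrt f a : f @ \oo --> a -> (fun n => Num.sqrt (f n)) @ \oo --> Num.sqrt a.
Proof. by move=> fa; apply: (cvg_comp _ (@Num.sqrt R) fa); exact: sqrt_continuous. Qed.

Lemma seqlim_expR f a : f @ \oo --> a -> (fun n => expR (f n)) @ \oo --> expR a.
Proof. by move=> fa; apply: (cvg_comp _ (@expR R) fa); exact: continuous_expR. Qed.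

Lemma seqlim_ln f a : 0 < a -> f @ \oo --> a -> (fun n => ln (f n)) @ \oo --> ln a.
Proof. by move=> a0 fa; apply: (cvg_comp _ (@ln R) fa); exact: continuous_ln. Qed.

Lemma seqlim_inv0 f : (\forall n \near \oo, 0 < f n) -> f @ \oo --> +oo ->
  (fun n => (f n)^-1) @ \oo --> (0 : R).
Proof. by move=> f0 foo; apply/gtr0_cvgV0. Qed.

Lemma seqlim_invy f : (\forall n \near \oo, 0 < f n) -> f @ \oo --> (0 : R) ->
  (fun n => (f n)^-1) @ \oo --> +oo.
Proof. by move=> f0 foo; apply/cvgrVy. Qed.

Lemma seqlimMy f g a : 0 < a -> f @ \oo --> +oo -> g @ \oo --> a ->
  (fun n => f n * g n) @ \oo --> +oo.
Proof.
move=> a0 fy ga; apply/cvgryPge => A.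
have a2 : 0 < a / 2 by rewrite divr_gt0.
near=> n.
have f1 : `|A| / (a / 2) <= f n by near: n; exact: cvgry_ge.
have g1 : a / 2 <= g n.
  by near: n; apply: (cvgr_ge a ga); rewrite ltr_pdivrMr// ltr_pMr// ltr1n.
apply: (le_trans (ler_norm A)).
rewrite -[leLHS](@divfK _ (a / 2)) ?gt_eqF// ler_pM// ?(ltW a2)//.
by rewrite divr_ge0// ltW.
Unshelve. all: by end_near. Qed.

Lemma seqlimDy f g a : f @ \oo --> +oo -> g @ \oo --> a ->
  (fun n => f n + g n) @ \oo --> +oo.
Proof.
move=> fy ga; apply/cvgryPge => A; near=> n.
have f1 : A - (a - 1) <= f n by near: n; exact: cvgry_ge.
have g1 : a - 1 <= g n by near: n; apply: (cvgr_ge a ga); rewrite gtrBl.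
lra.
Unshelve. all: by end_near. Qed.

Lemma seqlimDyy f g : f @ \oo --> +oo -> g @ \oo --> +oo ->
  (fun n => f n + g n) @ \oo --> +oo.
Proof.
move=> fy gy; apply/cvgryPge => A; near=> n.
have f1 : A <= f n by near: n; exact: cvgry_ge.
have g1 : 0 <= g n by near: n; exact: cvgry_ge.
lra.
Unshelve. all: by end_near. Qed.

Lemma seqlim_expNy f : f @ \oo --> +oo -> (fun n => expR (- f n)) @ \oo --> (0 : R).
Proof.
move=> fy; apply: (@seqlim_eq (fun n => (expR (f n))^-1) _ 0 0) => //; last first.
  by apply: nearW => n; rewrite expRN.
apply: seqlim_inv0; first by apply: nearW => n; exact: expR_gt0.
apply: (ger_cvgy _ fy); apply: nearW => n.
by apply: le_trans (expR_ge1Dx _); rewrite lerDr.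
Qed.

Lemma seqlim_squeeze0 f g : (\forall n \near \oo, 0 <= f n <= g n) -> g @ \oo --> (0 : R) ->
  f @ \oo --> (0 : R).
Proof. by move=> fg g0; apply: (squeeze_cvgr fg) => //; exact: cvg_cst. Qed.

Lemma seqlim_sqr0 f : (fun n => f n ^+ 2) @ \oo --> (0 : R) -> f @ \oo --> (0 : R).
Proof.
move=> /seqlim_sqrt; rewrite sqrtr0 => h; apply/norm_cvg0P.
by apply: (seqlim_eq h) => //; apply: nearW => n; rewrite sqrtr_sqr.
Qed.

Lemma seqlim_le f g a b : (\forall n \near \oo, f n <= g n) ->
  f @ \oo --> a -> g @ \oo --> b -> a <= b.
Proof. by move=> fg fa gb; exact: ler_cvg_to fa gb fg. Qed.

Lemma seqlim_gt0_near f a : 0 < a -> f @ \oo --> a -> \forall n \near \oo, 0 < f n.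
Proof. by move=> a0 fa; exact: (cvgr_gt a fa). Qed.

Lemma seqlim_uniq f a b : f @ \oo --> a -> f @ \oo --> b -> a = b.
Proof. exact: cvg_unique. Qed.

Lemma seqlim_not_y f a : f @ \oo --> a -> f @ \oo --> +oo -> False.
Proof.
move=> fa /cvgry_gt/(_ (a + 1)) h.
have h2 : \forall n \near \oo, f n < a + 1 by apply: (cvgr_lt a fa); rewrite ltrDl.
by have [n [h3 h4]] := filter_ex (filterI h h2); move: (lt_trans h3 h4); rewrite ltxx.
Qed.

End limits.

Arguments seqlim_cst {R} a.
Arguments seqlimX {R} k {f a} _.

(** * Growth of the critical value *)

Section critical_value.
Context {R : realType}.
Variable t : R.
Local Notation u := (@u R).
Local Notation dl := (@dHC R t).

Lemma u_cvgy : u @ \oo --> +oo.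
Proof.
apply/cvgryPge => A; near=> n.
have n1 : expR (expR A) <= n%:R by near: n; exact: nbhs_infty_ger.
have l1 : expR A <= ln n%:R.
  by rewrite -[leLHS]expRK ler_ln ?posrE ?expR_gt0// (lt_le_trans _ n1) ?expR_gt0.
by rewrite /u -[leLHS]expRK ler_ln ?posrE ?expR_gt0// (lt_le_trans _ l1) ?expR_gt0.
Unshelve. all: by end_near. Qed.

Lemma near_u_ge (A : R) : \forall n \near \oo, A <= u n.
Proof. exact: cvgry_ge u_cvgy A. Qed.

Lemma near_u_gt0 : \forall n \near \oo, 0 < u n.
Proof. exact: cvgry_gt u_cvgy 0. Qed.

Lemma inv_u_cvg0 : (fun n => (u n)^-1) @ \oo --> (0 : R).
Proof. exact: seqlim_inv0 near_u_gt0 u_cvgy. Qed.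

(** Powers of u, and with them powers of d, are negligible against n = exp (exp u). *)
Lemma near_n_ge_exp_u : \forall n \near \oo, expR (expR (u n)) <= n%:R.
Proof.
near=> n.
have u1 : 0 < u n by near: n; exact: near_u_gt0.
have n2 : 1 < n%:R :> R by rewrite ltr1n; near: n; exact: nbhs_infty_ge.
by rewrite /u lnK ?posrE ?ln_gt0// lnK ?posrE// (lt_trans _ n2).
Unshelve. all: by end_near. Qed.

(** From ln x <= 2 sqrt x. *)
Lemma ln_u_div_cvg0 : (fun n => ln (u n) / u n) @ \oo --> (0 : R).
Proof.
apply: (@seqlim_squeeze0 _ _ (fun n => 2 * Num.sqrt ((u n)^-1))).
  near=> n; have u1 : 1 <= u n by near: n; exact: near_u_ge.
  have u0 : 0 < u n by exact: lt_le_trans u1.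
  have s0 : 0 < Num.sqrt (u n) by rewrite sqrtr_gt0.
  rewrite divr_ge0 ?(ln_ge0 u1) ?(ltW u0)//=.
  rewrite (ler_pdivrMr _ _ u0) sqrtrV ?(ltW u0)//.
  rewrite -{3}(sqr_sqrtr (ltW u0)) expr2 -mulrA mulKf ?gt_eqF//.
  rewrite -{1}(sqr_sqrtr (ltW u0)) lnXn// mulr_natl lerMn2r/=.
  by rewrite ltW// ln_sublinear.
apply: (seqlim_eq (seqlimM (seqlim_cst (2 : R)) (seqlim_sqrt inv_u_cvg0))).
  exact: nearW.
by rewrite sqrtr0 mulr0.
Unshelve. all: by end_near. Qed.

Lemma sqr_dHC_div_cvg : (fun n => dl n ^+ 2 / u n) @ \oo --> (2 : R).
Proof.
have h1 : (fun n => t * (u n)^-1 + 2 + (ln (u n) / u n - ln pi * (u n)^-1) / 2) @ \oo -->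
    t * 0 + 2 + (0 - ln pi * 0) / 2.
  apply: seqlimD.
    apply: seqlimD; last exact: seqlim_cst.
    by apply: seqlimM; [exact: seqlim_cst|exact: inv_u_cvg0].
  apply: seqlimM; last exact: seqlim_cst.
  apply: seqlimB; first exact: ln_u_div_cvg0.
  by apply: seqlimM; [exact: seqlim_cst|exact: inv_u_cvg0].
apply: (seqlim_eq (seqlimM (seqlimX 2 h1) (seqlim_cst (2^-1 : R)))); last by field.
near=> n; have u0 : 0 < u n by near: n; exact: near_u_gt0.
rewrite /dHC exprMn exprVn sqr_sqrtr ?mulr_ge0 ?(ltW u0)//.
by field; rewrite gt_eqF.
Unshelve. all: by end_near. Qed.

Lemma dHC_cvgy : dl @ \oo --> +oo.
Proof.
apply/cvgryPge => A; near=> n.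
have u0 : 0 < u n by near: n; exact: near_u_gt0.
have uA : A ^+ 2 <= u n by near: n; exact: near_u_ge.
have r1 : 1 < dl n ^+ 2 / u n.
  by near: n; apply: (cvgr_gt _ sqr_dHC_div_cvg); rewrite ltr1n.
have d2 : A ^+ 2 <= dl n ^+ 2 by apply: (le_trans uA); move: r1; rewrite ltr_pdivlMr// mul1r => /ltW.
have un : - (t - ln pi / 2) <= u n by near: n; exact: near_u_ge.
have u1 : 1 <= u n by near: n; exact: near_u_ge.
have dn : 0 <= dl n.
  rewrite /dHC divr_ge0 ?sqrtr_ge0//.
  have := ln_ge0 u1; lra.
have [A0|A0] := leP A 0; first exact: le_trans A0 dn.
by rewrite -(@ler_pXn2r _ 2)// nnegrE ltW.
Unshelve. all: by end_near. Qed.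

Lemma near_dHC_ge (A : R) : \forall n \near \oo, A <= dl n.
Proof. exact: cvgry_ge dHC_cvgy A. Qed.

(** As d^2 is of order u, this compares a power of u with exp (exp u). *)
Lemma dHC_pow_div_cvg0 (k : nat) : (fun n => dl n ^+ k / n%:R) @ \oo --> (0 : R).
Proof.
pose c : R := 3 ^+ k * k.+1`!%:R.
apply: (@seqlim_squeeze0 _ _ (fun n => c * (u n)^-1)); last first.
  by apply: (seqlim_eq (seqlimM (seqlim_cst c) inv_u_cvg0)); [exact: nearW|rewrite mulr0].
near=> n.
have u0 : 0 < u n by near: n; exact: near_u_gt0.
have d1 : 1 <= dl n by near: n; exact: near_dHC_ge.
have r3 : dl n ^+ 2 / u n < 3.
  by near: n; apply: (cvgr_lt _ sqr_dHC_div_cvg); rewrite ltr_nat.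
have nE : expR (expR (u n)) <= n%:R by near: n; exact: near_n_ge_exp_u.
have n0 : 0 < n%:R :> R by apply: lt_le_trans nE; exact: expR_gt0.
have d0 : 0 <= dl n by apply: le_trans d1.
rewrite divr_ge0 ?exprn_ge0 ?(ltW n0)//=.
have d2 : dl n ^+ k <= 3 ^+ k * u n ^+ k.
  rewrite -exprMn; apply: (@le_trans _ _ ((dl n ^+ 2) ^+ k)).
    by apply: lerXn2r; rewrite ?nnegrE ?exprn_ge0// expr2 ler_peMl.
  have d20 : 0 <= dl n ^+ 2 by rewrite sqr_ge0.
  have u30 : 0 <= 3 * u n by lra.
  apply: lerXn2r; rewrite ?nnegrE//.
  by move: r3; rewrite (ltr_pdivrMr _ _ u0) => /ltW.
have un : u n ^+ k.+1 / k.+1`!%:R <= n%:R.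
  apply: (le_trans _ nE); apply: (@le_trans _ _ (expR (u n))).
    by apply: le_trans (expR_ge1Dxn k (ltW u0)); rewrite lerDr.
  by apply: le_trans (expR_ge1Dx _); rewrite lerDr.
rewrite ler_pdivrMr//; apply: (le_trans d2).
rewrite ler_pdivrMr ?ltr0n ?fact_gt0// in un.
rewrite /c -!mulrA ler_pM2l ?exprn_gt0//.
rewrite -(ler_pM2r u0) -exprSr; apply: (le_trans un).
rewrite [leRHS](_ : _ = n%:R * k.+1`!%:R)//; field.
by rewrite gt_eqF.
Unshelve. all: by end_near. Qed.

End critical_value.

(** * Gaps of ranks of order u at either end *)

Section gap_limits.
Context {R : realType}.
Variables (t : R) (i : nat -> nat).
Hypothesis hi : \forall n \near \oo, (0 < i n <= n)%N.
Local Notation u := (@u R).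
Local Notation dl := (@dHC R t).
Local Notation E n := (dl n ^+ 2 / n%:R).

Definition low_seq (n : nat) : R := low_gap n (i n) (dl n).
Definition high_seq (n : nat) : R := high_gap n (i n) (dl n).

Lemma dHC_pow_eps_cvg0 (k : nat) : (fun n => dl n ^+ k * E n) @ \oo --> (0 : R).
Proof.
apply: (seqlim_eq (dHC_pow_div_cvg0 t (k + 2))) => //.
by apply: nearW => n; rewrite exprD mulrA.
Qed.

Lemma eps_cvg0 : (fun n => E n) @ \oo --> (0 : R).
Proof. exact: dHC_pow_div_cvg0. Qed.

Lemma near_gap_eqs : \forall n \near \oo, let a := low_seq n in let b := high_seq n in
  [/\ [/\ 0 < a, 0 < b & b <= 1], a * b = E n, 0 < E n,
   (i n)%:R * (a ^+ 2 + E n) = dl n ^+ 2 * (1 + a) &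
   corank i n * (b ^+ 2 + E n) = dl n ^+ 2 * (1 - b)].
Proof.
near=> n.
have d0 : 0 < dl n by apply: (@lt_le_trans _ _ 1) => //; near: n; exact: near_dHC_ge.
have i_n : (0 < i n <= n)%N by near: n.
exact: gap_eqs d0 i_n.
Unshelve. all: by end_near. Qed.

(** Let q = i / d^2, which tends to c / 2. Then z = 1 / a is the nonnegative root of
    (1 - q eps) z^2 + z = q with eps = d^2 / n, a continuous function of the coefficients. The
    reciprocal is used because a tends to infinity if c = 0. *)
Lemma inv_low_gap_cvg c : 0 <= c -> classA c i ->
  exists r, [/\ 0 <= r, r ^+ 2 + r = c / 2 & (fun n => (low_seq n)^-1) @ \oo --> r].
Proof.
move=> c0 ic.
pose m : R := c / 2; have m0 : 0 <= m by rewrite divr_ge0.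
have mn : (fun n => (i n)%:R / dl n ^+ 2) @ \oo --> m.
  have two0 : (2 : R) != 0 by [].
  apply: (seqlim_eq (seqlimM ic (seqlimV (sqr_dHC_div_cvg t) two0))) => //.
  near=> n; have u0 : 0 < u n by near: n; exact: near_u_gt0.
  have d1 : 1 <= dl n by near: n; exact: near_dHC_ge.
  by field; rewrite !gt_eqF//; lra.
have wn : (fun n => 1 - (i n)%:R / dl n ^+ 2 * E n) @ \oo --> 1 - m * 0.
  by apply: seqlimB; [exact: seqlim_cst|apply: seqlimM => //; exact: eps_cvg0].
rewrite mulr0 subr0 in wn.
pose r := 2 * m / (1 + Num.sqrt (1 + 4 * m)).
have s0 : 0 <= Num.sqrt (1 + 4 * m) by exact: sqrtr_ge0.
have s1 : 0 < 1 + Num.sqrt (1 + 4 * m) by rewrite ltr_pwDl.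
exists r; split; first by rewrite divr_ge0 ?mulr_ge0 ?(ltW s1).
  have ss : Num.sqrt (1 + 4 * m) ^+ 2 = 1 + 4 * m.
    by rewrite sqr_sqrtr// addr_ge0// mulr_ge0.
  have rs : r = (Num.sqrt (1 + 4 * m) - 1) / 2.
    apply: (mulIf (lt0r_neq0 s1)); rewrite /r divfK ?gt_eqF//.
    by lra.
  by rewrite rs -/m; lra.
have lim : (fun n => 2 * ((i n)%:R / dl n ^+ 2)
     / (1 + Num.sqrt (1 + 4 * ((i n)%:R / dl n ^+ 2) * (1 - (i n)%:R / dl n ^+ 2 * E n))))
    @ \oo --> 2 * m / (1 + Num.sqrt (1 + 4 * m * 1)).
  apply: seqlimM; first by apply: seqlimM => //; exact: seqlim_cst.
  apply: seqlimV; last by rewrite mulr1 gt_eqF.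
  apply: seqlimD; first exact: seqlim_cst.
  apply: seqlim_sqrt; apply: seqlimD; first exact: seqlim_cst.
  by apply: seqlimM => //; apply: seqlimM => //; exact: seqlim_cst.
apply: (seqlim_eq lim); last by rewrite mulr1.
near=> n.
have d1 : 1 <= dl n by near: n; exact: near_dHC_ge.
have d0 : 0 < dl n ^+ 2 by rewrite exprn_gt0//; lra.
have w0 : 0 < 1 - (i n)%:R / dl n ^+ 2 * E n.
  by near: n; exact: (seqlim_gt0_near ltr01 wn).
have [|[a0 b0 b1] ab e0 iE _] := near near_gap_eqs n; first by [].
set q := (i n)%:R / dl n ^+ 2 in w0 *.
have qa : q * (low_seq n ^+ 2 + E n) = 1 + low_seq n.
  by rewrite /q mulrAC iE mulrC mulKf// gt_eqF.
set w := 1 - q * E n in w0 *; set z := (low_seq n)^-1.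
have z0 : 0 < z by rewrite invr_gt0.
have zq : z * (1 + w * z) = q.
  have aN : low_seq n != 0 by rewrite gt_eqF.
  have za : z * low_seq n = 1 by rewrite mulVf.
  apply: (@mulIf _ (low_seq n ^+ 2)); first by rewrite expf_neq0.
  transitivity ((z * low_seq n) * (low_seq n + w * (z * low_seq n))); first by ring.
  by rewrite za /w; move: qa; lra.
have -> : Num.sqrt (1 + 4 * q * w) = 1 + 2 * w * z.
  rewrite -[RHS]ger0_norm ?addr_ge0 ?mulr_ge0 ?(ltW w0) ?(ltW z0)// -sqrtr_sqr.
  by congr Num.sqrt; rewrite -zq; ring.
have wz0 : 0 < 1 + w * z by rewrite addr_gt0// mulr_gt0.
rewrite -{1}zq [1 + (1 + _)](_ : _ = 2 * (1 + w * z)); last by ring.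
by field; rewrite gt_eqF.
Unshelve. all: by end_near. Qed.

(** Let q = (n - i) / d^2, which tends to c / 2. Then b is the positive root of
    q b^2 + b = 1 - q eps with eps = d^2 / n. *)
Lemma high_gap_cvg c : 0 <= c -> classAbar c i ->
  exists b, [/\ 0 < b, b <= 1, c / 2 * b ^+ 2 + b = 1 & high_seq @ \oo --> b].
Proof.
move=> c0 ic.
pose m : R := c / 2; have m0 : 0 <= m by rewrite divr_ge0.
have mn : (fun n => corank i n / dl n ^+ 2) @ \oo --> m.
  have two0 : (2 : R) != 0 by [].
  apply: (seqlim_eq (seqlimM ic (seqlimV (sqr_dHC_div_cvg t) two0))) => //.
  near=> n; have u0 : 0 < u n by near: n; exact: near_u_gt0.
  have d1 : 1 <= dl n by near: n; exact: near_dHC_ge.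
  by field; rewrite !gt_eqF//; lra.
have wn : (fun n => 1 - corank i n / dl n ^+ 2 * E n) @ \oo --> 1 - m * 0.
  by apply: seqlimB; [exact: seqlim_cst|apply: seqlimM => //; exact: eps_cvg0].
rewrite mulr0 subr0 in wn.
pose b := 2 / (1 + Num.sqrt (1 + 4 * m)).
have s1 : 1 <= Num.sqrt (1 + 4 * m).
  by rewrite -[leLHS]sqrtr1 ler_wsqrtr// lerDl mulr_ge0.
have s2 : 0 < 1 + Num.sqrt (1 + 4 * m) by lra.
have ss : Num.sqrt (1 + 4 * m) ^+ 2 = 1 + 4 * m.
  by rewrite sqr_sqrtr// addr_ge0// mulr_ge0.
exists b; split; first by rewrite divr_gt0.
- by rewrite ler_pdivrMr//; lra.
- rewrite -/m /b.
  have mE : m = (Num.sqrt (1 + 4 * m) ^+ 2 - 1) / 4 by rewrite ss; field.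
  by rewrite {1}mE; field; rewrite gt_eqF.
have lim : (fun n => 2 * (1 - corank i n / dl n ^+ 2 * E n)
     / (1 + Num.sqrt (1 + 4 * (corank i n / dl n ^+ 2) * (1 - corank i n / dl n ^+ 2 * E n))))
    @ \oo --> 2 * 1 / (1 + Num.sqrt (1 + 4 * m * 1)).
  apply: seqlimM; first by apply: seqlimM => //; exact: seqlim_cst.
  apply: seqlimV; last by rewrite mulr1 gt_eqF.
  apply: seqlimD; first exact: seqlim_cst.
  apply: seqlim_sqrt; apply: seqlimD; first exact: seqlim_cst.
  by apply: seqlimM => //; apply: seqlimM => //; exact: seqlim_cst.
apply: (seqlim_eq lim); last by rewrite !mulr1.
near=> n.
have d1 : 1 <= dl n by near: n; exact: near_dHC_ge.
have d0 : 0 < dl n ^+ 2 by rewrite exprn_gt0//; lra.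
have i_n : (0 < i n <= n)%N by near: n.
have [|[a0 b0 b1] ab e0 _ jE] := near near_gap_eqs n; first by [].
set q := corank i n / dl n ^+ 2.
have q0 : 0 <= q.
  by rewrite divr_ge0 ?(ltW d0)// subr_ge0 ler_nat; case/andP: i_n.
have qb : q * (high_seq n ^+ 2 + E n) = 1 - high_seq n.
  by rewrite /q mulrAC jE mulrC mulKf// gt_eqF.
have wE : 1 - q * E n = high_seq n * (1 + q * high_seq n) by move: qb; lra.
rewrite wE.
have -> : Num.sqrt (1 + 4 * q * (high_seq n * (1 + q * high_seq n))) = 1 + 2 * q * high_seq n.
  have r0 : 0 <= 1 + 2 * q * high_seq n.
    by rewrite addr_ge0// mulr_ge0 ?(ltW b0)// mulr_ge0.
  by rewrite -[RHS](ger0_norm r0) -sqrtr_sqr; congr Num.sqrt; ring.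
have wz0 : 0 < 1 + q * high_seq n by rewrite ltr_wpDr// mulr_ge0// ltW.
rewrite [1 + (1 + _)](_ : _ = 2 * (1 + q * high_seq n)); last by ring.
by field; rewrite gt_eqF.
Unshelve. all: by end_near. Qed.

End gap_limits.

(** * Small gaps *)

(** Here y is a rank and x its low gap (th = 1), or y a corank and x its high gap (th = -1). *)
Section small_gaps.
Context {R : realType}.
Variables (t th : R) (x y : nat -> R).
Local Notation u := (@u R).
Local Notation dl := (@dHC R t).
Local Notation E n := (dl n ^+ 2 / n%:R).
Hypothesis th1 : `|th| <= 1.
Hypothesis x0 : \forall n \near \oo, 0 < x n.
Hypothesis xy : \forall n \near \oo, y n * (x n ^+ 2 + E n) = dl n ^+ 2 * (1 + th * x n).

Lemma dHC6_div_cvg : (fun n => dl n ^+ 6 / u n ^+ 3) @ \oo --> (8 : R).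
Proof.
apply: (seqlim_eq (seqlimX 3 (sqr_dHC_div_cvg t))); last by ring.
by apply: nearW => n; rewrite expr_div_n -exprM.
Qed.

Lemma near_div_u_gt0 : (fun n => y n / u n) @ \oo --> +oo -> \forall n \near \oo, 0 < y n.
Proof.
move=> yu; near=> n.
have u0 : 0 < u n by near: n; exact: near_u_gt0.
have : 0 < y n / u n by near: n; exact: cvgry_gt.
by rewrite pmulr_lgt0// invr_gt0.
Unshelve. all: by end_near. Qed.

(** The equation gives x^2 <= (d^2 / y) (1 + x), and d^2 / y tends to 0. *)
Lemma small_gap_cvg0 : (fun n => y n / u n) @ \oo --> +oo -> x @ \oo --> (0 : R).
Proof.
move=> yu; apply: seqlim_sqr0.
have dy : (fun n => dl n ^+ 2 / y n) @ \oo --> (0 : R).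
  have yu0 : \forall n \near \oo, 0 < y n / u n by exact: cvgry_gt.
  apply: (seqlim_eq (seqlimM (sqr_dHC_div_cvg t) (seqlim_inv0 yu0 yu))); last exact: mulr0.
  near=> n; have u0 : 0 < u n by near: n; exact: near_u_gt0.
  have y0 : 0 < y n by near: n; exact: near_div_u_gt0.
  by field; rewrite !gt_eqF.
apply: (@seqlim_squeeze0 _ _ (fun n => 2 * (dl n ^+ 2 / y n))); last first.
  by apply: (seqlim_eq (seqlimM (seqlim_cst (2 : R)) dy)); [exact: nearW|exact: mulr0].
near=> n; rewrite sqr_ge0/=.
have y0 : 0 < y n by near: n; exact: near_div_u_gt0.
have xn : 0 < x n by near: n.
have d1 : 1 <= dl n by near: n; exact: near_dHC_ge.
have h : y n * (x n ^+ 2 + E n) = dl n ^+ 2 * (1 + th * x n) by near: n.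
have q2 : dl n ^+ 2 / y n < 2^-1 by near: n; apply: (cvgr_lt _ dy); rewrite invr_gt0.
have q0 : 0 <= dl n ^+ 2 / y n by rewrite divr_ge0 ?sqr_ge0// ltW.
have e0 : 0 <= E n by rewrite divr_ge0 ?sqr_ge0.
have tx : th * x n <= x n by rewrite ler_piMl ?(ltW xn)// (le_trans (ler_norm _)).
have xE : x n ^+ 2 + E n = dl n ^+ 2 / y n * (1 + th * x n).
  by rewrite [RHS]mulrAC -h [in RHS]mulrC mulKf// gt_eqF.
have x2 : x n ^+ 2 <= dl n ^+ 2 / y n * (1 + x n).
  apply: (@le_trans _ _ (x n ^+ 2 + E n)); first by rewrite lerDl.
  by rewrite xE ler_wpM2l// lerD2l.
set q := dl n ^+ 2 / y n in q2 q0 x2 *.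
have x1 : x n <= 1.
  rewrite leNgt; apply/negP => x1.
  have : q * (1 + x n) <= 2^-1 * (1 + x n) by rewrite ler_wpM2r ?addr_ge0 ?ltW.
  by have : 1 * x n < x n * x n by [rewrite ltr_pM2r]; rewrite expr2 in x2; lra.
by apply: (le_trans x2); rewrite mulrC ler_wpM2r//; lra.
Unshelve. all: by end_near. Qed.

(** The equation solved for (d^2 x)^2. As d^6 / u^3 tends to 8, the limit of y / u^3 determines
    that of d^2 x; this is where the scale u^3 comes from. *)
Lemma sqr_scaled_gap : (fun n => y n / u n) @ \oo --> +oo ->
  \forall n \near \oo, (dl n ^+ 2 * x n) ^+ 2 =
    (y n / u n ^+ 3)^-1 * (dl n ^+ 6 / u n ^+ 3 * (1 + th * x n)) - dl n ^+ 4 * E n.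
Proof.
move=> yu; near=> n.
have y0 : 0 < y n by near: n; exact: near_div_u_gt0.
have u0 : 0 < u n by near: n; exact: near_u_gt0.
have h : y n * (x n ^+ 2 + E n) = dl n ^+ 2 * (1 + th * x n) by near: n.
transitivity (dl n ^+ 4 * (y n * (x n ^+ 2 + E n)) / y n - dl n ^+ 4 * E n).
  move: (E n) => e; by field; rewrite gt_eqF.
by rewrite h; move: (E n) => e; field; rewrite !gt_eqF.
Unshelve. all: by end_near. Qed.

Lemma scaled_gap_factor_cvg : x @ \oo --> (0 : R) ->
  (fun n => dl n ^+ 6 / u n ^+ 3 * (1 + th * x n)) @ \oo --> (8 : R).
Proof.
move=> xc.
apply: (seqlim_eq (seqlimM dHC6_div_cvg (seqlimD (seqlim_cst (1 : R)) (seqlimM (seqlim_cst th) xc)))).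
  exact: nearW.
by rewrite mulr0 addr0 mulr1.
Qed.

Lemma scaled_gap_cvg (c : R) : 0 < c -> (fun n => y n / u n ^+ 3) @ \oo --> c ->
  x @ \oo --> (0 : R) /\ (fun n => dl n ^+ 2 * x n) @ \oo --> Num.sqrt (8 / c).
Proof.
move=> c0 yc.
have yu : (fun n => y n / u n) @ \oo --> +oo.
  have u2 : (fun n => u n ^+ 2) @ \oo --> +oo.
    apply: (ger_cvgy _ (@u_cvgy R)); near=> n; rewrite expr2 ler_peMl//.
      by near: n; exact: near_u_ge.
    by near: n; exact: near_u_ge.
  apply: cvg_trans (seqlimMy c0 u2 yc); apply: near_eq_cvg; near=> n.
  have u0 : 0 < u n by near: n; exact: near_u_gt0.
  by field; rewrite gt_eqF.
have xc := small_gap_cvg0 yu; split=> //.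
have c0' : c != 0 by rewrite gt_eqF.
have h := seqlim_sqrt (seqlimB (seqlimM (seqlimV yc c0') (scaled_gap_factor_cvg xc))
  (dHC_pow_eps_cvg0 t 4)).
apply: (seqlim_eq h); last by rewrite subr0 mulrC.
near=> n.
have -> : (y n / u n ^+ 3)^-1 * (dl n ^+ 6 / u n ^+ 3 * (1 + th * x n)) - dl n ^+ 4 * E n
   = (dl n ^+ 2 * x n) ^+ 2 by apply/esym; near: n; exact: sqr_scaled_gap.
have xn : 0 < x n by near: n.
by rewrite sqrtr_sqr ger0_norm// mulr_ge0 ?sqr_ge0// ltW.
Unshelve. all: by end_near. Qed.

Lemma scaled_gap_cvgy : (fun n => y n / u n) @ \oo --> +oo ->
  (fun n => y n / u n ^+ 3) @ \oo --> (0 : R) ->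
  x @ \oo --> (0 : R) /\ (fun n => dl n ^+ 2 * x n) @ \oo --> +oo.
Proof.
move=> yu y3; have xc := small_gap_cvg0 yu; split=> //.
have y3p : \forall n \near \oo, 0 < y n / u n ^+ 3.
  near=> n; have y0 : 0 < y n by near: n; exact: near_div_u_gt0.
  have u0 : 0 < u n by near: n; exact: near_u_gt0.
  by rewrite divr_gt0// exprn_gt0.
have e8 : (0 : R) < 8 by [].
have h := seqlimDy (seqlimMy e8 (seqlim_invy y3p y3) (scaled_gap_factor_cvg xc))
  (seqlimN (dHC_pow_eps_cvg0 t 4)).
apply/cvgryPge => A; near=> n.
have h1 : A ^+ 2 <= (dl n ^+ 2 * x n) ^+ 2.
  have -> : (dl n ^+ 2 * x n) ^+ 2 =
    (y n / u n ^+ 3)^-1 * (dl n ^+ 6 / u n ^+ 3 * (1 + th * x n)) - dl n ^+ 4 * E n.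
    by near: n; exact: sqr_scaled_gap.
  by near: n; exact: cvgry_ge h _.
have xn : 0 < x n by near: n.
have dx : 0 <= dl n ^+ 2 * x n by rewrite mulr_ge0 ?sqr_ge0// ltW.
have [A0|A0] := leP A 0; first exact: le_trans A0 dx.
by rewrite -(@ler_pXn2r _ 2)// nnegrE ltW.
Unshelve. all: by end_near. Qed.

(** The other gap is eps / x with eps = d^2 / n, and d^4 eps tends to 0. *)
Lemma other_gap_cvg0 (z : nat -> R) : (\forall n \near \oo, z n * x n = E n) ->
  (exists2 c : R, 0 < c & \forall n \near \oo, c <= dl n ^+ 2 * x n) ->
  z @ \oo --> (0 : R) /\ (fun n => dl n ^+ 2 * z n) @ \oo --> (0 : R).
Proof.
move=> zx [c c0 cx].
have dz : (fun n => dl n ^+ 2 * z n) @ \oo --> (0 : R).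
  apply: (@seqlim_squeeze0 _ _ (fun n => c^-1 * (dl n ^+ 4 * E n))); last first.
    apply: (seqlim_eq (seqlimM (seqlim_cst c^-1) (dHC_pow_eps_cvg0 t 4))); last exact: mulr0.
    exact: nearW.
  near=> n.
  have xn : 0 < x n by near: n.
  have d1 : 1 <= dl n by near: n; exact: near_dHC_ge.
  have zxn : z n * x n = E n by near: n.
  have cxn : c <= dl n ^+ 2 * x n by near: n.
  have e0 : 0 <= E n by rewrite divr_ge0 ?sqr_ge0.
  have z0 : 0 <= z n by rewrite -(pmulr_lge0 _ xn) zxn.
  rewrite mulr_ge0 ?sqr_ge0//= [leRHS]mulrC ler_pdivlMr//.
  rewrite -zxn [leRHS](_ : _ = dl n ^+ 2 * z n * (dl n ^+ 2 * x n)); last by ring.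
  by rewrite ler_wpM2l// mulr_ge0 ?sqr_ge0.
split=> //; apply: (seqlim_squeeze0 _ dz); near=> n.
have xn : 0 < x n by near: n.
have d1 : 1 <= dl n by near: n; exact: near_dHC_ge.
have zxn : z n * x n = E n by near: n.
have e0 : 0 <= E n by rewrite divr_ge0 ?sqr_ge0.
have z0 : 0 <= z n by rewrite -(pmulr_lge0 _ xn) zxn.
by rewrite z0 ler_peMl// exprn_ege1.
Unshelve. all: by end_near. Qed.

End small_gaps.

(** * Gaps in each class *)

Section class_gaps.
Context {R : realType}.
Variables (t : R) (i : nat -> nat).
Hypothesis hi : \forall n \near \oo, (0 < i n <= n)%N.
Local Notation u := (@u R).
Local Notation dl := (@dHC R t).
Local Notation E n := (dl n ^+ 2 / n%:R).
Local Notation a := (low_seq t i).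
Local Notation b := (high_seq t i).

Lemma near_low_gt0 : \forall n \near \oo, 0 < a n.
Proof. by apply: filterS (near_gap_eqs t hi) => n [[]]. Qed.

Lemma near_high_gt0 : \forall n \near \oo, 0 < b n.
Proof. by apply: filterS (near_gap_eqs t hi) => n [[]]. Qed.

Lemma near_low_eq : \forall n \near \oo,
  (i n)%:R * (a n ^+ 2 + E n) = dl n ^+ 2 * (1 + 1 * a n).
Proof. by apply: filterS (near_gap_eqs t hi) => n [_ _ _ + _]; rewrite mul1r. Qed.

Lemma near_high_eq : \forall n \near \oo,
  corank i n * (b n ^+ 2 + E n) = dl n ^+ 2 * (1 + -1 * b n).
Proof. by apply: filterS (near_gap_eqs t hi) => n [_ _ _ _]; rewrite mulN1r. Qed.

Lemma near_low_high : \forall n \near \oo, b n * a n = E n.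
Proof. by apply: filterS (near_gap_eqs t hi) => n [_ + _ _ _]; rewrite mulrC. Qed.

Lemma near_high_low : \forall n \near \oo, a n * b n = E n.
Proof. by apply: filterS (near_gap_eqs t hi) => n [_ + _ _ _]. Qed.

Lemma classA_gaps c : 0 <= c -> classA c i ->
  exists r, [/\ 0 <= r, r ^+ 2 + r = c / 2, (fun n => (a n)^-1) @ \oo --> r &
    b @ \oo --> (0 : R)].
Proof.
move=> c0 ic; have [r [r0 rE ar]] := inv_low_gap_cvg t hi c0 ic.
exists r; split=> //.
apply: (seqlim_eq (seqlimM (eps_cvg0 t) ar)); last exact: mul0r.
near=> n; have a0 : 0 < a n by near: n; exact: near_low_gt0.
have -> : E n = b n * a n by apply/esym; near: n; exact: near_low_high.
by rewrite mulfK// gt_eqF.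
Unshelve. all: by end_near. Qed.

Lemma classAbar_gaps c : 0 <= c -> classAbar c i ->
  exists q, [/\ 0 < q, q <= 1, c / 2 * q ^+ 2 + q = 1, b @ \oo --> q &
    a @ \oo --> (0 : R)].
Proof.
move=> c0 ic; have [q [q0 q1 qE bq]] := high_gap_cvg t hi c0 ic.
exists q; split=> //; have qN : q != 0 by rewrite gt_eqF.
apply: (seqlim_eq (seqlimM (eps_cvg0 t) (seqlimV bq qN))); last exact: mul0r.
near=> n; have b0 : 0 < b n by near: n; exact: near_high_gt0.
have -> : E n = a n * b n by apply/esym; near: n; exact: near_high_low.
by rewrite mulfK// gt_eqF.
Unshelve. all: by end_near. Qed.

Let norm1 : `|1 : R| <= 1. Proof. by rewrite normr1. Qed.
Let normN1 : `|-1 : R| <= 1. Proof. by rewrite normrN1. Qed.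

Lemma classB_gaps c : 0 < c -> classB c i ->
  [/\ a @ \oo --> (0 : R), b @ \oo --> (0 : R),
   (fun n => dl n ^+ 2 * a n) @ \oo --> Num.sqrt (8 / c) &
   (fun n => dl n ^+ 2 * b n) @ \oo --> (0 : R)].
Proof.
move=> c0 ic; have [ac dac] := scaled_gap_cvg norm1 near_low_gt0 near_low_eq c0 ic.
have s0 : 0 < Num.sqrt (8 / c) by rewrite sqrtr_gt0 divr_gt0.
have H : exists2 c' : R, 0 < c' & \forall n \near \oo, c' <= dl n ^+ 2 * a n.
  exists (Num.sqrt (8 / c) / 2); first by rewrite divr_gt0.
  by apply: (cvgr_ge _ dac); rewrite ltr_pdivrMr// ltr_pMr// ltr1n.
by have [bc dbc] := other_gap_cvg0 near_low_gt0 near_low_high H.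
Qed.

Lemma classB0_gaps : @classB0 R i ->
  [/\ a @ \oo --> (0 : R), b @ \oo --> (0 : R),
   (fun n => dl n ^+ 2 * a n) @ \oo --> +oo &
   (fun n => dl n ^+ 2 * b n) @ \oo --> (0 : R)].
Proof.
move=> [iu i3]; have [ac dac] := scaled_gap_cvgy norm1 near_low_gt0 near_low_eq iu i3.
have H : exists2 c' : R, 0 < c' & \forall n \near \oo, c' <= dl n ^+ 2 * a n.
  by exists 1 => //; exact: cvgry_ge dac 1.
by have [bc dbc] := other_gap_cvg0 near_low_gt0 near_low_high H.
Qed.

Lemma classBbar_gaps c : 0 < c -> classBbar c i ->
  [/\ a @ \oo --> (0 : R), b @ \oo --> (0 : R),
   (fun n => dl n ^+ 2 * b n) @ \oo --> Num.sqrt (8 / c) &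
   (fun n => dl n ^+ 2 * a n) @ \oo --> (0 : R)].
Proof.
move=> c0 ic; have [bc dbc] := scaled_gap_cvg normN1 near_high_gt0 near_high_eq c0 ic.
have s0 : 0 < Num.sqrt (8 / c) by rewrite sqrtr_gt0 divr_gt0.
have H : exists2 c' : R, 0 < c' & \forall n \near \oo, c' <= dl n ^+ 2 * b n.
  exists (Num.sqrt (8 / c) / 2); first by rewrite divr_gt0.
  by apply: (cvgr_ge _ dbc); rewrite ltr_pdivrMr// ltr_pMr// ltr1n.
by have [ac dac] := other_gap_cvg0 near_high_gt0 near_high_low H.
Qed.

Lemma classBbar0_gaps : @classBbar0 R i ->
  [/\ a @ \oo --> (0 : R), b @ \oo --> (0 : R),
   (fun n => dl n ^+ 2 * b n) @ \oo --> +oo &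
   (fun n => dl n ^+ 2 * a n) @ \oo --> (0 : R)].
Proof.
move=> [iu i3]; have [bc dbc] := scaled_gap_cvgy normN1 near_high_gt0 near_high_eq iu i3.
have H : exists2 c' : R, 0 < c' & \forall n \near \oo, c' <= dl n ^+ 2 * b n.
  by exists 1 => //; exact: cvgry_ge dbc 1.
by have [ac dac] := other_gap_cvg0 near_high_gt0 near_high_low H.
Qed.

(** The product of the two gap equations, i (n - i) / n = d^2 (1 + a) (1 - b) / (a + b)^2,
    bounds both gaps at once, wherever i lies between the two ends. *)
Lemma classC_gaps : @classC R i ->
  [/\ a @ \oo --> (0 : R), b @ \oo --> (0 : R),
   (fun n => dl n ^+ 2 * a n) @ \oo --> (0 : R) &
   (fun n => dl n ^+ 2 * b n) @ \oo --> (0 : R)].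
Proof.
move=> ic; pose v n : R := (i n)%:R * (1 - (i n)%:R / n%:R) / u n ^+ 3.
have v0 : \forall n \near \oo, 0 < v n by exact: cvgry_gt ic 0.
have wc : (fun n => 3 * (dl n ^+ 6 / u n ^+ 3 * (v n)^-1)) @ \oo --> (0 : R).
  apply: (seqlim_eq (seqlimM (seqlim_cst (3 : R)) (seqlimM (dHC6_div_cvg t) (seqlim_inv0 v0 ic)))).
    exact: nearW.
  by rewrite !mulr0.
have sum2 : (fun n => (dl n ^+ 2 * (a n + b n)) ^+ 2) @ \oo --> (0 : R).
  apply: (seqlim_squeeze0 _ wc); near=> n; rewrite sqr_ge0/=.
  have vn : 0 < v n by near: n.
  have u0 : 0 < u n by near: n; exact: near_u_gt0.
  have d1 : 1 <= dl n by near: n; exact: near_dHC_ge.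
  have [|[a0 b0 b1] ab e0 iE jE] := near (near_gap_eqs t hi) n; first by [].
  have n0 : 0 < n%:R :> R.
    by rewrite ltr0n; near: n; exact: nbhs_infty_gt.
  have ab0 : 0 < a n + b n by rewrite addr_gt0.
  have d20 : 0 < dl n ^+ 2 by rewrite exprn_gt0//; lra.
  have iE' : (i n)%:R * (a n * (a n + b n)) = dl n ^+ 2 * (1 + a n).
    by rewrite -iE -ab; ring.
  have jE' : corank i n * (b n * (a n + b n)) = dl n ^+ 2 * (1 - b n).
    by rewrite -jE -ab; ring.
  have wE : v n * u n ^+ 3 * (a n + b n) ^+ 2 = dl n ^+ 2 * ((1 + a n) * (1 - b n)).
    have -> : v n * u n ^+ 3 = (i n)%:R * corank i n / n%:R.
      by rewrite /v /corank; field; rewrite !gt_eqF.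
    apply: (mulIf (lt0r_neq0 e0)); rewrite -{1}ab.
    transitivity ((i n)%:R * (a n * (a n + b n)) * (corank i n * (b n * (a n + b n))) / n%:R).
      by ring.
    by rewrite iE' jE'; ring.
  have w3 : 0 < v n * u n ^+ 3 by rewrite mulr_gt0// exprn_gt0.
  have wle : (a n + b n) ^+ 2 <= dl n ^+ 2 / (v n * u n ^+ 3) * (1 + a n).
    rewrite mulrAC ler_pdivlMr// mulrC wE ler_wpM2l ?(ltW d20)//.
    by rewrite ler_piMr ?addr_ge0 ?(ltW a0)//; lra.
  have q1 : dl n ^+ 6 / u n ^+ 3 * (v n)^-1 < 3^-1.
    suff : 3 * (dl n ^+ 6 / u n ^+ 3 * (v n)^-1) < 1 by lra.
    by near: n; exact: (cvgr_lt _ wc).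
  set q := dl n ^+ 6 / u n ^+ 3 * (v n)^-1 in q1 *.
  have qE : q = dl n ^+ 4 * (dl n ^+ 2 / (v n * u n ^+ 3)).
    by rewrite /q; field; rewrite !gt_eqF.
  have q0 : 0 <= dl n ^+ 2 / (v n * u n ^+ 3) by rewrite divr_ge0 ?ltW.
  have q2 : dl n ^+ 2 / (v n * u n ^+ 3) <= 3^-1.
    apply: le_trans (ltW q1); rewrite qE ler_peMl// exprn_ege1//.
  set q' := dl n ^+ 2 / (v n * u n ^+ 3) in qE q0 q2 wle.
  have a2 : a n <= 2.
    rewrite leNgt; apply/negP => a2.
    have : q' * (1 + a n) <= 3^-1 * (1 + a n) by rewrite ler_wpM2r// addr_ge0// ltW.
    have : a n * 2 < a n * a n by rewrite ltr_pM2l.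
    have : 0 < a n * b n by rewrite mulr_gt0.
    have : 0 < b n * b n by rewrite mulr_gt0.
    move: wle; rewrite expr2; lra.
  rewrite qE exprMn (_ : (dl n ^+ 2) ^+ 2 = dl n ^+ 4); last by rewrite -exprM.
  rewrite [leRHS]mulrCA ler_pM2l ?exprn_gt0//; last by lra.
  apply: (le_trans wle); rewrite mulrC ler_wpM2r//; lra.
have ds := seqlim_sqr0 sum2.
have da : (fun n => dl n ^+ 2 * a n) @ \oo --> (0 : R).
  apply: (seqlim_squeeze0 _ ds); near=> n.
  have a0 : 0 < a n by near: n; exact: near_low_gt0.
  have b0 : 0 < b n by near: n; exact: near_high_gt0.
  by rewrite mulr_ge0 ?sqr_ge0 ?(ltW a0)//= ler_wpM2l ?sqr_ge0// lerDl ltW.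
have db : (fun n => dl n ^+ 2 * b n) @ \oo --> (0 : R).
  apply: (seqlim_squeeze0 _ ds); near=> n.
  have a0 : 0 < a n by near: n; exact: near_low_gt0.
  have b0 : 0 < b n by near: n; exact: near_high_gt0.
  by rewrite mulr_ge0 ?sqr_ge0 ?(ltW b0)//= ler_wpM2l ?sqr_ge0// lerDr ltW.
split=> //.
  apply: (seqlim_squeeze0 _ da); near=> n.
  have a0 : 0 < a n by near: n; exact: near_low_gt0.
  have d1 : 1 <= dl n by near: n; exact: near_dHC_ge.
  by rewrite (ltW a0)/= ler_peMl ?(ltW a0)// exprn_ege1.
apply: (seqlim_squeeze0 _ db); near=> n.
have b0 : 0 < b n by near: n; exact: near_high_gt0.
have d1 : 1 <= dl n by near: n; exact: near_dHC_ge.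
by rewrite (ltW b0)/= ler_peMl ?(ltW b0)// exprn_ege1.
Unshelve. all: by end_near. Qed.

End class_gaps.

(** * Pairs of ranks near either end *)

Section rank_pair_extreme.
Context {R : realType}.
Variables (n i1 i2 : nat) (d : R).
Hypotheses (d1 : 1 <= d) (i10 : (0 < i1)%N) (i12 : (i1 < i2)%N) (i2n : (i2 <= n)%N).

Let d0 : 0 < d. Proof. exact: lt_le_trans d1. Qed.
Let i1_n : (0 < i1 <= n)%N. Proof. by rewrite i10 ltnW// (leq_trans i12). Qed.
Let i1_ltn : (0 < i1 < n)%N. Proof. by rewrite i10 (leq_trans i12). Qed.
Let i2_n : (0 < i2 <= n)%N. Proof. by rewrite i2n (leq_trans _ i12). Qed.
Local Notation a1 := (low_gap n i1 d).
Local Notation b1 := (high_gap n i1 d).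
Local Notation a2 := (low_gap n i2 d).
Local Notation b2 := (high_gap n i2 d).
Local Notation D := (d ^+ 2 * (rate a2 b2 - rate a1 b1)).
Local Notation shift_gap := (d ^+ 2 * (a1 - b1 - (a2 - b2))).

(** Both quadratics are at most 1 + s1 x, where s1 is the larger shift. *)
Lemma rate_diff_ge_slope : shift_gap * rate_slope (a1 - b1) 1 <= D.
Proof.
have [[a10 b10 b11] ab1 e0 iE1 _] := gap_eqs d0 i1_n.
have [[a20 b20 b21] ab2 _ iE2 _] := gap_eqs d0 i2_n.
have b1' := high_gap_lt1 d0 i1_ltn.
have la := low_gap_decr d1 i10 i12 i2n; have lb := high_gap_incr d1 i10 i12 i2n.
have b1i : 0 < b1 < 1 by rewrite b10.
have b2i : 0 < b2 <= 1 by rewrite b20.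
have abE : a1 * b1 = a2 * b2 by rewrite ab1.
have s21 : a2 - b2 <= a1 - b1 by lra.
have s1 : -1 < a1 - b1 by lra.
rewrite -mulrA ler_wpM2l ?sqr_ge0//.
have := @rate_diff_ge R a1 b1 a2 b2 (a1 - b1) 1 a10 b1i a20 b2i abE s21 s1 ltr01.
rewrite divr1; apply => x x01; have /andP[x0 x1] := x01.
have Q a b : 0 < a -> 0 < b -> a - b <= a1 - b1 -> (1 + a * x) * (1 - b * x) <= 1 + (a1 - b1) * x.
  move=> aa0 bb0 sab.
  have : 0 <= a * b * (x * x) by rewrite !mulr_ge0// ltW.
  have : (a - b) * x <= (a1 - b1) * x by rewrite ler_wpM2r.
  lra.
have Q0 a b : 0 < a -> 0 < b -> b <= 1 -> 0 <= (1 + a * x) * (1 - b * x).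
  move=> aa0 bb0 bb1; rewrite mulr_ge0//; first by rewrite addr_ge0// mulr_ge0// ltW.
  by rewrite subr_ge0 mulr_ile1// ltW.
by rewrite mul1r expr2 ler_pM// ?Q0// ?Q// ltW.
Qed.

Lemma shift_gap_ge_low : d ^+ 2 * (a1 - a2) <= shift_gap.
Proof.
rewrite ler_wpM2l ?sqr_ge0//; have := high_gap_incr d1 i10 i12 i2n; lra.
Qed.

Lemma shift_gap_ge_high : d ^+ 2 * (b2 - b1) <= shift_gap.
Proof.
rewrite ler_wpM2l ?sqr_ge0//; have := low_gap_decr d1 i10 i12 i2n; lra.
Qed.

(** The ranks differ by at least 1, which by gap_eq_sub forces d^2 (a1 - a2) >= a1 a2 / 3. If
    a2 < a1 / 2 this is replaced by a1 - a2 >= a1 / 2 and d^2 >= a1 / 2. *)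
Lemma shift_gap_bottom : 1 <= a2 -> a1 ^+ 2 / 6 <= shift_gap.
Proof.
move=> a21; apply: le_trans shift_gap_ge_low.
have [[a10 b10 b11] ab1 e0 iE1 _] := gap_eqs d0 i1_n.
have [[a20 b20 b21] ab2 _ iE2 _] := gap_eqs d0 i2_n.
have la := low_gap_decr d1 i10 i12 i2n.
set e := d ^+ 2 / n%:R in e0 iE1 iE2.
have iE1' : i1%:R * (a1 ^+ 2 + e) = d ^+ 2 * (1 + 1 * a1) by rewrite mul1r.
have iE2' : i2%:R * (a2 ^+ 2 + e) = d ^+ 2 * (1 + 1 * a2) by rewrite mul1r.
have h := gap_eq_sub iE1' iE2'; rewrite !mul1r in h.
have i12R : 1 <= i2%:R - i1%:R :> R by rewrite lerBrDl natr1 ler_nat.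
have i1R : 1 <= i1%:R :> R by rewrite ler1n.
have da0 : 0 <= d ^+ 2 * (a1 - a2) by rewrite mulr_ge0 ?sqr_ge0 ?subr_ge0 ?ltW.
have s1 : 0 <= a1 ^+ 2 + e by rewrite addr_ge0 ?sqr_ge0 ?ltW.
have s2 : 0 <= a2 ^+ 2 + e by rewrite addr_ge0 ?sqr_ge0 ?ltW.
have h1 : a1 ^+ 2 * a2 ^+ 2 <= d ^+ 2 * (a1 - a2) * (3 * (a1 * a2)).
  apply: (@le_trans _ _ ((a1 ^+ 2 + e) * (a2 ^+ 2 + e))).
    by rewrite ler_pM ?sqr_ge0// lerDl ltW.
  apply: (@le_trans _ _ ((i2%:R - i1%:R) * ((a1 ^+ 2 + e) * (a2 ^+ 2 + e)))).
    by rewrite ler_peMl// mulr_ge0.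
  rewrite h ler_wpM2l//.
  have : a1 * 1 <= a1 * a2 by rewrite ler_wpM2l// ltW.
  have : 1 * a2 <= a1 * a2 by rewrite ler_wpM2r ?(ltW a20)//; lra.
  lra.
have a12 : 0 < a1 * a2 by rewrite mulr_gt0.
have h2 : a1 * a2 <= 3 * (d ^+ 2 * (a1 - a2)).
  rewrite -(ler_pM2r a12) [leLHS](_ : _ = a1 ^+ 2 * a2 ^+ 2); last by ring.
  by apply: (le_trans h1); rewrite le_eqVlt; apply/orP; left; apply/eqP; ring.
have [a2h|a2h] := leP (a1 / 2) a2.
  have : a1 * (a1 / 2) <= a1 * a2 by rewrite ler_wpM2l// ltW.
  rewrite expr2; lra.
have dh : a1 / 2 <= d ^+ 2.
  have : a1 ^+ 2 <= d ^+ 2 * (2 * a1).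
    apply: (@le_trans _ _ (a1 ^+ 2 + e)); first by rewrite lerDl ltW.
    apply: (@le_trans _ _ (i1%:R * (a1 ^+ 2 + e))); first by rewrite ler_peMl.
    by rewrite iE1 ler_wpM2l ?sqr_ge0//; lra.
  rewrite expr2 mulrA ler_pM2r//; lra.
apply: (@le_trans _ _ (a1 / 2 * (a1 / 2))).
  by have := sqr_ge0 a1; rewrite expr2; lra.
have p0 : 0 <= a1 / 2 by lra.
by apply: (ler_pM p0 p0 dh); lra.
Qed.

(** For b1 >= 1/2 the denominators in gap_eq_sub are bounded below, and the gap difference is at
    least proportional to the rank difference. *)
Lemma shift_gap_top : 2^-1 <= b1 -> d ^+ 2 / n%:R <= 1 ->
  (i2%:R - i1%:R) / 48 <= shift_gap.
Proof.
move=> b1h e1; apply: le_trans shift_gap_ge_high.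
have [[a10 b10 b11] ab1 e0 _ jE1] := gap_eqs d0 i1_n.
have [[a20 b20 b21] ab2 _ _ jE2] := gap_eqs d0 i2_n.
have lb := high_gap_incr d1 i10 i12 i2n.
set e := d ^+ 2 / n%:R in e0 e1 jE1 jE2.
have jE1' : (n%:R - i1%:R) * (b1 ^+ 2 + e) = d ^+ 2 * (1 + -1 * b1) by rewrite mulN1r.
have jE2' : (n%:R - i2%:R) * (b2 ^+ 2 + e) = d ^+ 2 * (1 + -1 * b2) by rewrite mulN1r.
have h := gap_eq_sub jE2' jE1'.
have i12R : 0 <= i2%:R - i1%:R :> R by rewrite subr_ge0 ler_nat ltnW.
have mE : n%:R - i1%:R - (n%:R - i2%:R) = i2%:R - i1%:R :> R by ring.
rewrite mE in h.
have sq b : 2^-1 <= b -> 4^-1 <= b ^+ 2 + e.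
  move=> bh; have : 2^-1 * 2^-1 <= b * b by rewrite ler_pM// ?invr_ge0.
  by rewrite expr2; lra.
have db0 : 0 <= d ^+ 2 * (b2 - b1) by rewrite mulr_ge0 ?sqr_ge0 ?subr_ge0 ?ltW.
have h1 : (i2%:R - i1%:R) * (4^-1 * 4^-1) <= d ^+ 2 * (b2 - b1) * 3.
  apply: (@le_trans _ _ ((i2%:R - i1%:R) * ((b2 ^+ 2 + e) * (b1 ^+ 2 + e)))).
    by rewrite ler_wpM2l// ler_pM// ?sq//; lra.
  rewrite h ler_wpM2l//.
  have := mulr_ge0 (ltW b10) (ltW b20); lra.
lra.
Qed.

End rank_pair_extreme.

(** * Limits of the ratio of two levels *)

Section pair_limits.
Context {R : realType}.
Variables (t : R) (i1 i2 : nat -> nat).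
Hypothesis h12 : \forall n \near \oo, [/\ (0 < i1 n)%N, (i1 n < i2 n)%N & (i2 n <= n)%N].
Local Notation u := (@u R).
Local Notation dl := (@dHC R t).
Local Notation E n := (dl n ^+ 2 / n%:R).
Local Notation a1 := (low_seq t i1).
Local Notation b1 := (high_seq t i1).
Local Notation a2 := (low_seq t i2).
Local Notation b2 := (high_seq t i2).

Definition level_ratio n : R := rank_level n (i2 n) (dl n) / rank_level n (i1 n) (dl n).
Definition rate_gap n : R := dl n ^+ 2 * (rate (a2 n) (b2 n) - rate (a1 n) (b1 n)).
Definition shift_gap n : R := dl n ^+ 2 * (a1 n - b1 n - (a2 n - b2 n)).

Lemma near_rank1 : \forall n \near \oo, (0 < i1 n <= n)%N.
Proof.
apply: filterS h12 => n [h1 h2 h3].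
by rewrite h1 ltnW// (leq_trans h2).
Qed.

Lemma near_rank2 : \forall n \near \oo, (0 < i2 n <= n)%N.
Proof.
apply: filterS h12 => n [h1 h2 h3].
by rewrite h3 (leq_trans _ h2).
Qed.

Lemma near_level_ratio_gt0 : \forall n \near \oo, 0 < level_ratio n.
Proof.
near=> n; have d0 : 0 < dl n by apply: (@lt_le_trans _ _ 1) => //; near: n; exact: near_dHC_ge.
by rewrite divr_gt0// rank_level_gt0//; near: n; [exact: near_rank2|exact: near_rank1].
Unshelve. all: by end_near. Qed.

Lemma near_shift_gap_gt0 : \forall n \near \oo, 0 < shift_gap n.
Proof.
near=> n; have d1 : 1 <= dl n by near: n; exact: near_dHC_ge.
have [h1 h2 h3] : [/\ (0 < i1 n)%N, (i1 n < i2 n)%N & (i2 n <= n)%N] by near: n.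
have la := low_gap_decr d1 h1 h2 h3; have lb := high_gap_incr d1 h1 h2 h3.
rewrite mulr_gt0 ?exprn_gt0//; first by lra.
rewrite /low_seq /high_seq; lra.
Unshelve. all: by end_near. Qed.

(** The rates differ by a multiple of d^2, which beats the prefactor d (1 + a2): as p2 > 0, the
    gap a2 is bounded. *)
Lemma level_ratio_separated (p1 p2 : R) : p1 < p2 ->
  (fun n => (2 + (a1 n - b1 n))^-1) @ \oo --> p1 ->
  (fun n => (2 + (a2 n - b2 n))^-1) @ \oo --> p2 ->
  level_ratio @ \oo --> (0 : R).
Proof.
move=> p12 l1 l2; pose q := (p2 - p1) / 2.
have q0 : 0 < q by rewrite divr_gt0// subr_gt0.
have dgap : \forall n \near \oo, q < (2 + (a2 n - b2 n))^-1 - (2 + (a1 n - b1 n))^-1.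
  by apply: (cvgr_gt _ (seqlimB l2 l1)); rewrite /q; lra.
pose k : R := q / 6; have k0 : 0 < k by rewrite divr_gt0.
pose c : R := 4 * expR 2 * q^-1 / k.
apply: (@seqlim_squeeze0 _ _ (fun n => c * (dl n)^-1)); last first.
  have dp : \forall n \near \oo, 0 < dl n by exact: cvgry_gt (dHC_cvgy t) 0.
  apply: (seqlim_eq (seqlimM (seqlim_cst c) (seqlim_inv0 dp (dHC_cvgy t)))); last exact: mulr0.
  exact: nearW.
near=> n.
have d1 : 1 <= dl n by near: n; exact: near_dHC_ge.
have d0 : 0 < dl n by lra.
have [h1 h2 h3] : [/\ (0 < i1 n)%N, (i1 n < i2 n)%N & (i2 n <= n)%N] by near: n.
have -> : 0 <= level_ratio n by apply: ltW; near: n; exact: near_level_ratio_gt0.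
have dg : q < (2 + (a2 n - b2 n))^-1 - (2 + (a1 n - b1 n))^-1 by near: n.
have [|[a10 b10 b11] _ _ _ _] := near (near_gap_eqs t near_rank1) n; first by [].
have [|[a20 b20 b21] _ _ _ _] := near (near_gap_eqs t near_rank2) n; first by [].
have s1 : 0 < 2 + (a1 n - b1 n) by lra.
have s2 : 0 < 2 + (a2 n - b2 n) by lra.
have Dk : k * dl n ^+ 2 <= rate_gap n.
  apply: le_trans (rate_diff_ge_inv d1 h1 h2 h3).
  rewrite (_ : k * _ = dl n ^+ 2 * q / 6); last by rewrite /k; ring.
  by rewrite ler_wpM2r// ler_wpM2l ?sqr_ge0// ltW.
have a2q : 1 + a2 n <= q^-1.
  apply: (@le_trans _ _ (2 + (a2 n - b2 n))); first by lra.
  rewrite -[leLHS]invrK lef_pV2 ?posrE ?invr_gt0// ltW// (lt_trans dg)//.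
  by rewrite gtrBl invr_gt0.
rewrite /=; apply: (le_trans (rank_ratio_crude d1 h1 h2 h3)).
rewrite -/(low_seq t i2 n) -/(high_seq t i2 n) -/(low_seq t i1 n) -/(high_seq t i1 n) -/(rate_gap n).
have kd : 0 < k * dl n ^+ 2 := mulr_gt0 k0 (exprn_gt0 2 d0).
have ex : expR (- rate_gap n) <= (k * dl n ^+ 2)^-1.
  rewrite expRN lef_pV2 ?posrE ?expR_gt0 ?kd//.
  by apply: (le_trans Dk); apply: le_trans (expR_ge1Dx _); rewrite lerDr.
have e0 : 0 <= 4 * expR 2 :> R by rewrite mulr_ge0 ?expR_ge0.
have cE : c * (dl n)^-1 = 4 * expR 2 * (k * dl n ^+ 2)^-1 * dl n * q^-1.
  have gen (e k' q' d' : R) : 0 < k' -> 0 < q' -> 0 < d' ->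
      e * q'^-1 / k' * d'^-1 = e * (k' * d' ^+ 2)^-1 * d' * q'^-1.
    by move=> ? ? ?; field; rewrite !gt_eqF.
  exact: gen.
rewrite cE; have l3 : 4 * expR 2 * expR (- rate_gap n) * dl n <= 4 * expR 2 * (k * dl n ^+ 2)^-1 * dl n.
  by apply: ler_wpM2r; [exact: ltW|exact: ler_wpM2l].
have l0 : 0 <= 4 * expR 2 * expR (- rate_gap n) * dl n.
  by apply: mulr_ge0; [apply: mulr_ge0 => //; exact: expR_ge0|exact: ltW].
by apply: (ler_pM l0 _ l3 a2q); lra.
Unshelve. all: by end_near. Qed.

Section common_limit.
Variables (al be : R).
Hypotheses (al0 : 0 <= al) (be1 : be < 1).
Hypotheses (a1c : a1 @ \oo --> al) (a2c : a2 @ \oo --> al).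
Hypotheses (b1c : b1 @ \oo --> be) (b2c : b2 @ \oo --> be).

Let s1 : -1 < al - be. Proof. by have := al0; have := be1; lra. Qed.

Lemma near_i2_lt_n : \forall n \near \oo, (i2 n < n)%N.
Proof.
near=> n; have i_n : (0 < i2 n <= n)%N by near: n; exact: near_rank2.
have d1 : 1 <= dl n by near: n; exact: near_dHC_ge.
have b21 : b2 n < 1 by near: n; exact: (cvgr_lt _ b2c).
have [|[a20 b20 _] _ e0 _ jE] := near (near_gap_eqs t near_rank2) n; first by [].
rewrite ltn_neqAle; have /andP[_ ->] := i_n; rewrite andbT; apply/eqP => iE.
have : 0 < dl n ^+ 2 * (1 - b2 n) by rewrite mulr_gt0 ?exprn_gt0 ?subr_gt0//; lra.
by rewrite -jE /corank iE subrr mul0r ltxx.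
Unshelve. all: by end_near. Qed.

(** Gaps that converge, with the high ones away from 1, force i and n - i to infinity at least
    like d^2. *)
Lemma stirling_gap_cvg0 : (fun n => stirling_log (i1 n) - stirling_log (i2 n)
    + (stirling_log (n - i1 n) - stirling_log (n - i2 n))) @ \oo --> (0 : R).
Proof.
have bd (x : nat -> R) (l : R) : x @ \oo --> l ->
    (fun n => (x n ^+ 2 + E n) * (dl n ^+ 2)^-1) @ \oo --> (0 : R).
  move=> xl; have dp : \forall n \near \oo, 0 < dl n ^+ 2.
    by apply: filterS (cvgry_gt (dHC_cvgy t) 0) => n dn; rewrite exprn_gt0.
  have d2y : (fun n => dl n ^+ 2) @ \oo --> +oo.
    apply: (ger_cvgy _ (dHC_cvgy t)); near=> n.
    have d1 : 1 <= dl n by near: n; exact: near_dHC_ge.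
    by rewrite expr2 ler_peMl//; lra.
  apply: (seqlim_eq (seqlimM (seqlimD (seqlimX 2 xl) (eps_cvg0 t)) (seqlim_inv0 dp d2y))).
    exact: nearW.
  exact: mulr0.
have ib : (fun n => (i1 n)%:R^-1) @ \oo --> (0 : R).
  apply: (seqlim_squeeze0 _ (bd _ _ a1c)); near=> n.
  have i_n : (0 < i1 n <= n)%N by near: n; exact: near_rank1.
  have i0 : 0 < (i1 n)%:R :> R by rewrite ltr0n; case/andP: i_n.
  have d1 : 1 <= dl n by near: n; exact: near_dHC_ge.
  have [|[a0 b0 _] _ e0 iE _] := near (near_gap_eqs t near_rank1) n; first by [].
  rewrite invr_ge0 ltW//= ler_pdivlMr ?exprn_gt0//; last by lra.
  rewrite mulrC ler_pdivrMr// mulrC iE ler_peMr ?sqr_ge0//; lra.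
have jb : (fun n => (n - i2 n)%:R^-1) @ \oo --> (0 : R).
  have be0 : 1 - be != 0 by rewrite gt_eqF// subr_gt0 be1.
  have bd2 := seqlimM (bd _ _ b2c) (seqlimV (seqlimB (seqlim_cst (1 : R)) b2c) be0).
  rewrite mul0r in bd2.
  apply: (seqlim_squeeze0 _ bd2); near=> n.
  have i_n : (i2 n < n)%N by near: n; exact: near_i2_lt_n.
  have b21 : b2 n < 1 by near: n; exact: (cvgr_lt _ b2c).
  have j0 : 0 < (n - i2 n)%:R :> R by rewrite ltr0n subn_gt0.
  have d1 : 1 <= dl n by near: n; exact: near_dHC_ge.
  have [|[a0 b0 _] _ e0 _ jE] := near (near_gap_eqs t near_rank2) n; first by [].
  rewrite invr_ge0 ltW//= -mulrA -invfM ler_pdivlMr; last first.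
    by rewrite mulr_gt0 ?exprn_gt0 ?subr_gt0//; lra.
  by rewrite mulrC ler_pdivrMr// [leRHS]mulrC natrB ?(ltnW i_n)// -/(corank i2 n) jE.
apply/norm_cvg0P.
have bnd := seqlimD (seqlimM (seqlim_cst (4^-1 : R)) ib) (seqlimM (seqlim_cst (4^-1 : R)) jb).
rewrite !mulr0 addr0 in bnd.
apply: (seqlim_squeeze0 _ bnd); near=> n.
have [h1 h2 h3] : [/\ (0 < i1 n)%N, (i1 n < i2 n)%N & (i2 n <= n)%N] by near: n.
have i_n : (i2 n < n)%N by near: n; exact: near_i2_lt_n.
have j0 : (0 < n - i2 n)%N by rewrite subn_gt0.
have /andP[l1 l2] := @stirling_log_le R _ _ h1 (ltnW h2).
have /andP[l3 l4] := @stirling_log_le R _ _ j0 (leq_sub2l n (ltnW h2)).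
rewrite invfM in l2; rewrite invfM in l4.
rewrite normr_ge0/= ler_norml; apply/andP; split.
  apply: (@le_trans _ _ (- (4^-1 * (n - i2 n)%:R^-1))).
    by rewrite lerN2 lerDr mulr_ge0// invr_ge0.
  lra.
apply: (@le_trans _ _ (4^-1 * (i1 n)%:R^-1)).
  lra.
by rewrite lerDl mulr_ge0// invr_ge0.
Unshelve. all: by end_near. Qed.

(** The prefactors of the two levels have the same limit, which leaves the exponentials of the
    rates. *)
Lemma level_ratio_exp_cvg : (fun n => level_ratio n * expR (rate_gap n)) @ \oo --> (1 : R).
Proof.
pose g n : R := expR (stirling_log (i1 n) - stirling_log (i2 n)
    + (stirling_log (n - i1 n) - stirling_log (n - i2 n)))
  * Num.sqrt ((1 + a2 n) / (1 - b2 n) / ((1 + a1 n) / (1 - b1 n))).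
have al1 : 1 + al != 0 by rewrite gt_eqF// ltr_pwDl// al0.
have be0 : 1 - be != 0 by rewrite gt_eqF// subr_gt0 be1.
have Xc x y : x @ \oo --> al -> y @ \oo --> be ->
    (fun n => (1 + x n) / (1 - y n)) @ \oo --> (1 + al) / (1 - be).
  move=> xc yc; apply: seqlimM.
    by apply: seqlimD => //; exact: seqlim_cst.
  by apply: seqlimV => //; apply: seqlimB => //; exact: seqlim_cst.
have X0 : (1 + al) / (1 - be) != 0 by rewrite mulf_neq0 ?invr_eq0.
have gc : g @ \oo --> (1 : R).
  apply: (seqlim_eq (seqlimM (seqlim_expR stirling_gap_cvg0)
    (seqlim_sqrt (seqlimM (Xc _ _ a2c b2c) (seqlimV (Xc _ _ a1c b1c) X0))))).
    exact: nearW.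
  by rewrite expR0 mul1r divff// sqrtr1.
have kc : (fun n => 1 + dl n ^- 2) @ \oo --> (1 : R).
  have dp : \forall n \near \oo, 0 < dl n by exact: cvgry_gt (dHC_cvgy t) 0.
  apply: (seqlim_eq (seqlimD (seqlim_cst (1 : R)) (seqlimX 2 (seqlim_inv0 dp (dHC_cvgy t))))).
    by apply: nearW => n; rewrite exprVn.
  by rewrite expr0n addr0.
have lo := seqlimM gc (seqlimV kc (oner_neq0 R)); rewrite invr1 mulr1 in lo.
have hi := seqlimM kc gc; rewrite mulr1 in hi.
apply: (squeeze_cvgr _ lo hi); near=> n.
have d1 : 1 <= dl n by near: n; exact: near_dHC_ge.
have d0 : 0 < dl n by exact: lt_le_trans d1.
have [h1 h2 h3] : [/\ (0 < i1 n)%N, (i1 n < i2 n)%N & (i2 n <= n)%N] by near: n.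
have i_n : (i2 n < n)%N by near: n; exact: near_i2_lt_n.
have [l1 l2] := rank_ratio_approx d1 h1 h2 h3 i_n.
have k0 : 0 < 1 + dl n ^- 2 by apply: ltr_pwDl => //; rewrite invr_ge0 sqr_ge0.
have gE : g n = (expR (stirling_log (i1 n) - stirling_log (i2 n)
    + (stirling_log (n - i1 n) - stirling_log (n - i2 n)) - rate_gap n)
  * Num.sqrt ((1 + a2 n) / (1 - b2 n) / ((1 + a1 n) / (1 - b1 n)))) * expR (rate_gap n).
  by rewrite /g [RHS]mulrAC -expRD subrK.
rewrite ler_pdivrMr// gE; apply/andP; split.
  rewrite [leRHS]mulrC mulrA ler_wpM2r ?expR_ge0//.
by rewrite mulrA ler_wpM2r ?expR_ge0.
Unshelve. all: by end_near. Qed.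

Definition slope_ratio n : R := rate_gap n / shift_gap n.

Lemma rate_gapE : \forall n \near \oo, rate_gap n = slope_ratio n * shift_gap n.
Proof.
near=> n; have s0 : 0 < shift_gap n by near: n; exact: near_shift_gap_gt0.
by rewrite /slope_ratio divfK// gt_eqF.
Unshelve. all: by end_near. Qed.

(** With s = al - be, both quadratics tend to 1 + s x uniformly on [0, 1], so the comparisons of
    rates hold with constants C tending to 1. *)
Lemma slope_ratio_cvg : slope_ratio @ \oo --> rate_slope (al - be) 1.
Proof.
set s := al - be; set K := rate_slope s 1.
have s1' : -1 < s by exact: s1.
have K0 : 0 < K by exact: rate_slope1_gt0.
pose mu : R := Num.min 1 (1 + s).
have mu0 : 0 < mu by rewrite lt_min ltr01/=; lra.
pose rho n : R := (`|a1 n - b1 n - s| + `|a2 n - b2 n - s| + E n) / mu.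
have sc x y : x @ \oo --> al -> y @ \oo --> be ->
    (fun n => `|x n - y n - s|) @ \oo --> (0 : R).
  move=> xc yc; apply/norm_cvg0P.
  apply: (seqlim_eq (seqlimB (seqlimB xc yc) (seqlim_cst s))); last exact: subrr.
  exact: nearW.
have rc : rho @ \oo --> (0 : R).
  apply: (seqlim_eq (seqlimM (seqlimD (seqlimD (sc _ _ a1c b1c) (sc _ _ a2c b2c))
    (eps_cvg0 t)) (seqlim_cst mu^-1))); first exact: nearW.
  by rewrite !addr0 mul0r.
have lim1 (e : R) : (fun n => K / (1 + e * rho n) ^+ 2) @ \oo --> K.
  have h := seqlimD (seqlim_cst (1 : R)) (seqlimM (seqlim_cst e) rc).
  rewrite mulr0 addr0 in h.
  have h2 := seqlimX 2 h; rewrite expr1n in h2.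
  apply: (seqlim_eq (seqlimM (seqlim_cst K) (seqlimV h2 (oner_neq0 R)))); first exact: nearW.
  by rewrite invr1 mulr1.
apply: (squeeze_cvgr _ (lim1 1) (lim1 (-1))); near=> n.
have d1 : 1 <= dl n by near: n; exact: near_dHC_ge.
have d0 : 0 < dl n by exact: lt_le_trans d1.
have [h1 h2 h3] : [/\ (0 < i1 n)%N, (i1 n < i2 n)%N & (i2 n <= n)%N] by near: n.
have i_n : (i2 n < n)%N by near: n; exact: near_i2_lt_n.
have i1_ltn : (0 < i1 n < n)%N by rewrite h1 (ltn_trans h2).
have i2_ltn : (0 < i2 n < n)%N by rewrite i_n (ltn_trans h1).
have [|[a10 b10 b11] ab1 e0 iE jE] := near (near_gap_eqs t near_rank1) n; first by [].
have [|[a20 b20 b21] ab2 _ iE2 jE2] := near (near_gap_eqs t near_rank2) n; first by [].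
have b1i : 0 < b1 n < 1 by rewrite b10 high_gap_lt1.
have b2i : 0 < b2 n < 1 by rewrite b20 high_gap_lt1.
have la : a2 n < a1 n by exact: low_gap_decr d1 h1 h2 h3.
have lb : b1 n < b2 n by exact: high_gap_incr d1 h1 h2 h3.
have abE : a1 n * b1 n = a2 n * b2 n by rewrite ab1 ab2.
have s21 : a2 n - b2 n <= a1 n - b1 n by lra.
have G0 : 0 < shift_gap n by near: n; exact: near_shift_gap_gt0.
have r1 : rho n < 1 by near: n; exact: (cvgr_lt _ rc).
have r0 : 0 <= rho n.
  by rewrite /rho divr_ge0 ?(ltW mu0)// addr_ge0 ?(ltW e0)// addr_ge0.
(* each quadratic is within a factor 1 +- rho of 1 + x s *)
have Q a b : 0 < a -> 0 < b -> a * b = E n -> `|a - b - s| + E n <= mu * rho n ->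
    forall x, 0 <= x <= 1 -> (1 - rho n) * (1 + s * x) <= (1 + a * x) * (1 - b * x)
      <= (1 + rho n) * (1 + s * x).
  move=> aa0 bb0 ab h x /andP[x0 x1].
  have muL : mu <= 1 + s * x.
    have m1 : mu <= 1 by rewrite ge_min lexx.
    have m2 : mu <= 1 + s by rewrite ge_min lexx orbT.
    have : mu * (1 - x) <= 1 * (1 - x) by rewrite ler_wpM2r// subr_ge0.
    have : mu * x <= (1 + s) * x by rewrite ler_wpM2r.
    lra.
  have QE : (1 + a * x) * (1 - b * x) = (1 + s * x) + ((a - b - s) * x - E n * (x * x)).
    by rewrite -ab; ring.
  have dev : `|(a - b - s) * x - E n * (x * x)| <= mu * rho n.
    apply: (le_trans (ler_normB _ _)); apply: le_trans h.
    rewrite lerD// normrM ?(ger0_norm x0) ?(ger0_norm (ltW e0)).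
      by rewrite ler_piMr.
    rewrite [`|x * x|]ger0_norm ?mulr_ge0// ler_piMr ?(ltW e0)// mulr_ile1//.
  have dev2 : mu * rho n <= (1 + s * x) * rho n by rewrite ler_wpM2r.
  move: (le_trans dev dev2); rewrite QE ler_norml => /andP[q1 q2].
  by apply/andP; split; lra.
have mr : mu * rho n = `|a1 n - b1 n - s| + `|a2 n - b2 n - s| + E n.
  by rewrite /rho mulrC divfK// gt_eqF.
have Q1 := @Q _ _ a10 b10 ab1 _; have Q2 := @Q _ _ a20 b20 ab2 _.
have m1 : `|a1 n - b1 n - s| + E n <= mu * rho n by rewrite mr lerD2r lerDl.
have m2 : `|a2 n - b2 n - s| + E n <= mu * rho n by rewrite mr lerD2r lerDr.
have rp : 0 < 1 + 1 * rho n by rewrite mul1r ltr_pwDl.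
have rm : 0 < 1 + -1 * rho n by rewrite mulN1r subr_gt0.
have x01 x : 0 <= x <= 1 -> 0 < 1 + s * x by exact: affine_gt0.
rewrite /slope_ratio; apply/andP; split.
  rewrite ler_pdivlMr// /shift_gap /rate_gap.
  have := @rate_diff_ge R (a1 n) (b1 n) (a2 n) (b2 n) s ((1 + 1 * rho n) ^+ 2)
    a10 b1i a20 _ abE s21 s1' (exprn_gt0 2 rp) _.
  rewrite b20 b21 => /(_ isT) h.
  rewrite mulrCA ler_wpM2l ?sqr_ge0//.
  apply: le_trans (h _); first by rewrite le_eqVlt; apply/orP; left; apply/eqP; rewrite -/K; ring.
  move=> x xx; have /andP[l1 u1] := Q1 m1 x xx; have /andP[l2 u2] := Q2 m2 x xx.
  have p0 := x01 x xx.
  rewrite mul1r -exprMn expr2 ler_pM//.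
    by apply: le_trans l1; rewrite mulr_ge0 ?(ltW p0)// subr_ge0 ltW.
  by apply: le_trans l2; rewrite mulr_ge0 ?(ltW p0)// subr_ge0 ltW.
rewrite ler_pdivrMr// /shift_gap /rate_gap.
have := @rate_diff_le R (a1 n) (b1 n) (a2 n) (b2 n) s ((1 + -1 * rho n) ^+ 2)
    a10 b1i a20 b2i abE s21 s1' (exprn_gt0 2 rm) _.
move=> h; rewrite [leRHS]mulrCA ler_wpM2l ?sqr_ge0//.
apply: (le_trans (h _)); last by rewrite le_eqVlt; apply/orP; left; apply/eqP; rewrite -/K; ring.
move=> x xx; have /andP[l1 u1] := Q1 m1 x xx; have /andP[l2 u2] := Q2 m2 x xx.
have p0 := x01 x xx.
have q0 : 0 <= (1 - rho n) * (1 + s * x) by rewrite mulr_ge0 ?(ltW p0)// subr_ge0 ltW.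
by rewrite mulN1r -exprMn expr2 ler_pM.
Unshelve. all: by end_near. Qed.

Local Notation K := (rate_slope (al - be) 1).

Lemma level_ratio_cvg (lam : R) : shift_gap @ \oo --> lam ->
  level_ratio @ \oo --> expR (- (K * lam)).
Proof.
move=> gl.
have Dc : rate_gap @ \oo --> K * lam.
  apply: (seqlim_eq (seqlimM slope_ratio_cvg gl)) => //.
  by apply: filterS rate_gapE => n ->.
apply: (seqlim_eq (seqlimM level_ratio_exp_cvg (seqlim_expR (seqlimN Dc)))).
  by apply: nearW => n; rewrite -mulrA -expRD subrr expR0 mulr1.
exact: mul1r.
Qed.

Lemma level_ratio_cvg0 : shift_gap @ \oo --> +oo -> level_ratio @ \oo --> (0 : R).
Proof.
move=> gy.
have Dy : rate_gap @ \oo --> +oo.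
  apply: cvg_trans (seqlimMy (rate_slope1_gt0 s1) gy slope_ratio_cvg).
  by apply: near_eq_cvg; apply: filterS rate_gapE => n ->; rewrite mulrC.
apply: (seqlim_eq (seqlimM level_ratio_exp_cvg (seqlim_expNy Dy))).
  by apply: nearW => n; rewrite -mulrA -expRD subrr expR0 mulr1.
exact: mulr0.
Qed.

Lemma shift_gap_cvg (l : R) : level_ratio @ \oo --> l -> l != 0 ->
  exists lam : R, shift_gap @ \oo --> lam.
Proof.
move=> rl l0; exists (ln (1 / l) / K).
have l1 : 0 < l.
  rewrite lt_neqAle eq_sym l0/=; apply: (seqlim_le _ (seqlim_cst (0 : R)) rl).
  by apply: filterS near_level_ratio_gt0 => n; exact: ltW.
have ll : 0 < 1 / l by rewrite divr_gt0.
have K0 : K != 0 by rewrite gt_eqF// rate_slope1_gt0// s1.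
have Dc : rate_gap @ \oo --> ln (1 / l).
  apply: (seqlim_eq (seqlim_ln ll (seqlimM level_ratio_exp_cvg (seqlimV rl l0)))) => //.
  apply: filterS near_level_ratio_gt0 => n r0.
  by rewrite mulrAC divff ?gt_eqF// mul1r expRK.
apply: (seqlim_eq (seqlimM Dc (seqlimV slope_ratio_cvg K0))) => //.
near=> n.
have s0 : 0 < slope_ratio n.
  by near: n; exact: (seqlim_gt0_near (rate_slope1_gt0 s1) slope_ratio_cvg).
have -> : rate_gap n = slope_ratio n * shift_gap n by near: n; exact: rate_gapE.
by rewrite mulrC mulKf// gt_eqF.
Unshelve. all: by end_near. Qed.

End common_limit.

End pair_limits.

(** * Ratios at the bottom and top ranks *)

Section extreme_limits.
Context {R : realType}.
Variables (t : R) (i1 i2 : nat -> nat).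
Hypothesis h12 : \forall n \near \oo, [/\ (0 < i1 n)%N, (i1 n < i2 n)%N & (i2 n <= n)%N].
Local Notation dl := (@dHC R t).
Local Notation E n := (dl n ^+ 2 / n%:R).
Local Notation a1 := (low_seq t i1).
Local Notation b1 := (high_seq t i1).
Local Notation a2 := (low_seq t i2).
Local Notation b2 := (high_seq t i2).

(** The shift gap is at least s^2 / 6 for the shift s of the first rank, and s^2 times the slope
    at s tends to infinity with s; the prefactor is bounded. *)
Lemma level_ratio_bottom :
  (fun n => (a1 n)^-1) @ \oo --> (0 : R) -> (fun n => (a2 n)^-1) @ \oo --> (0 : R) ->
  b1 @ \oo --> (0 : R) -> b2 @ \oo --> (0 : R) ->
  level_ratio t i1 i2 @ \oo --> (0 : R).
Proof.
move=> a1c a2c b1c b2c.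
have near1 := near_gap_eqs t (near_rank1 h12).
have near2 := near_gap_eqs t (near_rank2 h12).
have a1y : a1 @ \oo --> +oo.
  have p : \forall n \near \oo, 0 < (a1 n)^-1.
    by apply: filterS near1 => n [[a0 _ _] _ _ _ _]; rewrite invr_gt0.
  by apply: cvg_trans (seqlim_invy p a1c); apply: near_eq_cvg; apply: nearW => n; rewrite invrK.
have lny : (fun n => (ln (1 + (a1 n - b1 n)) + - 2) * 6^-1) @ \oo --> +oo.
  have p6 : 0 < 6^-1 :> R by rewrite invr_gt0.
  apply: seqlimMy p6 _ (seqlim_cst _); apply: seqlimDy (seqlim_cst _).
  apply/cvgryPge => A; near=> n.
  have a1n : expR A <= a1 n by near: n; exact: cvgry_ge.
  have b1n : b1 n < 1 by near: n; exact: (cvgr_lt _ b1c).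
  have x0 : expR A <= 1 + (a1 n - b1 n) by lra.
  by rewrite -[leLHS]expRK ler_ln ?posrE ?expR_gt0// (lt_le_trans _ x0) ?expR_gt0.
have c0 : (fun n => 4 * expR 2 * expR (- ((ln (1 + (a1 n - b1 n)) + - 2) * 6^-1))) @ \oo --> (0 : R).
  apply: (seqlim_eq (seqlimM (seqlim_cst (4 * expR 2)) (seqlim_expNy lny))); last exact: mulr0.
  exact: nearW.
apply: (seqlim_squeeze0 _ c0); near=> n.
have d1 : 1 <= dl n by near: n; exact: near_dHC_ge.
have [h1 h2 h3] : [/\ (0 < i1 n)%N, (i1 n < i2 n)%N & (i2 n <= n)%N] by near: n.
have -> : 0 <= level_ratio t i1 i2 n by apply: ltW; near: n; exact: near_level_ratio_gt0.
have b1n : b1 n < 1 by near: n; exact: (cvgr_lt _ b1c).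
have b2n : b2 n < 2^-1 by near: n; apply: (cvgr_lt _ b2c); rewrite invr_gt0.
have a1n : 1 <= a1 n by near: n; exact: cvgry_ge.
have a2n : 1 <= a2 n.
  have h : (a2 n)^-1 < 1 by near: n; exact: (cvgr_lt _ a2c).
  have [|[a0 _ _] _ _ _ _] := near near2 n; first by [].
  by rewrite ltW// -invf_lt1.
have i2n : (i2 n < n)%N.
  have [|[_ b20 _] _ _ _ jE2] := near near2 n; first by [].
  rewrite ltn_neqAle h3 andbT; apply/eqP => iE.
  have : 0 < dl n ^+ 2 * (1 - b2 n).
    by rewrite mulr_gt0 ?exprn_gt0 ?subr_gt0 ?(lt_le_trans _ d1)// (lt_trans b2n)// invf_lt1// ltr1n.
  by rewrite -jE2 /corank iE subrr mul0r ltxx.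
have [|[a10 b10 _] _ _ _ _] := near near1 n; first by [].
have la : a2 n < a1 n by exact: low_gap_decr d1 h1 h2 h3.
rewrite /=; apply: (le_trans (rank_ratio_le_lt d1 h1 h2 h3 i2n)).
rewrite -/(low_seq t i2 n) -/(high_seq t i2 n) -/(low_seq t i1 n) -/(high_seq t i1 n).
have sq : Num.sqrt ((1 + a2 n) / (1 - b2 n) / ((1 + a1 n) / (1 - b1 n))) <= 2.
  have -> : (2 : R) = Num.sqrt (2 ^+ 2) by rewrite sqrtr_sqr ger0_norm.
  have p1 : 0 < 1 + a1 n by lra.
  have p2 : 0 < 1 - b2 n by lra.
  have p3 : 0 < 1 - b1 n by lra.
  rewrite ler_wsqrtr// ler_pdivrMr ?divr_gt0// ler_pdivrMr//.
  apply: (@le_trans _ _ (1 + a1 n)); first by lra.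
  rewrite -mulrA [_ / _ * _]mulrAC mulrA ler_pdivlMr// mulrCA ler_wpM2l ?(ltW p1)//.
  by lra.
have s0 : 0 < a1 n - b1 n by lra.
have Dl : (ln (1 + (a1 n - b1 n)) + - 2) * 6^-1 <= rate_gap t i1 i2 n.
  apply: le_trans (rate_diff_ge_slope d1 h1 h2 h3).
  have := shift_gap_bottom d1 h1 h2 h3 a2n.
  rewrite -/(low_seq t i2 n) -/(high_seq t i2 n) -/(low_seq t i1 n) -/(high_seq t i1 n) => sg.
  have K0 : 0 < rate_slope (a1 n - b1 n) 1 by apply: rate_slope1_gt0; lra.
  apply: (@le_trans _ _ ((a1 n - b1 n) ^+ 2 / 6 * rate_slope (a1 n - b1 n) 1)).
    rewrite mulrAC ler_wpM2r ?invr_ge0// rate_slope1_ge_ln//.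
  rewrite ler_wpM2r ?(ltW K0)//; apply: le_trans sg.
  by rewrite ler_wpM2r ?invr_ge0// ler_pXn2r ?nnegrE ?(ltW s0) ?(ltW a10)//; lra.
have eD : expR (- rate_gap t i1 i2 n) <= expR (- ((ln (1 + (a1 n - b1 n)) + - 2) * 6^-1)).
  by rewrite ler_expR lerN2.
have e2 : 0 <= 2 * expR 2 :> R by apply: mulr_ge0 => //; exact: expR_ge0.
have e3 : 0 <= 2 * expR 2 * expR (- rate_gap t i1 i2 n) by apply: mulr_ge0 => //; exact: expR_ge0.
apply: (@le_trans _ _ (2 * expR 2 * expR (- rate_gap t i1 i2 n) * 2)).
  exact: ler_wpM2l.
rewrite mulrAC; apply: (@le_trans _ _ (2 * expR 2 * 2 * expR (- ((ln (1 + (a1 n - b1 n)) + - 2) * 6^-1)))).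
  by apply: ler_wpM2l => //; apply: mulr_ge0.
rewrite le_eqVlt; apply/orP; left; apply/eqP; ring.
Unshelve. all: by end_near. Qed.

(** The prefactor is at most exponential in the rank difference, while the rates differ by at
    least a fixed multiple of this difference times a slope that tends to infinity. *)
Lemma level_ratio_top :
  b1 @ \oo --> (1 : R) -> a1 @ \oo --> (0 : R) ->
  level_ratio t i1 i2 @ \oo --> (0 : R).
Proof.
move=> b1c a1c.
have near1 := near_gap_eqs t (near_rank1 h12).
have near2 := near_gap_eqs t (near_rank2 h12).
pose s n : R := a1 n - b1 n.
have sc : s @ \oo --> (-1 : R).
  by apply: (seqlim_eq (seqlimB a1c b1c)); [exact: nearW | rewrite sub0r].
have s1 : \forall n \near \oo, -1 < s n < 0.
  near=> n.
  have d1 : 1 <= dl n by near: n; exact: near_dHC_ge.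
  have [h1 h2 h3] : [/\ (0 < i1 n)%N, (i1 n < i2 n)%N & (i2 n <= n)%N] by near: n.
  have [|[a10 b10 b11] _ _ _ _] := near near1 n; first by [].
  apply/andP; split; first by rewrite /s; lra.
  by near: n; apply: (cvgr_lt _ sc); rewrite oppr_lt0.
have lny : (fun n => (- ln (1 + s n) + - (2 + 48)) * 48^-1) @ \oo --> +oo.
  have p48 : 0 < 48^-1 :> R by rewrite invr_gt0.
  apply: seqlimMy p48 _ (seqlim_cst _); apply: seqlimDy (seqlim_cst _).
  apply/cvgryPge => A; near=> n.
  have sn : s n < expR (- A) - 1.
    by near: n; apply: (cvgr_lt _ sc); rewrite ltrBrDr addNr expR_gt0.
  have /andP[sn1 _] : -1 < s n < 0 by near: n.
  rewrite lerNr -[leRHS]expRK ler_ln ?posrE ?expR_gt0//; lra.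
have c0 : (fun n => 2 * expR 2 * expR (- ((- ln (1 + s n) + - (2 + 48)) * 48^-1))) @ \oo --> (0 : R).
  apply: (seqlim_eq (seqlimM (seqlim_cst (2 * expR 2)) (seqlim_expNy lny))); last exact: mulr0.
  exact: nearW.
apply: (seqlim_squeeze0 _ c0); near=> n.
have d1 : 1 <= dl n by near: n; exact: near_dHC_ge.
have [h1 h2 h3] : [/\ (0 < i1 n)%N, (i1 n < i2 n)%N & (i2 n <= n)%N] by near: n.
have -> : 0 <= level_ratio t i1 i2 n by apply: ltW; near: n; exact: near_level_ratio_gt0.
have b1n : 2^-1 <= b1 n.
  by near: n; apply: (cvgr_ge _ b1c); rewrite invf_lt1// ltr1n.
have e1 : E n <= 1 by near: n; apply: (cvgr_le _ (eps_cvg0 t)).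
have sn : -1 < s n < 0 by near: n.
have /andP[sn1 sn0] := sn.
have L0 : 0 <= (- ln (1 + s n) + - (2 + 48)) * 48^-1 by near: n; exact: cvgry_ge lny 0.
rewrite /=; apply: (le_trans (rank_ratio_top d1 h1 h2 h3 b1n e1)).
rewrite -/(low_seq t i2 n) -/(high_seq t i2 n) -/(low_seq t i1 n) -/(high_seq t i1 n) -/(rate_gap t i1 i2 n).
have e2 : 0 <= 2 * expR 2 :> R by apply: mulr_ge0 => //; exact: expR_ge0.
apply: ler_wpM2l => //; rewrite ler_expR.
have sg := shift_gap_top d1 h1 h2 h3 b1n e1.
have K0 : 0 < rate_slope (s n) 1 by exact: rate_slope1_gt0.
have Dl := rate_diff_ge_slope d1 h1 h2 h3.
have Kl := rate_slope1_ge_lnN sn.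
have m1 : 1 <= (i2 n)%:R - (i1 n)%:R :> R by rewrite lerBrDl natr1 ler_nat.
move: sg Dl; rewrite -/(low_seq t i2 n) -/(high_seq t i2 n) -/(low_seq t i1 n).
rewrite -/(high_seq t i1 n) -/(rate_gap t i1 i2 n) -/(s n) -/(shift_gap t i1 i2 n).
move: m1 Kl K0 L0.
move: ((i2 n)%:R - (i1 n)%:R) (rate_slope (s n) 1) (ln (1 + s n)) (rate_gap _ _ _ _) (shift_gap _ _ _ _).
move=> m K L D S m1 Kl K0 L0 sg Dl.
have p1 : m / 48 * K <= S * K by rewrite ler_wpM2r ?(ltW K0).
have p2 : 0 <= (m - 1) * (K - 48) by rewrite mulr_ge0//; lra.
lra.
Unshelve. all: by end_near. Qed.

End extreme_limits.

(** * Differences of ranks and of gaps *)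

(** Here x1, x2 are the larger and the smaller gap of two ranks or coranks y1 < y2; th is 1 for
    ranks and -1 for coranks. *)
Section rank_gaps.
Context {R : realType}.
Variables (t th : R) (x1 x2 y1 y2 : nat -> R).
Local Notation u := (@u R).
Local Notation dl := (@dHC R t).
Local Notation E n := (dl n ^+ 2 / n%:R).
Hypothesis th1 : `|th| <= 1.
Hypothesis x10 : \forall n \near \oo, 0 < x1 n.
Hypothesis x20 : \forall n \near \oo, 0 < x2 n.
Hypothesis e0 : \forall n \near \oo, 0 < E n.
Hypothesis xy1 : \forall n \near \oo, y1 n * (x1 n ^+ 2 + E n) = dl n ^+ 2 * (1 + th * x1 n).
Hypothesis xy2 : \forall n \near \oo, y2 n * (x2 n ^+ 2 + E n) = dl n ^+ 2 * (1 + th * x2 n).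

Definition gap_diff n : R := dl n ^+ 2 * (x1 n - x2 n).

(** With a positive limit of the gaps the factor between rank difference and gap difference in
    gap_eq_sub converges. *)
Lemma rank_diff_cvg (xi : R) : 0 < xi -> 0 < 2 * xi + th * xi ^+ 2 ->
  x1 @ \oo --> xi -> x2 @ \oo --> xi ->
  exists psi : nat -> R, exists2 c : R, 0 < c & psi @ \oo --> c /\
    (\forall n \near \oo, y2 n - y1 n = gap_diff n * psi n).
Proof.
move=> xi0 c0 x1c x2c.
pose psi n := (x1 n + x2 n + th * x1 n * x2 n - th * E n)
  / ((x1 n ^+ 2 + E n) * (x2 n ^+ 2 + E n)).
exists psi, ((2 * xi + th * xi ^+ 2) / xi ^+ 4); first by rewrite divr_gt0// exprn_gt0.
have ec := eps_cvg0 t.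
have x4 : (xi ^+ 2 + 0) * (xi ^+ 2 + 0) != 0 by rewrite addr0 mulf_neq0// expf_neq0// gt_eqF.
split.
  have h := seqlimM (seqlimB (seqlimD (seqlimD x1c x2c)
      (seqlimM (seqlimM (seqlim_cst th) x1c) x2c)) (seqlimM (seqlim_cst th) ec))
    (seqlimV (seqlimM (seqlimD (seqlimX 2 x1c) ec) (seqlimD (seqlimX 2 x2c) ec)) x4).
  apply: (seqlim_eq h); first exact: nearW.
  by rewrite !addr0 mulr0 subr0; field; rewrite gt_eqF.
near=> n.
have e0n : 0 < E n by near: n.
have h1 : y1 n * (x1 n ^+ 2 + E n) = dl n ^+ 2 * (1 + th * x1 n) by near: n.
have h2 : y2 n * (x2 n ^+ 2 + E n) = dl n ^+ 2 * (1 + th * x2 n) by near: n.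
have q1 : x1 n ^+ 2 + E n != 0 by rewrite gt_eqF// ltr_wpDl ?sqr_ge0.
have q2 : x2 n ^+ 2 + E n != 0 by rewrite gt_eqF// ltr_wpDl ?sqr_ge0.
apply: (mulIf (mulf_neq0 q1 q2)); rewrite (gap_eq_sub h1 h2) /psi /gap_diff.
by rewrite -[RHS]mulrA divfK// mulf_neq0.
Unshelve. all: by end_near. Qed.

Hypothesis y10 : \forall n \near \oo, 0 < y1 n.
Hypothesis x21 : \forall n \near \oo, x2 n <= x1 n.
Hypothesis x1c : x1 @ \oo --> (0 : R).
Hypothesis x2c : x2 @ \oo --> (0 : R).
Hypothesis dx1 : (fun n => dl n ^+ 2 * x1 n) @ \oo --> +oo.

(** The quotient of x1 + x2 by x1 up to corrections of lower order; it tends to 2 once x2 / x1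
    tends to 1. *)
Definition gap_factor n : R := (1 + x2 n / x1 n + th * x2 n - th * (E n / x1 n))
  / ((1 + E n / x1 n ^+ 2) * (1 + th * x2 n)).

(** By the gap equation y1 is close to d^2 / x1^2, and d^6 / u^3 tends to 8, so that this tends
    to the constant sqrt 8. *)
Definition scale_factor n : R := dl n ^+ 2 * x1 n * Num.sqrt (y1 n / u n ^+ 3).

Let inv_dx1 : (fun n => (dl n ^+ 2 * x1 n)^-1) @ \oo --> (0 : R).
Proof. by apply: seqlim_inv0 dx1; exact: cvgry_gt dx1 0. Qed.

Lemma eps_div_sqr_cvg0 : (fun n => E n / x1 n ^+ 2) @ \oo --> (0 : R).
Proof.
apply: (seqlim_eq (seqlimM (dHC_pow_eps_cvg0 t 4) (seqlimM inv_dx1 inv_dx1))); last by rewrite !mulr0.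
near=> n.
have x0 : 0 < x1 n by near: n.
have d1 : 1 <= dl n by near: n; exact: near_dHC_ge.
have d0 : 0 < dl n by exact: lt_le_trans d1.
by move: (n%:R^-1) (dl n) d0 => N d d0; field; rewrite !gt_eqF.
Unshelve. all: by end_near. Qed.

Lemma eps_div_cvg0 : (fun n => E n / x1 n) @ \oo --> (0 : R).
Proof.
apply: (seqlim_eq (seqlimM eps_div_sqr_cvg0 x1c)); last exact: mulr0.
near=> n.
have x0 : 0 < x1 n by near: n.
by move: (E n) => e; field; rewrite gt_eqF.
Unshelve. all: by end_near. Qed.

Lemma scale_factor_cvg : scale_factor @ \oo --> Num.sqrt (8 : R).
Proof.
have h := seqlimM (seqlimM (dHC6_div_cvg t) (seqlimD (seqlim_cst (1 : R)) (seqlimM (seqlim_cst th) x1c)))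
  (seqlimV (seqlimD (seqlim_cst (1 : R)) eps_div_sqr_cvg0) _).
rewrite mulr0 !addr0 invr1 !mulr1 in h; have h' := seqlim_sqrt (h (oner_neq0 R)).
apply: (seqlim_eq h') => //.
near=> n.
have x0 : 0 < x1 n by near: n.
have u0 : 0 < u n by near: n; exact: near_u_gt0.
have d1 : 1 <= dl n by near: n; exact: near_dHC_ge.
have e0n : 0 < E n by near: n.
have h1 : y1 n * (x1 n ^+ 2 + E n) = dl n ^+ 2 * (1 + th * x1 n) by near: n.
have p0 : 0 <= dl n ^+ 2 * x1 n by rewrite mulr_ge0 ?sqr_ge0 ?ltW.
rewrite /scale_factor -[X in _ = X * _](ger0_norm p0) -sqrtr_sqr -sqrtrM ?sqr_ge0//.
congr Num.sqrt.
have q1 : x1 n ^+ 2 + E n != 0 by rewrite gt_eqF// ltr_wpDl ?sqr_ge0.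
have yE : y1 n = dl n ^+ 2 * (1 + th * x1 n) / (x1 n ^+ 2 + E n) by rewrite -h1 mulfK.
rewrite yE; move: (E n) q1 => e q1; field.
by rewrite q1 !gt_eqF.
Unshelve. all: by end_near. Qed.

Let th_cvg0 : (fun n => 1 + th * x2 n) @ \oo --> (1 : R).
Proof.
apply: (seqlim_eq (seqlimD (seqlim_cst (1 : R)) (seqlimM (seqlim_cst th) x2c))).
  exact: nearW.
by rewrite mulr0 addr0.
Qed.

Let denom_cvg : (fun n => (1 + E n / x1 n ^+ 2) * (1 + th * x2 n)) @ \oo --> (1 : R).
Proof.
apply: (seqlim_eq (seqlimM (seqlimD (seqlim_cst (1 : R)) eps_div_sqr_cvg0) th_cvg0)).
  exact: nearW.
by rewrite addr0 mulr1.
Qed.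

Lemma gap_factor_cvg : (fun n => x2 n / x1 n) @ \oo --> (1 : R) -> gap_factor @ \oo --> (2 : R).
Proof.
move=> rc.
have h := seqlimM (seqlimB (seqlimD (seqlimD (seqlim_cst (1 : R)) rc) (seqlimM (seqlim_cst th) x2c))
  (seqlimM (seqlim_cst th) eps_div_cvg0)) (seqlimV denom_cvg (oner_neq0 R)).
apply: (seqlim_eq h); first exact: nearW.
by rewrite !mulr0 addr0 subr0 invr1 mulr1.
Qed.

(** This bound does not presuppose that x2 / x1 tends to 1; it gives the bound on gap_diff from
    which that limit follows. *)
Lemma near_gap_factor_ge : \forall n \near \oo, 2^-1 <= gap_factor n.
Proof.
near=> n.
have x0 : 0 < x1 n by near: n.
have x0' : 0 < x2 n by near: n.
have e0n : 0 < E n by near: n.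
have half1 : 4^-1 < 1 :> R by rewrite invf_lt1// ltr1n.
have c1 : (1 + E n / x1 n ^+ 2) * (1 + th * x2 n) < 3 / 2.
  by near: n; apply: (cvgr_lt _ denom_cvg); lra.
have c0 : 0 < (1 + E n / x1 n ^+ 2) * (1 + th * x2 n).
  by near: n; exact: (seqlim_gt0_near ltr01 denom_cvg).
have h1 : x2 n < 8^-1 by near: n; apply: (cvgr_lt _ x2c); rewrite invr_gt0.
have h2 : E n / x1 n < 8^-1 by near: n; apply: (cvgr_lt _ eps_div_cvg0); rewrite invr_gt0.
have [t1 t2] : -1 <= th /\ th <= 1 by apply/andP; rewrite -ler_norml th1.
have h3 : - x2 n <= th * x2 n by rewrite -mulN1r ler_wpM2r// ltW.
have h4 : th * (E n / x1 n) <= E n / x1 n by rewrite ler_piMl// divr_ge0 ?ltW.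
have h5 : 0 <= x2 n / x1 n by rewrite divr_ge0 ?ltW.
rewrite /gap_factor ler_pdivlMr//; lra.
Unshelve. all: by end_near. Qed.

(** Measured in units of sqrt (y1 / u^3), the relative rank difference 1 - y1 / y2 is the gap
    difference up to the two correction factors. *)
Lemma rank_quotientE : \forall n \near \oo,
  (1 - y1 n / y2 n) * scale_factor n =
  gap_diff n * gap_factor n * Num.sqrt (y1 n / u n ^+ 3).
Proof.
near=> n.
have x0 : 0 < x1 n by near: n.
have x0' : 0 < x2 n by near: n.
have e0n : 0 < E n by near: n.
have d1 : 1 <= dl n by near: n; exact: near_dHC_ge.
have d0 : dl n != 0 by rewrite gt_eqF//; apply: lt_le_trans d1.
have h1 : y1 n * (x1 n ^+ 2 + E n) = dl n ^+ 2 * (1 + th * x1 n) by near: n.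
have h2 : y2 n * (x2 n ^+ 2 + E n) = dl n ^+ 2 * (1 + th * x2 n) by near: n.
have q1 : x1 n ^+ 2 + E n != 0 by rewrite gt_eqF// ltr_wpDl ?sqr_ge0.
have q2 : x2 n ^+ 2 + E n != 0 by rewrite gt_eqF// ltr_wpDl ?sqr_ge0.
have p2 : 1 + th * x2 n != 0.
  by rewrite gt_eqF//; near: n; exact: (seqlim_gt0_near ltr01 th_cvg0).
have y1E : y1 n = dl n ^+ 2 * (1 + th * x1 n) / (x1 n ^+ 2 + E n) by rewrite -h1 mulfK.
have y2E : y2 n = dl n ^+ 2 * (1 + th * x2 n) / (x2 n ^+ 2 + E n) by rewrite -h2 mulfK.
have -> : gap_diff n * gap_factor n = (1 - y1 n / y2 n) * (dl n ^+ 2 * x1 n).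
  rewrite y1E y2E /gap_diff /gap_factor; move: (E n) q1 q2 => e q1 q2; field.
  by rewrite q1 q2 p2 d0 gt_eqF.
by rewrite /scale_factor mulrA.
Unshelve. all: by end_near. Qed.

(** A bounded d^2 (x1 - x2) is negligible against d^2 x1, which tends to infinity. *)
Lemma ratio_gap_cvg1 (G : nat -> R) (c : R) : G @ \oo --> c ->
  (\forall n \near \oo, gap_diff n <= G n) -> (fun n => x2 n / x1 n) @ \oo --> (1 : R).
Proof.
move=> Gc le.
have h0 : (fun n => gap_diff n * (dl n ^+ 2 * x1 n)^-1) @ \oo --> (0 : R).
  have h := seqlimM Gc inv_dx1; rewrite mulr0 in h.
  apply: (seqlim_squeeze0 _ h); near=> n.
  have p : 0 < dl n ^+ 2 * x1 n by near: n; exact: cvgry_gt dx1 0.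
  have gl : gap_diff n <= G n by near: n.
  have xx : x2 n <= x1 n by near: n.
  have g0 : 0 <= gap_diff n by rewrite /gap_diff mulr_ge0 ?sqr_ge0 ?subr_ge0.
  by rewrite mulr_ge0 ?invr_ge0 ?(ltW p)//= ler_wpM2r// invr_ge0 ltW.
apply: (seqlim_eq (seqlimB (seqlim_cst (1 : R)) h0)); last exact: subr0.
near=> n.
have x0 : 0 < x1 n by near: n.
have d1 : 1 <= dl n by near: n; exact: near_dHC_ge.
have d0 : dl n != 0 by rewrite gt_eqF//; apply: lt_le_trans d1.
by rewrite /gap_diff; field; rewrite d0 gt_eqF.
Unshelve. all: by end_near. Qed.

Let near_sqrt_gt0 : \forall n \near \oo, 0 < Num.sqrt (y1 n / u n ^+ 3).
Proof.
near=> n.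
have y0 : 0 < y1 n by near: n.
have u0 : 0 < u n by near: n; exact: near_u_gt0.
by rewrite sqrtr_gt0 divr_gt0// exprn_gt0.
Unshelve. all: by end_near. Qed.

Let sqrt8 : Num.sqrt (8 : R) != 0.
Proof. by rewrite gt_eqF// sqrtr_gt0. Qed.

Lemma gap_diff_of_quotient (c : nat -> R) (c0 : R) : c @ \oo --> c0 ->
  (\forall n \near \oo, y1 n / y2 n = 1 - c n * Num.sqrt (y1 n / u n ^+ 3)) ->
  gap_diff @ \oo --> c0 * Num.sqrt 8 / 2.
Proof.
move=> cc yc.
have eq1 : \forall n \near \oo, gap_diff n * gap_factor n = c n * scale_factor n.
  near=> n.
  have q0 : 0 < Num.sqrt (y1 n / u n ^+ 3) by near: n; exact: near_sqrt_gt0.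
  have e : (1 - y1 n / y2 n) * scale_factor n =
    gap_diff n * gap_factor n * Num.sqrt (y1 n / u n ^+ 3) by near: n; exact: rank_quotientE.
  have yn : y1 n / y2 n = 1 - c n * Num.sqrt (y1 n / u n ^+ 3) by near: n.
  apply: (mulIf (lt0r_neq0 q0)); rewrite -e yn; ring.
have W0 : \forall n \near \oo, 0 < gap_factor n.
  by apply: filterS near_gap_factor_ge => n; apply: lt_le_trans; rewrite invr_gt0.
have rc : (fun n => x2 n / x1 n) @ \oo --> (1 : R).
  apply: (@ratio_gap_cvg1 (fun n => 2 * (c n * scale_factor n)) (2 * (c0 * Num.sqrt 8))).
    exact: seqlimM (seqlim_cst 2) (seqlimM cc scale_factor_cvg).
  near=> n.
  have e : gap_diff n * gap_factor n = c n * scale_factor n by near: n.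
  have w : 2^-1 <= gap_factor n by near: n; exact: near_gap_factor_ge.
  have xx : x2 n <= x1 n by near: n.
  have g0 : 0 <= gap_diff n by rewrite /gap_diff mulr_ge0 ?sqr_ge0 ?subr_ge0.
  have : gap_diff n * 2^-1 <= gap_diff n * gap_factor n by rewrite ler_wpM2l.
  rewrite e; lra.
have two0 : (2 : R) != 0 by [].
apply: (seqlim_eq (seqlimM (seqlimM cc scale_factor_cvg) (seqlimV (gap_factor_cvg rc) two0))) => //.
near=> n.
have w : 0 < gap_factor n by near: n.
have <- : gap_diff n * gap_factor n = c n * scale_factor n by near: n.
by rewrite mulfK// gt_eqF.
Unshelve. all: by end_near. Qed.

Lemma quotient_of_gap_diff (lam : R) : gap_diff @ \oo --> lam ->
  (fun n => (1 - y1 n / y2 n) / Num.sqrt (y1 n / u n ^+ 3)) @ \oo --> lam * 2 / Num.sqrt 8.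
Proof.
move=> gl; have rc : (fun n => x2 n / x1 n) @ \oo --> (1 : R).
  by apply: (ratio_gap_cvg1 gl); exact: nearW.
apply: (seqlim_eq (seqlimM (seqlimM gl (gap_factor_cvg rc)) (seqlimV scale_factor_cvg sqrt8))) => //.
near=> n.
have q0 : 0 < Num.sqrt (y1 n / u n ^+ 3) by near: n; exact: near_sqrt_gt0.
have s0 : 0 < scale_factor n.
  by near: n; apply: (seqlim_gt0_near _ scale_factor_cvg); rewrite sqrtr_gt0.
have e : (1 - y1 n / y2 n) * scale_factor n =
  gap_diff n * gap_factor n * Num.sqrt (y1 n / u n ^+ 3) by near: n; exact: rank_quotientE.
have sN : scale_factor n != 0 by rewrite gt_eqF.
have qN : Num.sqrt (y1 n / u n ^+ 3) != 0 by rewrite gt_eqF.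
apply: (mulIf (mulf_neq0 sN qN)).
rewrite [LHS](_ : _ = gap_diff n * gap_factor n * Num.sqrt (y1 n / u n ^+ 3)); last first.
  by rewrite mulrA divfK.
by rewrite -e [scale_factor n * _]mulrC [RHS]mulrA divfK.
Unshelve. all: by end_near. Qed.

End rank_gaps.

(** * Quotients, integers and the central classes *)

Section little_o.
Context {R : realType}.
Implicit Types (f g : nat -> R).

Lemma littleo1_quotient f g : (\forall n \near \oo, 0 < g n) ->
  (f = cst 1 +o_\oo g) -> (fun n => (1 - f n) / g n) @ \oo --> (0 : R).
Proof.
move=> g0 /eqaddoP fo; apply/cvgr0Pnorm_le => e e0.
near=> n; have gn : 0 < g n by near: n.
have h : `|(f - cst 1) n| <= e * `|g n| by near: n; exact: fo.
rewrite normrM normfV (ger0_norm (ltW gn)) ler_pdivrMr//.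
by rewrite distrC; move: h; rewrite (ger0_norm (ltW gn)).
Unshelve. all: by end_near. Qed.

Lemma quotient_littleo1 f g : (\forall n \near \oo, 0 < g n) ->
  (fun n => (1 - f n) / g n) @ \oo --> (0 : R) -> (f = cst 1 +o_\oo g).
Proof.
move=> g0 fo; apply/eqaddoP => e e0.
near=> n; have gn : 0 < g n by near: n.
have h : `|(1 - f n) / g n| <= e by near: n; move/cvgr0Pnorm_le: fo; apply.
rewrite normrM normfV (ger0_norm (ltW gn)) ler_pdivrMr// distrC in h.
by rewrite (ger0_norm (ltW gn)).
Unshelve. all: by end_near. Qed.

Lemma near_quotientE f g : (\forall n \near \oo, 0 < g n) ->
  \forall n \near \oo, f n = 1 - (1 - f n) / g n * g n.
Proof.
by apply: filterS => n g0; rewrite divfK ?gt_eqF// opprB addrC subrK.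
Qed.

Lemma nat_cvg_eventually_cst (k : nat -> nat) (l : R) :
  (fun n => (k n)%:R : R) @ \oo --> l -> exists m, \forall n \near \oo, k n = m.
Proof.
move=> kl.
have h : \forall n \near \oo, `|(k n)%:R - l| < 2^-1.
  have e2 : 0 < 2^-1 :> R by rewrite invr_gt0.
  by move/cvgrPdist_lt: kl => /(_ _ e2); apply: filterS => n; rewrite distrC.
have [N _ hN] := h; exists (k N); near=> n.
have hn : `|(k n)%:R - l| < 2^-1 by near: n.
have hN' := hN N (leqnn N).
have : `|(k n)%:R - (k N)%:R| < 1 :> R.
  have -> : (k n)%:R - (k N)%:R = ((k n)%:R - l) - ((k N)%:R - l) :> R by ring.
  by apply: (le_lt_trans (ler_normB _ _)); rewrite /= in hN'; lra.
have [kk|kk] := leqP (k n) (k N).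
  rewrite distrC -natrB// normr_nat ltrn1 ltnS leqn0 subn_eq0 => kk'.
  by apply/eqP; rewrite eqn_leq kk.
rewrite -natrB ?(ltnW kk)// normr_nat ltrn1 ltnS leqn0 subn_eq0 => kk'.
by apply/eqP; rewrite eqn_leq kk' ltnW.
Unshelve. all: by end_near. Qed.

End little_o.

Section central_classes.
Context {R : realType}.
Variables (t : R) (i : nat -> nat).
Hypothesis hi : \forall n \near \oo, (0 < i n <= n)%N.
Local Notation dl := (@dHC R t).
Local Notation a := (low_seq t i).
Local Notation b := (high_seq t i).

Definition scaled_shift n : R := dl n ^+ 2 * (a n - b n).

Lemma scaled_shift_cvg (x y : R) : (fun n => dl n ^+ 2 * a n) @ \oo --> x ->
  (fun n => dl n ^+ 2 * b n) @ \oo --> y -> scaled_shift @ \oo --> x - y.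
Proof.
by move=> ax ay; apply: (seqlim_eq (seqlimB ax ay)) => //; apply: nearW => n; rewrite -mulrBr.
Qed.

Definition central : Prop := a @ \oo --> (0 : R) /\ b @ \oo --> (0 : R).

Lemma classB_central (c : R) : 0 < c -> classB c i ->
  central /\ scaled_shift @ \oo --> Num.sqrt (8 / c).
Proof.
move=> c0 /(classB_gaps t hi c0)[ac bc da db]; split=> //.
by rewrite -[X in _ --> X]subr0; exact: scaled_shift_cvg.
Qed.

Lemma classBbar_central (c : R) : 0 < c -> classBbar c i ->
  central /\ scaled_shift @ \oo --> - Num.sqrt (8 / c).
Proof.
move=> c0 /(classBbar_gaps t hi c0)[ac bc db da]; split=> //.
by rewrite -[X in _ --> X]sub0r; exact: scaled_shift_cvg.
Qed.

Lemma classC_central : @classC R i -> central /\ scaled_shift @ \oo --> (0 : R).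
Proof.
move=> /(classC_gaps t hi)[ac bc da db]; split=> //.
by rewrite -[X in _ --> X]subr0; exact: scaled_shift_cvg.
Qed.

Lemma classB0_central : @classB0 R i -> central /\ scaled_shift @ \oo --> +oo.
Proof.
move=> /(classB0_gaps t hi)[ac bc da db]; split=> //.
apply: cvg_trans (seqlimDy da (seqlimN db)); apply: near_eq_cvg.
by apply: nearW => n; rewrite -mulrBr.
Qed.

Lemma classBbar0_central : @classBbar0 R i ->
  central /\ (fun n => - scaled_shift n) @ \oo --> +oo.
Proof.
move=> /(classBbar0_gaps t hi)[ac bc da db]; split=> //.
apply: cvg_trans (seqlimDy da (seqlimN db)); apply: near_eq_cvg.
by apply: nearW => n; rewrite /scaled_shift; ring.
Qed.

(** The limit of 1 / (2 + s), unlike that of the shift s, is finite in every class: here r / (2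
    r + 1) < 1/2, for coranks of order u it is 1 / (2 - q) > 1/2, and 1/2 in the classes between. *)
Lemma classA_inv_shift (r : R) : 0 <= r -> (fun n => (a n)^-1) @ \oo --> r ->
  b @ \oo --> (0 : R) -> (fun n => (2 + (a n - b n))^-1) @ \oo --> r / (2 * r + 1).
Proof.
move=> r0 ar bc.
have d0 : 2 * r + (1 - 0 * r) != 0 by rewrite mul0r subr0 gt_eqF// ltr_wpDl// mulr_ge0.
apply: (seqlim_eq (seqlimM ar (seqlimV (seqlimD (seqlimM (seqlim_cst (2 : R)) ar)
  (seqlimB (seqlim_cst (1 : R)) (seqlimM bc ar))) d0))); last by rewrite mul0r subr0.
near=> n; have a0 : 0 < a n by near: n; exact: near_low_gt0.
have [|[_ b0 b1] _ _ _ _] := near (near_gap_eqs t hi) n; first by [].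
have s0 : 2 + (a n - b n) != 0 by rewrite gt_eqF//; lra.
move: a0 s0; move: (a n) (b n) => A B A0 s0; field.
by rewrite s0 gt_eqF//= andbT gt_eqF.
Unshelve. all: by end_near. Qed.

Lemma inv_shift_cvg (x y : R) : a @ \oo --> x -> b @ \oo --> y -> 0 <= x -> y <= 1 ->
  (fun n => (2 + (a n - b n))^-1) @ \oo --> (2 + (x - y))^-1.
Proof.
move=> ax ay x0 y1; apply: seqlimV; last by rewrite gt_eqF//; lra.
by apply: seqlimD (seqlim_cst _) (seqlimB ax ay).
Qed.

End central_classes.

(** * From rank gaps to shift gaps and back *)

Section ratio_limits.
Context {R : realType}.
Variables (t : R) (i1 i2 : nat -> nat).
Hypothesis h12 : \forall n \near \oo, [/\ (0 < i1 n)%N, (i1 n < i2 n)%N & (i2 n <= n)%N].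
Local Notation u := (@u R).
Local Notation dl := (@dHC R t).
Local Notation E n := (dl n ^+ 2 / n%:R).
Local Notation a1 := (low_seq t i1).
Local Notation b1 := (high_seq t i1).
Local Notation a2 := (low_seq t i2).
Local Notation b2 := (high_seq t i2).
Local Notation ratio := (level_ratio t i1 i2).
Local Notation sg := (shift_gap t i1 i2).

Let r1 := near_rank1 h12.
Let r2 := near_rank2 h12.

(** The non-degenerate situation, in which the ratio of the levels tends to exp (- K lam) with K
    > 0: to 1 if lam = 0 and to a number in ]0, 1[ if lam > 0. *)
Definition gap_limit (x y lam : R) : Prop :=
  [/\ 0 <= x, y < 1, a1 @ \oo --> x /\ a2 @ \oo --> x, b1 @ \oo --> y /\ b2 @ \oo --> y &
      sg @ \oo --> lam].

Lemma gap_limit_ratio x y lam : gap_limit x y lam ->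
  ratio @ \oo --> expR (- (rate_slope (x - y) 1 * lam)).
Proof. by move=> [x0 y1 [? ?] [? ?] sl]; exact: level_ratio_cvg. Qed.

Lemma gap_limit_ratio1 x y : gap_limit x y 0 -> ratio @ \oo --> (1 : R).
Proof. by move=> /gap_limit_ratio; rewrite mulr0 oppr0 expR0. Qed.

Lemma gap_limit_ratio01 x y lam : 0 < lam -> gap_limit x y lam ->
  exists l : R, [/\ ratio @ \oo --> l, 0 < l & l < 1].
Proof.
move=> l0 gl; exists (expR (- (rate_slope (x - y) 1 * lam))); split.
- exact: gap_limit_ratio.
- exact: expR_gt0.
rewrite expR_lt1 oppr_lt0 mulr_gt0// rate_slope1_gt0//.
by case: gl => x0 y1 _ _ _; lra.
Qed.

Lemma scaled_shift_sub n : sg n = scaled_shift t i1 n - scaled_shift t i2 n.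
Proof. by rewrite /shift_gap /scaled_shift mulrBr. Qed.

Lemma central_gap_limit (s1 s2 : R) : central t i1 /\ scaled_shift t i1 @ \oo --> s1 ->
  central t i2 /\ scaled_shift t i2 @ \oo --> s2 -> gap_limit 0 0 (s1 - s2).
Proof.
move=> [[? ?] c1] [[? ?] c2]; split=> //.
apply: (seqlim_eq (seqlimB c1 c2)) => //.
by apply: nearW => n; rewrite scaled_shift_sub.
Qed.

Lemma near_low12 : \forall n \near \oo, a2 n < a1 n.
Proof.
near=> n; have d1 : 1 <= dl n by near: n; exact: near_dHC_ge.
have [h1 h2 h3] : [/\ (0 < i1 n)%N, (i1 n < i2 n)%N & (i2 n <= n)%N] by near: n.
exact: low_gap_decr d1 h1 h2 h3.
Unshelve. all: by end_near. Qed.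

Lemma near_high12 : \forall n \near \oo, b1 n < b2 n.
Proof.
near=> n; have d1 : 1 <= dl n by near: n; exact: near_dHC_ge.
have [h1 h2 h3] : [/\ (0 < i1 n)%N, (i1 n < i2 n)%N & (i2 n <= n)%N] by near: n.
exact: high_gap_incr d1 h1 h2 h3.
Unshelve. all: by end_near. Qed.

Lemma near_E_gt0 : \forall n \near \oo, 0 < E n.
Proof. by apply: filterS (near_gap_eqs t r1) => n []. Qed.

(** The high gaps contribute o(1) to the shift gap. *)
Lemma shift_gap_low (lam : R) :
  (fun n => dl n ^+ 2 * b1 n) @ \oo --> (0 : R) -> (fun n => dl n ^+ 2 * b2 n) @ \oo --> (0 : R) ->
  (gap_diff t a1 a2 @ \oo --> lam -> sg @ \oo --> lam) /\
  (sg @ \oo --> lam -> gap_diff t a1 a2 @ \oo --> lam).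
Proof.
move=> d1 d2; have dd := seqlimB d2 d1; rewrite subr0 in dd.
split=> h.
  apply: (seqlim_eq (seqlimD h dd)); last exact: addr0.
  by apply: nearW => n; rewrite /gap_diff /shift_gap; ring.
apply: (seqlim_eq (seqlimB h dd)); last exact: subr0.
by apply: nearW => n; rewrite /gap_diff /shift_gap; ring.
Qed.

Lemma shift_gap_high (lam : R) :
  (fun n => dl n ^+ 2 * a1 n) @ \oo --> (0 : R) -> (fun n => dl n ^+ 2 * a2 n) @ \oo --> (0 : R) ->
  (gap_diff t b2 b1 @ \oo --> lam -> sg @ \oo --> lam) /\
  (sg @ \oo --> lam -> gap_diff t b2 b1 @ \oo --> lam).
Proof.
move=> d1 d2; have dd := seqlimB d1 d2; rewrite subr0 in dd.
split=> h.
  apply: (seqlim_eq (seqlimD h dd)); last exact: addr0.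
  by apply: nearW => n; rewrite /gap_diff /shift_gap; ring.
apply: (seqlim_eq (seqlimB h dd)); last exact: subr0.
by apply: nearW => n; rewrite /gap_diff /shift_gap; ring.
Qed.

Let norm1 : `|1 : R| <= 1. Proof. by rewrite normr1. Qed.
Let normN1 : `|-1 : R| <= 1. Proof. by rewrite normrN1. Qed.

Section B0.
Hypotheses (c1 : @classB0 R i1) (c2 : @classB0 R i2).

Let i1R0 : \forall n \near \oo, 0 < (i1 n)%:R :> R.
Proof. by apply: filterS h12 => n [h _ _]; rewrite ltr0n. Qed.

Let low21 : \forall n \near \oo, a2 n <= a1 n.
Proof. by apply: filterS near_low12 => n /ltW. Qed.

Lemma B0_sqrt_gt0 : \forall n \near \oo, 0 < Num.sqrt ((i1 n)%:R / u n ^+ 3).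
Proof.
near=> n; have i0 : 0 < (i1 n)%:R :> R by near: n.
have u0 : 0 < u n by near: n; exact: near_u_gt0.
by rewrite sqrtr_gt0 divr_gt0// exprn_gt0.
Unshelve. all: by end_near. Qed.

Lemma B0_gap_limit (v : nat -> R) (c : R) : v @ \oo --> c ->
  (\forall n \near \oo, (i1 n)%:R / (i2 n)%:R = 1 - v n * Num.sqrt ((i1 n)%:R / u n ^+ 3)) ->
  gap_limit 0 0 (c * Num.sqrt 8 / 2).
Proof.
move=> vc hv; have [a1c b1c da1 db1] := classB0_gaps t r1 c1.
have [a2c b2c da2 db2] := classB0_gaps t r2 c2.
split=> //; apply: (shift_gap_low _ db1 db2).1.
exact: (gap_diff_of_quotient norm1 (near_low_gt0 t r1) (near_low_gt0 t r2) near_E_gt0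
  (near_low_eq t r1) (near_low_eq t r2) i1R0 low21 a1c a2c da1 vc hv).
Qed.

Lemma B0_quotient (lam : R) : sg @ \oo --> lam ->
  (fun n => (1 - (i1 n)%:R / (i2 n)%:R) / Num.sqrt ((i1 n)%:R / u n ^+ 3)) @ \oo
    --> lam * 2 / Num.sqrt 8.
Proof.
move=> sl; have [a1c b1c da1 db1] := classB0_gaps t r1 c1.
have [a2c b2c da2 db2] := classB0_gaps t r2 c2.
exact: (quotient_of_gap_diff (near_low_gt0 t r1) (near_low_gt0 t r2) near_E_gt0
  (near_low_eq t r1) (near_low_eq t r2) i1R0 low21 a1c a2c da1 ((shift_gap_low lam db1 db2).2 sl)).
Qed.

End B0.

Section Bbar0.
Hypotheses (c1 : @classBbar0 R i1) (c2 : @classBbar0 R i2).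

Let j2R0 : \forall n \near \oo, 0 < corank i2 n :> R.
Proof. exact: near_div_u_gt0 c2.1. Qed.

Let high12 : \forall n \near \oo, b1 n <= b2 n.
Proof. by apply: filterS near_high12 => n /ltW. Qed.

Lemma Bbar0_sqrt_gt0 : \forall n \near \oo, 0 < Num.sqrt (corank i2 n / u n ^+ 3).
Proof.
near=> n; have i0 : 0 < corank i2 n :> R by near: n.
have u0 : 0 < u n by near: n; exact: near_u_gt0.
by rewrite sqrtr_gt0 divr_gt0// exprn_gt0.
Unshelve. all: by end_near. Qed.

Lemma Bbar0_gap_limit (v : nat -> R) (c : R) : v @ \oo --> c ->
  (\forall n \near \oo, corank i2 n / corank i1 n = 1 - v n * Num.sqrt (corank i2 n / u n ^+ 3)) ->
  gap_limit 0 0 (c * Num.sqrt 8 / 2).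
Proof.
move=> vc hv; have [a1c b1c db1 da1] := classBbar0_gaps t r1 c1.
have [a2c b2c db2 da2] := classBbar0_gaps t r2 c2.
split=> //; apply: (shift_gap_high _ da1 da2).1.
exact: (gap_diff_of_quotient normN1 (near_high_gt0 t r2) (near_high_gt0 t r1) near_E_gt0
  (near_high_eq t r2) (near_high_eq t r1) j2R0 high12 b2c b1c db2 vc hv).
Qed.

Lemma Bbar0_quotient (lam : R) : sg @ \oo --> lam ->
  (fun n => (1 - corank i2 n / corank i1 n) / Num.sqrt (corank i2 n / u n ^+ 3)) @ \oo
    --> lam * 2 / Num.sqrt 8.
Proof.
move=> sl; have [a1c b1c db1 da1] := classBbar0_gaps t r1 c1.
have [a2c b2c db2 da2] := classBbar0_gaps t r2 c2.
exact: (quotient_of_gap_diff (near_high_gt0 t r2) (near_high_gt0 t r1) near_E_gt0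
  (near_high_eq t r2) (near_high_eq t r1) j2R0 high12 b2c b1c db2
  ((shift_gap_high lam da1 da2).2 sl)).
Qed.

End Bbar0.

(** Here z = eps / x with eps = d^2 / n, and d^2 eps tends to 0. *)
Lemma scaled_other_cvg0 (x z : nat -> R) (r : R) :
  (\forall n \near \oo, 0 < x n) -> (\forall n \near \oo, z n * x n = E n) ->
  (fun n => (x n)^-1) @ \oo --> r -> (fun n => dl n ^+ 2 * z n) @ \oo --> (0 : R).
Proof.
move=> x0 zx xr; apply: (seqlim_eq (seqlimM (dHC_pow_eps_cvg0 t 2) xr)); last exact: mul0r.
near=> n; have xn : 0 < x n by near: n.
have <- : z n * x n = E n by near: n.
by rewrite mulrA mulfK// gt_eqF.
Unshelve. all: by end_near. Qed.

Lemma inv_inv_cvg (x : nat -> R) (r : R) : r != 0 ->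
  (fun n => (x n)^-1) @ \oo --> r -> x @ \oo --> r^-1.
Proof.
move=> r0 xr; apply: (seqlim_eq (seqlimV xr r0)) => //.
by apply: nearW => n; rewrite invrK.
Qed.

(** For ranks of order u the rank difference is asymptotically proportional to the shift gap.
    Both directions are used: from rank differences to ratios, and back in the last claim. *)
Lemma low_rank_diff (r : R) : 0 < r -> (fun n => (a1 n)^-1) @ \oo --> r ->
  (fun n => (a2 n)^-1) @ \oo --> r ->
  exists k : R, 0 < k /\ forall l : R,
    ((fun n => (i2 n)%:R - (i1 n)%:R) @ \oo --> l -> sg @ \oo --> l / k) /\
    (sg @ \oo --> l -> (fun n => (i2 n)%:R - (i1 n)%:R : R) @ \oo --> l * k).
Proof.
move=> r0 a1r a2r; have rN : r != 0 by rewrite gt_eqF.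
have xi0 : 0 < r^-1 by rewrite invr_gt0.
have p0 : 0 < 2 * r^-1 + 1 * r^-1 ^+ 2 by rewrite addr_gt0 ?mulr_gt0 ?exprn_gt0.
have [psi [k k0 [pk pe]]] := rank_diff_cvg near_E_gt0 (near_low_eq t r1) (near_low_eq t r2)
  xi0 p0 (inv_inv_cvg rN a1r) (inv_inv_cvg rN a2r).
have kN : k != 0 by rewrite gt_eqF.
have db1 := scaled_other_cvg0 (near_low_gt0 t r1) (near_low_high t r1) a1r.
have db2 := scaled_other_cvg0 (near_low_gt0 t r2) (near_low_high t r2) a2r.
exists k; split=> // l; split=> h.
  apply: (shift_gap_low _ db1 db2).1.
  apply: (seqlim_eq (seqlimM h (seqlimV pk kN))) => //; near=> n.
  have ps0 : 0 < psi n by near: n; exact: (seqlim_gt0_near k0 pk).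
  have -> : (i2 n)%:R - (i1 n)%:R = gap_diff t a1 a2 n * psi n by near: n.
  by rewrite mulfK// gt_eqF.
have gl := (shift_gap_low l db1 db2).2 h.
apply: (seqlim_eq (seqlimM gl pk)) => //.
by apply: filterS pe => n ->.
Unshelve. all: by end_near. Qed.

Lemma high_rank_diff (q : R) : 0 < q -> q <= 1 -> b1 @ \oo --> q -> b2 @ \oo --> q ->
  exists k : R, 0 < k /\ forall l : R,
    ((fun n => (i2 n)%:R - (i1 n)%:R) @ \oo --> l -> sg @ \oo --> l / k) /\
    (sg @ \oo --> l -> (fun n => (i2 n)%:R - (i1 n)%:R : R) @ \oo --> l * k).
Proof.
move=> q0 q1 b1q b2q; have qN : q != 0 by rewrite gt_eqF.
have p0 : 0 < 2 * q + -1 * q ^+ 2.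
  have : 0 <= q * (1 - q) by rewrite mulr_ge0 ?(ltW q0)// subr_ge0.
  rewrite expr2; lra.
have [psi [k k0 [pk pe]]] := rank_diff_cvg near_E_gt0 (near_high_eq t r2) (near_high_eq t r1)
  q0 p0 b2q b1q.
have kN : k != 0 by rewrite gt_eqF.
have da1 := scaled_other_cvg0 (near_high_gt0 t r1) (near_high_low t r1) (seqlimV b1q qN).
have da2 := scaled_other_cvg0 (near_high_gt0 t r2) (near_high_low t r2) (seqlimV b2q qN).
have pe' : \forall n \near \oo, (i2 n)%:R - (i1 n)%:R = gap_diff t b2 b1 n * psi n.
  by apply: filterS pe => n <-; rewrite /corank; ring.
exists k; split=> // l; split=> h.
  apply: (shift_gap_high _ da1 da2).1.
  apply: (seqlim_eq (seqlimM h (seqlimV pk kN))) => //; near=> n.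
  have ps0 : 0 < psi n by near: n; exact: (seqlim_gt0_near k0 pk).
  have -> : (i2 n)%:R - (i1 n)%:R = gap_diff t b2 b1 n * psi n by near: n.
  by rewrite mulfK// gt_eqF.
have gl := (shift_gap_high l da1 da2).2 h.
apply: (seqlim_eq (seqlimM gl pk)) => //.
by apply: filterS pe' => n ->.
Unshelve. all: by end_near. Qed.

Lemma const_rank_diff (m : nat) : (\forall n \near \oo, i2 n = i1 n + m)%N ->
  (0 < m)%N /\ (fun n => (i2 n)%:R - (i1 n)%:R : R) @ \oo --> (m%:R : R).
Proof.
move=> hm; split.
  have [n [[_ h _] e]] := filter_ex (filterI h12 hm).
  by move: h; rewrite e -[X in (X < _)%N]addn0 ltn_add2l.
apply: (seqlim_eq (seqlim_cst (m%:R : R))) => //.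
by apply: filterS hm => n ->; rewrite natrD addrC addKr.
Qed.

(** A convergent sequence of integers is eventually constant. *)
Lemma rank_diff_const (l : R) : (fun n => (i2 n)%:R - (i1 n)%:R : R) @ \oo --> l ->
  exists m : nat, \forall n \near \oo, (i2 n = i1 n + m)%N.
Proof.
move=> h; have h' : (fun n => (i2 n - i1 n)%:R : R) @ \oo --> l.
  apply: (seqlim_eq h) => //; apply: filterS h12 => n [_ lt _].
  by rewrite natrB// ltnW.
have [m hm] := nat_cvg_eventually_cst h'; exists m.
by apply: filterS (filterI h12 hm) => n [[_ lt _] <-]; rewrite subnKC// ltnW.
Qed.

End ratio_limits.

(** * The three kinds of limit *)

Section trichotomy.
Context {R : realType}.
Variables (t : R) (i1 i2 : nat -> nat).
Hypothesis h12 : \forall n \near \oo, [/\ (0 < i1 n)%N, (i1 n < i2 n)%N & (i2 n <= n)%N].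
Local Notation u := (@u R).
Local Notation dl := (@dHC R t).
Local Notation a1 := (low_seq t i1).
Local Notation b1 := (high_seq t i1).
Local Notation a2 := (low_seq t i2).
Local Notation b2 := (high_seq t i2).
Local Notation ratio := (level_ratio t i1 i2).
Local Notation sg := (shift_gap t i1 i2).

Let r1 := near_rank1 h12.
Let r2 := near_rank2 h12.

Lemma negligible_ratio : negligible_gap R i1 i2 -> ratio @ \oo --> (1 : R).
Proof.
case=> [c1 c2|c c0 c1 c2|c c0 c1 c2|c1 c2 lo|c1 c2 lo].
- have := central_gap_limit (classC_central t r1 c1) (classC_central t r2 c2).
  by rewrite subrr => /(gap_limit_ratio1 h12).
- have := central_gap_limit (classB_central t r1 c0 c1) (classB_central t r2 c0 c2).
  by rewrite subrr => /(gap_limit_ratio1 h12).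
- have := central_gap_limit (classBbar_central t r1 c0 c1) (classBbar_central t r2 c0 c2).
  by rewrite subrr => /(gap_limit_ratio1 h12).
- have s0 := B0_sqrt_gt0 (R := R) h12.
  have := B0_gap_limit t h12 c1 c2 (littleo1_quotient s0 lo) (near_quotientE _ s0).
  by rewrite !mul0r => /(gap_limit_ratio1 h12).
have s0 := Bbar0_sqrt_gt0 (R := R) c2.
have := Bbar0_gap_limit t h12 c1 c2 (littleo1_quotient s0 lo) (near_quotientE _ s0).
by rewrite !mul0r => /(gap_limit_ratio1 h12).
Qed.

Lemma quad_root_uniq (x y : R) : 0 <= x -> 0 <= y -> x ^+ 2 + x = y ^+ 2 + y -> x = y.
Proof.
move=> x0 y0 e; apply/eqP; rewrite -subr_eq0.
have : (x - y) * (x + y + 1) = 0.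
  by transitivity (x ^+ 2 + x - (y ^+ 2 + y)); [ring|rewrite e subrr].
move/eqP; rewrite mulf_eq0 => /orP[//|/eqP h]; exfalso; lra.
Qed.

Lemma sqrt8_div_lt (x y : R) : 0 < x -> x < y -> Num.sqrt (8 / y) < Num.sqrt (8 / x).
Proof.
move=> x0 xy; have y0 : 0 < y by exact: lt_trans xy.
by rewrite ltr_sqrt ?divr_gt0// ltr_pM2l// ltf_pV2 ?posrE.
Qed.

Lemma sqrt8_div_gt0 (x : R) : 0 < x -> 0 < Num.sqrt (8 / x).
Proof. by move=> x0; rewrite sqrtr_gt0 divr_gt0. Qed.

Lemma critical_ratio : critical_gap R i1 i2 ->
  exists l : R, [/\ ratio @ \oo --> l, 0 < l & l < 1].
Proof.
have s8 : 0 < Num.sqrt 8 :> R by rewrite sqrtr_gt0.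
case=> [c1 c2 c10 c12 k1 k2|c c0 k1 k2|c c' c0 c0' k1 k2|c c0 k1 k2|c1 c2 c20 c21 k1 k2
  |v c k1 k2 hv vc c0|v c k1 k2 hv vc c0|c m c0 k1 k2 hm|c m c0 k1 k2 hm].
- apply: (gap_limit_ratio01 h12 _ (central_gap_limit (classB_central t r1 c10 k1)
    (classB_central t r2 (lt_trans c10 c12) k2))).
  by rewrite subr_gt0 sqrt8_div_lt.
- apply: (gap_limit_ratio01 h12 _ (central_gap_limit (classB_central t r1 c0 k1)
    (classC_central t r2 k2))).
  by rewrite subr0 sqrt8_div_gt0.
- apply: (gap_limit_ratio01 h12 _ (central_gap_limit (classB_central t r1 c0 k1)
    (classBbar_central t r2 c0' k2))).
  by rewrite opprK addr_gt0 ?sqrt8_div_gt0.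
- apply: (gap_limit_ratio01 h12 _ (central_gap_limit (classC_central t r1 k1)
    (classBbar_central t r2 c0 k2))).
  by rewrite sub0r opprK sqrt8_div_gt0.
- apply: (gap_limit_ratio01 h12 _ (central_gap_limit
    (classBbar_central t r1 (lt_trans c20 c21) k1) (classBbar_central t r2 c20 k2))).
  by rewrite opprK addrC subr_gt0 sqrt8_div_lt.
- apply: (gap_limit_ratio01 h12 _ (B0_gap_limit t h12 k1 k2 vc hv)).
  by rewrite divr_gt0// mulr_gt0.
- apply: (gap_limit_ratio01 h12 _ (Bbar0_gap_limit t h12 k1 k2 vc hv)).
  by rewrite divr_gt0// mulr_gt0.
- have [r [r0 rE a1r b1c]] := classA_gaps t r1 (ltW c0) k1.
  have [r' [r0' rE' a2r b2c]] := classA_gaps t r2 (ltW c0) k2.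
  have e : r' = r by apply: quad_root_uniq => //; rewrite rE rE'.
  rewrite {}e in a2r.
  have rp : 0 < r.
    rewrite lt_neqAle r0 andbT; apply/eqP => re; move: rE; rewrite -re expr0n addr0.
    by move=> ce; move: c0; rewrite -(@pmulr_lgt0 _ 2^-1)// -ce ltxx.
  have [m0 mc] := const_rank_diff (R := R) h12 hm.
  have [k [k0 kP]] := low_rank_diff h12 rp a1r a2r.
  have rN : r != 0 by rewrite gt_eqF.
  apply: (@gap_limit_ratio01 _ t _ _ h12 r^-1 0 (m%:R / k)).
    by rewrite divr_gt0// ltr0n.
  split=> //; first by rewrite invr_ge0.
    by split; exact: inv_inv_cvg.
  exact: (kP _).1.
have [q [q0 q1 qE b1c a1c]] := classAbar_gaps t r1 (ltW c0) k1.
have [q' [q0' q1' qE' b2c a2c]] := classAbar_gaps t r2 (ltW c0) k2.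
have e : q' = q.
  have : (q' - q) * (c / 2 * (q' + q) + 1) = 0.
    transitivity (c / 2 * q' ^+ 2 + q' - (c / 2 * q ^+ 2 + q)); first by ring.
    by rewrite qE qE' subrr.
  move/eqP; rewrite mulf_eq0 subr_eq0 => /orP[/eqP//|].
  rewrite gt_eqF// ltr_wpDl// mulr_ge0 ?divr_ge0 ?(ltW c0)// addr_ge0// ltW//.
rewrite {}e in b2c.
have qlt1 : q < 1.
  rewrite lt_neqAle q1 andbT; apply/eqP => qe; move: qE; rewrite qe expr1n; lra.
have [m0 mc] := const_rank_diff (R := R) h12 hm.
have [k [k0 kP]] := high_rank_diff h12 q0 q1 b1c b2c.
apply: (@gap_limit_ratio01 _ t _ _ h12 0 q (m%:R / k)).
  by rewrite divr_gt0// ltr0n.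
by split=> //; exact: (kP _).1.
Qed.

(** The classes grouped by the limit of 1 / (2 + shift), as in classA_inv_shift. The constants
    of classA and classAbar are expressed by the limits of the gaps, so that equal limits give equal
    constants. *)
Inductive shift_regime (i : nat -> nat) : Prop :=
| Regime_low (r : R) of 0 <= r & (fun n => (low_seq t i n)^-1) @ \oo --> r &
    high_seq t i @ \oo --> (0 : R) & classA (2 * (r ^+ 2 + r)) i
| Regime_central of central t i & (fun n => (2 + (low_seq t i n - high_seq t i n))^-1) @ \oo --> (2^-1 : R)
| Regime_high (q : R) of 0 < q & q <= 1 & high_seq t i @ \oo --> q &
    low_seq t i @ \oo --> (0 : R) & classAbar (2 * ((1 - q) / q ^+ 2)) i.

Lemma central_regime i : central t i -> shift_regime i.
Proof.
move=> ci; apply: Regime_central => //; have [ac bc] := ci.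
by have := inv_shift_cvg ac bc (lexx 0) ler01; rewrite subrr addr0.
Qed.

Lemma classified_regime i : (\forall n \near \oo, (0 < i n <= n)%N) -> classified R i -> shift_regime i.
Proof.
move=> hi [c c0 k|k|c c0 k|k|c c0 k|k|c c0 k].
- have [r [r0 rE ar bc]] := classA_gaps t hi c0 k; apply: (@Regime_low i r) => //.
  by rewrite rE mulrC divfK.
- by apply: central_regime; case: (classB0_central t hi k).
- by apply: central_regime; case: (classB_central t hi c0 k).
- by apply: central_regime; case: (classC_central t hi k).
- by apply: central_regime; case: (classBbar_central t hi c0 k).
- by apply: central_regime; case: (classBbar0_central t hi k).
have [q [q0 q1 qE bc ac]] := classAbar_gaps t hi c0 k; apply: (@Regime_high i q) => //.
have -> : 1 - q = c / 2 * q ^+ 2 by move: qE; lra.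
by rewrite mulfK ?expf_neq0 ?gt_eqF// mulrC divfK.
Qed.

(** The shift decreases with the rank; if the limits differ, the rates are separated. *)
Lemma ratio_same_inv_shift (p1 p2 : R) :
  (fun n => (2 + (a1 n - b1 n))^-1) @ \oo --> p1 ->
  (fun n => (2 + (a2 n - b2 n))^-1) @ \oo --> p2 ->
  ratio @ \oo --> (0 : R) \/ p1 = p2.
Proof.
move=> l1 l2; have p12 : p1 <= p2.
  apply: (seqlim_le _ l1 l2); near=> n.
  have a10 : 0 < a1 n by near: n; exact: near_low_gt0.
  have a20 : 0 < a2 n by near: n; exact: near_low_gt0.
  have la : a2 n < a1 n by near: n; exact: near_low12.
  have lb : b1 n < b2 n by near: n; exact: near_high12.
  have [|[_ _ b2l] _ _ _ _] := near (near_gap_eqs t r2) n; first by [].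
  by rewrite lef_pV2 ?posrE; lra.
move: p12; rewrite le_eqVlt => /predU1P[|p12]; first by right.
by left; exact: level_ratio_separated l1 l2.
Unshelve. all: by end_near. Qed.

(** A nonzero limit l of the ratio forces the shift gap to tend to - ln l divided by the
    slope. *)
Lemma ratio_or_gap (x y : R) : 0 <= x -> y < 1 -> a1 @ \oo --> x -> a2 @ \oo --> x ->
  b1 @ \oo --> y -> b2 @ \oo --> y -> cvg (ratio @ \oo) ->
  ratio @ \oo --> (0 : R) \/ exists2 lam : R, 0 <= lam & sg @ \oo --> lam.
Proof.
move=> x0 y1 a1x a2x b1y b2y /cvg_ex[/= l rl].
have [l0|l0] := eqVneq l 0; first by left; rewrite -l0.
right; have [lam sl] : exists lam : R, sg @ \oo --> lam.
  exact: (shift_gap_cvg h12 x0 y1 a1x a2x b1y b2y rl l0).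
exists lam => //; apply: (seqlim_le _ (seqlim_cst (0 : R)) sl).
by apply: filterS (near_shift_gap_gt0 t h12) => n /ltW.
Qed.

Lemma scaled_shift_ge_lim (s1 s2 : R) : scaled_shift t i1 @ \oo --> s1 ->
  scaled_shift t i2 @ \oo --> s2 -> s2 <= s1.
Proof.
move=> c1 c2; apply: (seqlim_le _ c2 c1).
by apply: filterS (near_shift_gap_gt0 t h12) => n; rewrite scaled_shift_sub subr_gt0 => /ltW.
Qed.

Lemma shift_gap_not_Ny : (fun n => - sg n) @ \oo --> +oo -> False.
Proof.
move=> /cvgry_gt/(_ 0) h.
have [n [h1 h2]] := filter_ex (filterI h (near_shift_gap_gt0 t h12)).
by move: h1; rewrite oppr_gt0 ltNge ltW.
Qed.

(** Within the central regime, the limit of d^2 times the shift separates the classes, including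
    their constants. *)
Inductive central_kind (i : nat -> nat) : Prop :=
| Kind_B0 of classB0 (R := R) i & scaled_shift t i @ \oo --> +oo
| Kind_Bbar0 of classBbar0 (R := R) i & (fun n => - scaled_shift t i n) @ \oo --> +oo
| Kind_mid (s : R) of scaled_shift t i @ \oo --> s &
   [\/ exists2 c : R, 0 < c & s = Num.sqrt (8 / c) /\ classB c i,
       s = 0 /\ classC (R := R) i |
       exists2 c : R, 0 < c & s = - Num.sqrt (8 / c) /\ classBbar c i].

Lemma central_kindP i : (\forall n \near \oo, (0 < i n <= n)%N) -> classified R i ->
  central t i -> central_kind i.
Proof.
move=> hi k [ac bc].
have noA (c : R) : 0 <= c -> classA c i -> False.
  move=> c0 kc; have [r [r0 rE ar _]] := classA_gaps t hi c0 kc.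
  have hy := seqlim_invy (near_low_gt0 t hi) ac.
  exact: seqlim_not_y ar hy.
have noAb (c : R) : 0 <= c -> classAbar c i -> False.
  move=> c0 kc; have [q [q0 _ _ bq _]] := classAbar_gaps t hi c0 kc.
  by move: q0; rewrite (seqlim_uniq bq bc) ltxx.
case: k => [c c0 k|k|c c0 k|k|c c0 k|k|c c0 k].
- by have := noA _ c0 k.
- by have [_ sc] := classB0_central t hi k; exact: Kind_B0.
- have [_ sc] := classB_central t hi c0 k; apply: (Kind_mid sc).
  by apply: Or31; exists c.
- by have [_ sc] := classC_central t hi k; apply: (Kind_mid sc); apply: Or32.
- have [_ sc] := classBbar_central t hi c0 k; apply: (Kind_mid sc).
  by apply: Or33; exists c.
- by have [_ sc] := classBbar0_central t hi k; exact: Kind_Bbar0.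
by have := noAb _ c0 k.
Qed.

Lemma central_ratio : classified R i1 -> classified R i2 -> central t i1 -> central t i2 ->
  ~ negligible_gap R i1 i2 -> ~ critical_gap R i1 i2 -> cvg (ratio @ \oo) ->
  ratio @ \oo --> (0 : R).
Proof.
move=> k1 k2 cen1 cen2 nN nC rc; have [a1c b1c] := cen1; have [a2c b2c] := cen2.
have sub0N : 0 - 0 = 0 :> R by rewrite subrr.
have to0 : sg @ \oo --> +oo -> ratio @ \oo --> (0 : R).
  exact: (level_ratio_cvg0 h12 (lexx 0) ltr01 a1c a2c b1c b2c).
have s8 : 0 < Num.sqrt 8 :> R by rewrite sqrtr_gt0.
have sgE (f : nat -> R) : (\forall n \near \oo, f n = sg n) -> f @ \oo --> +oo -> sg @ \oo --> +oo.
  by move=> fe; apply: cvg_trans; apply: near_eq_cvg; apply: filterS fe => n ->.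
have sgN (f : nat -> R) : (\forall n \near \oo, f n = - sg n) -> f @ \oo --> +oo -> False.
  move=> fe fy; apply: shift_gap_not_Ny; apply: cvg_trans fy.
  by apply: near_eq_cvg; apply: filterS fe => n ->.
case: (central_kindP r1 k1 cen1) => [B1 s1c|B1 s1c|s1 s1c kind1].
- case: (central_kindP r2 k2 cen2) => [B2 s2c|B2 s2c|s2 s2c kind2].
  + have [//|[lam lam0 sl]] := ratio_or_gap (lexx 0) ltr01 a1c a2c b1c b2c rc.
    have vq := B0_quotient h12 B1 B2 sl; have s0 := B0_sqrt_gt0 (R := R) h12.
    exfalso; move: lam0; rewrite le_eqVlt => /predU1P[lE|l0].
      apply: nN; apply: Gap0_B0 => //; apply: quotient_littleo1 s0 _.
      by move: vq; rewrite -lE !mul0r.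
    apply: nC; apply: (Gap1_B0 B1 B2 (near_quotientE _ s0) vq).
    by rewrite divr_gt0 ?mulr_gt0.
  + apply: to0; apply: (sgE _ _ (seqlimDyy s1c s2c)).
    by apply: nearW => n; rewrite scaled_shift_sub.
  apply: to0; apply: (sgE _ _ (seqlimDy s1c (seqlimN s2c))).
  by apply: nearW => n; rewrite scaled_shift_sub.
- case: (central_kindP r2 k2 cen2) => [B2 s2c|B2 s2c|s2 s2c kind2].
  + exfalso; apply: (sgN _ _ (seqlimDyy s1c s2c)).
    by apply: nearW => n; rewrite scaled_shift_sub; ring.
  + have [//|[lam lam0 sl]] := ratio_or_gap (lexx 0) ltr01 a1c a2c b1c b2c rc.
    have vq := Bbar0_quotient h12 B1 B2 sl; have s0 := Bbar0_sqrt_gt0 (R := R) B2.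
    exfalso; move: lam0; rewrite le_eqVlt => /predU1P[lE|l0].
      apply: nN; apply: Gap0_Bbar0 => //; apply: quotient_littleo1 s0 _.
      by move: vq; rewrite -lE !mul0r.
    apply: nC; apply: (Gap1_Bbar0 B1 B2 (near_quotientE _ s0) vq).
    by rewrite divr_gt0 ?mulr_gt0.
  exfalso; apply: (sgN _ _ (seqlimDy s1c s2c)).
  by apply: nearW => n; rewrite scaled_shift_sub; ring.
case: (central_kindP r2 k2 cen2) => [B2 s2c|B2 s2c|s2 s2c kind2].
- exfalso; apply: (sgN _ _ (seqlimDy s2c (seqlimN s1c))).
  by apply: nearW => n; rewrite scaled_shift_sub; ring.
- apply: to0; apply: (sgE _ _ (seqlimDy s2c s1c)).
  by apply: nearW => n; rewrite scaled_shift_sub; ring.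
have s12 := scaled_shift_ge_lim s1c s2c.
have inj (c c' : R) : 0 < c -> 0 < c' -> Num.sqrt (8 / c') <= Num.sqrt (8 / c) ->
    c = c' \/ c < c'.
  move=> c0 c0' le; have [lt|gt|->] := ltgtP c c'; [by right| |by left].
  by move: le; rewrite leNgt sqrt8_div_lt.
exfalso; case: kind1 => [[c c0 [e1 B1]]|[e1 B1]|[c c0 [e1 B1]]];
  case: kind2 => [[c' c0' [e2 B2]]|[e2 B2]|[c' c0' [e2 B2]]]; rewrite {}e1 {}e2 in s12.
- have [e|lt] := inj _ _ c0 c0' s12; first by apply: nN; subst c'; exact: Gap0_B B1 B2.
  by apply: nC; exact: Gap1_B_B c0 lt B1 B2.
- by apply: nC; exact: Gap1_B_C c0 B1 B2.
- by apply: nC; exact: Gap1_B_Bbar c0 c0' B1 B2.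
- by have := sqrt8_div_gt0 c0'; rewrite ltNge s12.
- by apply: nN; exact: Gap0_C.
- by apply: nC; exact: Gap1_C_Bbar c0' B1 B2.
- have := sqrt8_div_gt0 c0; have := sqrt8_div_gt0 c0'; lra.
- have := sqrt8_div_gt0 c0; lra.
rewrite lerN2 in s12.
have [e|lt] := inj _ _ c0' c0 s12; first by apply: nN; subst c'; exact: Gap0_Bbar B1 B2.
by apply: nC; exact: Gap1_Bbar_Bbar c0' lt B1 B2.
Qed.

(** If the ratio has a limit other than 0, both ranks belong to the same regime and the shift
    gap converges; translated back into ranks this is one of the negligible or critical cases. At
    the extreme ends (r = 0 or q = 1) the ratio tends to 0 outright. *)
Lemma other_ratio : classified R i1 -> classified R i2 ->
  ~ negligible_gap R i1 i2 -> ~ critical_gap R i1 i2 -> cvg (ratio @ \oo) ->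
  ratio @ \oo --> (0 : R).
Proof.
move=> k1 k2 nN nC rc.
have s8 : 0 < Num.sqrt 8 :> R by rewrite sqrtr_gt0.
case: (classified_regime r1 k1) => [r r0 a1r b1c A1|cen1 l1|q q0 q1 b1c a1c A1].
- have l1 := classA_inv_shift r1 r0 a1r b1c.
  have p1 : r / (2 * r + 1) < 2^-1.
    by rewrite ltr_pdivrMr; lra.
  case: (classified_regime r2 k2) => [r' r0' a2r b2c A2|cen2 l2|q q0 q1 b2c a2c A2].
  + have l2 := classA_inv_shift r2 r0' a2r b2c.
    have [//|e] := ratio_same_inv_shift l1 l2.
    have re : r' = r.
      have n1 : 2 * r + 1 != 0 by rewrite gt_eqF//; lra.
      have n2 : 2 * r' + 1 != 0 by rewrite gt_eqF//; lra.
      move/eqP: e; rewrite eqr_div// => /eqP; lra.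
    rewrite {}re in a2r A2 l2 e r0'.
    have [rE|rN] := eqVneq r 0.
      by rewrite rE in a1r a2r; exact: (level_ratio_bottom h12).
    have rp : 0 < r by rewrite lt_neqAle eq_sym rN.
    have ri0 : 0 <= r^-1 by rewrite invr_ge0.
    have [//|[lam lam0 sl]] := ratio_or_gap ri0 ltr01 (inv_inv_cvg rN a1r)
      (inv_inv_cvg rN a2r) b1c b2c rc.
    have [k [k0 kP]] := low_rank_diff h12 rp a1r a2r.
    have [m hm] := rank_diff_const h12 ((kP _).2 sl).
    exfalso; apply: nC; apply: (@Gap1_A _ _ _ (2 * (r ^+ 2 + r)) m) => //.
    by rewrite mulr_gt0// addr_gt0// exprn_gt0.
  + by have [//|e] := ratio_same_inv_shift l1 l2; move: p1; rewrite e ltxx.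
  have l2 := inv_shift_cvg a2c b2c (lexx 0) q1.
  have [//|e] := ratio_same_inv_shift l1 l2.
  move: p1; rewrite e sub0r ltf_pV2 ?posrE; lra.
- case: (classified_regime r2 k2) => [r' r0' a2r b2c A2|cen2 l2|q q0 q1 b2c a2c A2].
  + have l2 := classA_inv_shift r2 r0' a2r b2c.
    have [//|e] := ratio_same_inv_shift l1 l2.
    have : r' / (2 * r' + 1) < 2^-1 by rewrite ltr_pdivrMr; lra.
    by rewrite -e ltxx.
  + exact: central_ratio.
  have l2 := inv_shift_cvg a2c b2c (lexx 0) q1.
  have [//|e] := ratio_same_inv_shift l1 l2.
  have : (2 : R)^-1 < (2 + (0 - q))^-1 by rewrite ltf_pV2 ?posrE; lra.
  by rewrite -e ltxx.
have l1 := inv_shift_cvg a1c b1c (lexx 0) q1.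
case: (classified_regime r2 k2) => [r' r0' a2r b2c A2|cen2 l2|q' q0' q1' b2c a2c A2].
- have l2 := classA_inv_shift r2 r0' a2r b2c.
  have [//|e] := ratio_same_inv_shift l1 l2.
  have : r' / (2 * r' + 1) < 2^-1 by rewrite ltr_pdivrMr; lra.
  by rewrite -e sub0r ltf_pV2 ?posrE; lra.
- have [//|e] := ratio_same_inv_shift l1 l2.
  have : (2 : R)^-1 < (2 + (0 - q))^-1 by rewrite ltf_pV2 ?posrE; lra.
  by rewrite e ltxx.
have l2 := inv_shift_cvg a2c b2c (lexx 0) q1'.
have [//|/invr_inj e] := ratio_same_inv_shift l1 l2.
have qe : q' = q by lra.
rewrite {}qe in b2c A2 l2 e q0' q1'.
have [qE|qN] := eqVneq q 1.
  by rewrite qE in b1c; exact: (level_ratio_top h12).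
have qlt : q < 1 by rewrite lt_neqAle qN.
have [//|[lam lam0 sl]] := ratio_or_gap (lexx 0) qlt a1c a2c b1c b2c rc.
have [k [k0 kP]] := high_rank_diff h12 q0 q1 b1c b2c.
have [m hm] := rank_diff_const h12 ((kP _).2 sl).
exfalso; apply: nC; apply: (@Gap1_Abar _ _ _ (2 * ((1 - q) / q ^+ 2)) m) => //.
by rewrite mulr_gt0// divr_gt0 ?subr_gt0 ?exprn_gt0.
Qed.

End trichotomy.

(** * The theorem *)

Lemma local_levelE {R : realType} {d : measure_display} {T : measurableType d}
    {P : probability T R} (n : nat) (U : 'I_n -> {RV P >-> R}) (t : R) (i : nat) :
  iid_uniform01 U -> 0 < dHC t n -> (0 < i <= n)%N ->
  local_level U t i = rank_level n i (dHC t n).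
Proof.
move=> hU d0 i_n; have [h0 h1 _ _] := hHC_root d0 i_n.
by rewrite /local_level prob_order_stat_lt// ?(ltW h0) ?ltW.
Qed.

Theorem theorem5p1 (R : realType)
    (d : nat -> measure_display) (T : forall n : nat, measurableType (d n))
    (P : forall n : nat, probability (T n) R)
    (U : forall n : nat, 'I_n -> {RV (P n) >-> R})
    (hU : forall n : nat, iid_uniform01 (U n))
    (t : R) (i1 i2 : nat -> nat)
    (hmono1 : nondecreasing_ranks i1) (hmono2 : nondecreasing_ranks i2)
    (hlt : ordered_ranks i1 i2)
    (hcl1 : classified R i1) (hcl2 : classified R i2) :
  let ratio : nat -> R :=
    fun n => local_level (U n) t (i2 n) / local_level (U n) t (i1 n) in
  [/\ negligible_gap R i1 i2 -> ratio @ \oo --> (1 : R),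
      critical_gap R i1 i2 ->
        exists l : R, [/\ ratio @ \oo --> l, 0 < l & l < 1] &
      ~ negligible_gap R i1 i2 -> ~ critical_gap R i1 i2 ->
        cvg (ratio @ \oo) -> ratio @ \oo --> (0 : R)].
Proof.
move=> ratio.
have h12 : \forall n \near \oo, [/\ (0 < i1 n)%N, (i1 n < i2 n)%N & (i2 n <= n)%N].
  by exists 2%N => // n /= n2; exact: hlt.
have rE : \forall n \near \oo, level_ratio t i1 i2 n = ratio n.
  near=> n; have d1 : 1 <= dHC t n by near: n; exact: near_dHC_ge.
  have d0 : 0 < dHC t n by exact: lt_le_trans d1.
  rewrite /ratio !local_levelE//.
    by near: n; exact: near_rank1 h12.
  by near: n; exact: near_rank2 h12.
have lim (l : R) : level_ratio t i1 i2 @ \oo --> l -> ratio @ \oo --> l.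
  by move=> h; apply: (seqlim_eq h rE).
split.
- by move=> /(negligible_ratio t h12)/lim.
- by move=> /(critical_ratio t h12)[l [/lim ? ? ?]]; exists l.
move=> nN nC /cvg_ex[/= l rl]; apply: lim; apply: (other_ratio h12) => //.
apply/cvg_ex; exists l; apply: (seqlim_eq rl) => //.
by apply: filterS rE => n ->.
Unshelve. all: by end_near. Qed.
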